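(* Let $\Omega\subset\mathbb{R}^d$ be a bounded Lipschitz domain, $T>0$, let $\sigma:(0,T)\to\mathbb{R}$ be measurable with $0<\epsilon\le\sigma(t)\le\epsilon^{-1}$, and let $f\in L^\infty(\Omega\times(0,T);\mathbb{R}^d)$. No hypothesis is made on $\nabla\cdot f$ and none on the boundary behaviour of $f$. Then in the class $$\mathcal{X}_\Omega:=\Big\{p\in L^\infty\big([0,T];L^1\cap L^\infty(\Omega)\big):\ \nabla p\in L^2\big([0,T];L^2(\Omega)\big)\Big\}$$ there is at most one no-flux weak solution of $$\partial_tp+\nabla\cdot(fp)-\tfrac12\sigma(t)^2\Delta p=0\ \text{ in }\Omega,\qquad \big(\tfrac12\sigma^2\nabla p-fp\big)\cdot\nu=0\ \text{ on }\partial\Omega,$$ with a given initial condition $p_0\in L^1\cap L^\infty(\Omega)$.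
   Context: $\nu$ is the outer unit normal to $\partial\Omega$. A no-flux weak solution of the Fokker--Planck problem is a function $p\in L^\infty([0,T];L^1\cap L^\infty(\Omega))$ with $p_t\ge0$, $\int_\Omega p_t\,dx=1$, $t\mapsto p_t\mathcal{L}^d$ narrowly continuous, such that with $J:=fp-\tfrac12\sigma^2\nabla p$ one has $J\in L^1([0,T]\times\Omega;\mathbb{R}^d)$ and $$\int_0^T\!\!\int_\Omega\big(p\,\partial_t\varphi+J\cdot\nabla\varphi\big)\,dx\,dt+\int_\Omega p_0\,\varphi(\cdot,0)\,dx=0$$ for every $\varphi\in C^\infty(\bar\Omega\times[0,T))$ vanishing for $t$ near $T$ (no restriction on $\varphi$ at $\partial\Omega$). *)

(* Defs.v *)
From HB Require Import structures.
From mathcomp Require Import all_boot all_order all_algebra.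
From mathcomp Require Import all_classical all_reals all_analysis.

Set Implicit Arguments.
Unset Strict Implicit.
Unset Printing Implicit Defensive.

Import Order.TTheory GRing.Theory Num.Theory.
Import numFieldNormedType.Exports.

Local Open Scope classical_set_scope.
Local Open Scope ring_scope.

(* The product (Borel) sigma-algebra on R^n = 'rV[R]_n, generated by the
   coordinate functions; same construction as the one on n.-tuple T. *)
Definition measure_rV_display : measure_display.
Proof. exact. Qed.

Section measurable_rV.
Variables (R : realType) (n : nat).

Let coord_rV : 'I_n -> 'rV[R]_n -> R := fun i x => x ord0 i.

Let rV_set0 : g_sigma_preimage coord_rV set0.
Proof. exact: sigma_algebra0. Qed.

Let rV_setC A :
  g_sigma_preimage coord_rV A -> g_sigma_preimage coord_rV (~` A).
Proof. exact: sigma_algebraC. Qed.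

Let rV_bigcup (F : (set 'rV[R]_n)^nat) :
  (forall i, g_sigma_preimage coord_rV (F i)) ->
  g_sigma_preimage coord_rV (\bigcup_i F i).
Proof. exact: sigma_algebra_bigcup. Qed.

HB.instance Definition _ := @isMeasurable.Build measure_rV_display
  'rV[R]_n (g_sigma_preimage coord_rV) rV_set0 rV_setC rV_bigcup.

End measurable_rV.

Lemma measurable_coord_rV (R : realType) n (i : 'I_n) :
  measurable_fun [set: 'rV[R]_n] (fun x : 'rV[R]_n => x ord0 i).
Proof.
move=> _ Y mY; rewrite setTI; apply: sub_sigma_algebra => /=.
rewrite -bigcup_seq/=; exists i => /=; first by rewrite mem_index_enum.
by exists Y => //; rewrite setTI.
Qed.

Lemma measurable_fun_rVP d (T : measurableType d) (R : realType) n
    (f : T -> 'rV[R]_n) :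
  (forall i, measurable_fun [set: T] (fun x => f x ord0 i)) ->
  measurable_fun [set: T] f.
Proof.
move=> mf.
suff : g_sigma_preimage (fun i x => f x ord0 i) `<=` measurable.
  rewrite (g_sigma_preimage_comp (fun i (x : 'rV[R]_n) => x ord0 i)) => h _ A mA.
  by apply: h; exists A.
apply: smallest_sub; first exact: sigma_algebra_measurable.
case: n => [|n] in f mf *; first by rewrite big_ord0.
rewrite -bigcup_mkord_ord; apply: bigcup_sub => i Ii.
by move=> A [B mB <-]; exact: mf.
Qed.

(* The last component of the pair becomes the coordinate number 0. *)
Definition cons_rV (R : realType) n (z : 'rV[R]_n * measurableTypeR R) :
  'rV[R]_n.+1 := row_mx (z.2)%:M z.1 : 'rV[R]_(1 + n).

Lemma cons_rV0 (R : realType) n (z : 'rV[R]_n * measurableTypeR R) :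
  cons_rV z ord0 ord0 = z.2.
Proof.
transitivity ((cons_rV z : 'rV[R]_(1 + n)) ord0 (lshift n ord0)).
  by congr (_ _ _); exact/val_inj.
by rewrite row_mxEl mxE eqxx mulr1n.
Qed.

Lemma cons_rVS (R : realType) n (z : 'rV[R]_n * measurableTypeR R) i :
  cons_rV z ord0 (lift ord0 i) = z.1 ord0 i.
Proof.
transitivity ((cons_rV z : 'rV[R]_(1 + n)) ord0 (rshift 1 i)).
  by congr (_ _ _); exact/val_inj.
by rewrite row_mxEr.
Qed.

Lemma measurable_cons_rV (R : realType) n :
  measurable_fun [set: 'rV[R]_n * measurableTypeR R] (@cons_rV R n).
Proof.
apply: measurable_fun_rVP => i; case: (unliftP ord0 i) => [j|] ->.
  under eq_fun do rewrite cons_rVS.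
  exact: (measurableT_comp (measurable_coord_rV j) measurable_fst).
under eq_fun do rewrite cons_rV0.
exact: measurable_snd.
Qed.

Section lebesgue_rV_succ.
Context (R : realType) (n : nat).
Variable mu : {sigma_finite_measure set 'rV[R]_n -> \bar R}.

Definition lebesgue_rV_succ : set 'rV[R]_n.+1 -> \bar R :=
  pushforward (mu \x (@lebesgue_measure R))%E (@cons_rV R n).

Let m : {measure
    set ('rV[R]_n * measurableTypeR R)%type -> \bar R} :=
  (mu \x (@lebesgue_measure R))%E.

Let lebesgue_rV_succ0 : lebesgue_rV_succ set0 = 0%E.
Proof. by rewrite /lebesgue_rV_succ /pushforward preimage_set0 measure0. Qed.

Let lebesgue_rV_succ_ge0 A : (0 <= lebesgue_rV_succ A)%E.
Proof.
exact: (measure_ge0 m).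
Qed.

Let lebesgue_rV_succ_sigma_additive : semi_sigma_additive lebesgue_rV_succ.
Proof.
move=> F mF tF mUF; rewrite /lebesgue_rV_succ /pushforward preimage_bigcup.
apply: (@measure_semi_sigma_additive _ _ _ m).
- by move=> k; rewrite -[X in measurable X]setTI; exact: measurable_cons_rV.
- apply/trivIsetP => /= i j _ _ ij; rewrite -preimage_setI.
  by move/trivIsetP : tF => /(_ _ _ _ _ ij) ->//; rewrite preimage_set0.
- rewrite -preimage_bigcup -[X in measurable X]setTI.
  exact: measurable_cons_rV.
Qed.

HB.instance Definition _ := isMeasure.Build _ _ _ lebesgue_rV_succ
  lebesgue_rV_succ0 lebesgue_rV_succ_ge0 lebesgue_rV_succ_sigma_additive.

Let lebesgue_rV_succ_sigma_finite : sigma_finite setT lebesgue_rV_succ.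
Proof.
have /sigma_finiteP[F [TF ndF Foo]] := sigma_finiteT mu.
have /sigma_finiteP[G [TG ndG Goo]] := sigma_finiteT (@lebesgue_measure R).
pose g (x : 'rV[R]_n.+1) : 'rV[R]_n * measurableTypeR R :=
  (rsubmx (x : 'rV[R]_(1 + n)), x ord0 ord0).
have gK z : g (cons_rV z) = z.
  by case: z => v a; rewrite /g cons_rV0 /cons_rV row_mxKr.
have mg : measurable_fun setT g.
  apply/measurable_fun_pairP; split.
    apply: measurable_fun_rVP => i.
    rewrite (_ : (fun _ => _) =
      (fun x : 'rV[R]_n.+1 => x ord0 (rshift 1 i : 'I_n.+1))).
      exact: measurable_coord_rV.
    by apply/funext => x; rewrite /g/= mxE.
  exact: measurable_coord_rV.
exists (fun k => g @^-1` (F k `*` G k)).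
  rewrite -preimage_bigcup (_ : \bigcup_k _ = setT) ?preimage_setT//.
  rewrite -subTset => -[x y] _.
  have : setT x by []. have : setT y by [].
  rewrite TF TG => -[k _ Gky] [l _ Flx]; exists (maxn l k) => //; split.
  - by move: x Flx; exact/subsetPset/ndF/leq_maxl.
  - by move: y Gky; exact/subsetPset/ndG/leq_maxr.
move=> k; have [mF Fkoo] := Foo k; have [mG Gkoo] := Goo k; split.
  by rewrite -[X in measurable X]setTI; apply: mg => //; exact: measurableX.
rewrite /lebesgue_rV_succ /pushforward -comp_preimage.
rewrite (_ : g \o _ = id); last by apply/funext => z /=; rewrite gK.
by rewrite preimage_id product_measure1E// lte_mul_pinfty// ge0_fin_numE.
Qed.

HB.instance Definition _ := Measure_isSigmaFinite.Build _ _ _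
  lebesgue_rV_succ lebesgue_rV_succ_sigma_finite.

End lebesgue_rV_succ.

Section lebesgue_rV0.
Context (R : realType).

Definition lebesgue_rV0 : set 'rV[R]_0 -> \bar R := \d_(0 : 'rV[R]_0).

HB.instance Definition _ := Measure.on lebesgue_rV0.

Let lebesgue_rV0_sigma_finite : sigma_finite setT lebesgue_rV0.
Proof.
exists (fun=> setT); first by rewrite bigcup_const.
by move=> _; split=> //; rewrite /lebesgue_rV0 diracT ltry.
Qed.

HB.instance Definition _ := Measure_isSigmaFinite.Build _ _ _
  lebesgue_rV0 lebesgue_rV0_sigma_finite.

End lebesgue_rV0.

(* Lebesgue measure on R^n, as the n-fold product of lebesgue_measure. *)
Fixpoint lebesgue_rV (R : realType) (n : nat) :
    {sigma_finite_measure set 'rV[R]_n -> \bar R} :=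
  match n with
  | 0 => @lebesgue_rV0 R
  | m.+1 => lebesgue_rV_succ (@lebesgue_rV R m)
  end.
Arguments lebesgue_rV R n : clear implicits.

(* u belongs to L^q(D, mu); u is only looked at on D. *)
Definition in_Lebesgue d (X : measurableType d) (R : realType)
    (mu : {measure set X -> \bar R}) (q : \bar R) (D : set X) (u : X -> R) :=
  measurable_fun D u /\ ('N[mu]_q[EFin \o (u \_ D)] < +oo)%E.

Section Fokker_Planck.
Context (R : realType).

(* C^infinity: every iterated directional derivative is differentiable. *)
Definition smooth (V : normedModType R) (phi : V -> R) :=
  forall (vs : seq V) (x : V),
    differentiable (foldr (fun v h => 'D_v h) phi vs) x.

(* Near every boundary point, and after a change of orthonormal coordinates
   (the orthogonal matrix Q), Omega is the strict epigraph of a Lipschitz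
   function gamma; the coordinate number 0 plays the role of the vertical one. *)
Definition Lipschitz_boundary n (Omega : set 'rV[R]_n.+1) :=
  forall x0, (closure Omega `\` Omega°) x0 ->
  exists (Q : 'M[R]_n.+1) (gamma : 'rV[R]_n -> R),
    [/\ Q *m Q^T = 1%:M, lipschitz gamma &
        \forall x \near x0, Omega x <->
          gamma (rsubmx (x *m Q : 'rV[R]_(1 + n))) < (x *m Q) ord0 ord0].

Definition bounded_Lipschitz_domain n (Omega : set 'rV[R]_n.+1) :=
  [/\ Omega !=set0, open Omega, connected Omega, bounded_set Omega &
      Lipschitz_boundary Omega].

Section fixed_domain.
Variables (n : nat) (Omega : set 'rV[R]_n).

Local Notation vol := (lebesgue_rV R n).

(* Lebesgue measure dt dx on space-time. *)
Definition vol_tx :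
    {measure set (measurableTypeR R * 'rV[R]_n)%type -> \bar R} :=
  (@lebesgue_measure R \x vol)%E.

Definition Cc_infty (phi : 'rV[R]_n -> R) :=
  smooth phi /\
  exists K, [/\ compact K, K `<=` Omega & forall x, ~ K x -> phi x = 0].

(* g is the weak (distributional) gradient of u in Omega. *)
Definition weak_gradient (u : 'rV[R]_n -> R) (g : 'rV[R]_n -> 'rV[R]_n) :=
  (forall K, compact K -> K `<=` Omega ->
     vol.-integrable K (EFin \o u) /\
     forall i, vol.-integrable K (fun x => (g x ord0 i)%:E)) /\
  forall phi, Cc_infty phi -> forall i,
    \int[vol]_(x in Omega) (u x * 'D_(delta_mx ord0 i) phi x) =
    - \int[vol]_(x in Omega) (g x ord0 i * phi x).

(* L^r(I; L^q(Omega)), as jointly measurable functions with finite mixed norm. *)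
Definition in_mixed_Lebesgue (I : set R) (r q : \bar R)
    (u : R -> 'rV[R]_n -> R) :=
  measurable_fun (I `*` Omega)
    (fun z : measurableTypeR R * 'rV[R]_n => u z.1 z.2) /\
  ('N[@lebesgue_measure R]_r
     [(fun t => 'N[vol]_q[EFin \o (u t \_ Omega)]) \_ I] < +oo)%E.

Variable T : R.

(* L^oo([0,T]; L^1 /\ L^oo(Omega)). *)
Definition in_Linfty_L1Linfty (p : R -> 'rV[R]_n -> R) :=
  in_mixed_Lebesgue `[0, T] +oo%E 1%E p /\
  in_mixed_Lebesgue `[0, T] +oo%E +oo%E p.

(* g = nabla p, the gradient being taken in space only. *)
Definition spatial_gradient (p : R -> 'rV[R]_n -> R)
    (g : R -> 'rV[R]_n -> 'rV[R]_n) :=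
  {ae @lebesgue_measure R, forall t, t \in `]0, T[ ->
    weak_gradient (p t) (g t)}.

Definition class_X (p : R -> 'rV[R]_n -> R) :=
  in_Linfty_L1Linfty p /\
  exists g, spatial_gradient p g /\
    forall i, in_mixed_Lebesgue `]0, T[ 2%:E 2%:E (fun t x => g t x ord0 i).

(* Narrow continuity on [0,T] of the measures p_t(x) dx on Omega. *)
Definition narrowly_continuous (p : R -> 'rV[R]_n -> R) :=
  forall phi : 'rV[R]_n -> R,
    {within Omega, continuous phi} -> [bounded phi x | x in Omega] ->
    {within `[0, T], continuous
      (fun t => \int[vol]_(x in Omega) (phi x * p t x))}.

(* C^infinity(closure Omega x [0,T)) consists of the restrictions of smooth
   functions of the whole space-time; nothing is imposed on the boundary of
   Omega. *)
Definition test_function (phi : R * 'rV[R]_n -> R) :=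
  smooth phi /\
  exists2 delta, 0 < delta & forall t x,
    T - delta < t < T -> closure Omega x -> phi (t, x) = 0.

Variables (sigma : R -> R) (f : R -> 'rV[R]_n -> 'rV[R]_n).

(* J = f p - sigma^2 / 2 nabla p *)
Definition flux (p : R -> 'rV[R]_n -> R) (g : R -> 'rV[R]_n -> 'rV[R]_n)
    (t : R) (x : 'rV[R]_n) : 'rV[R]_n :=
  p t x *: f t x - (2^-1 * sigma t ^+ 2) *: g t x.

(* The no-flux boundary condition is encoded by the test functions, which do
   not vanish on the boundary; the initial datum p0 by the term at t = 0. *)
Definition weak_formulation (p0 : 'rV[R]_n -> R) (p : R -> 'rV[R]_n -> R)
    (J : R -> 'rV[R]_n -> 'rV[R]_n) :=
  forall phi, test_function phi ->
    \int[vol_tx]_(z in `]0, T[ `*` Omega)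
      (p z.1 z.2 * 'D_(1, 0) phi z +
       \sum_(i < n) J z.1 z.2 ord0 i * 'D_(0, delta_mx ord0 i) phi z) +
    \int[vol]_(x in Omega) (p0 x * phi (0, x)) = 0.

Definition no_flux_weak_solution (p0 : 'rV[R]_n -> R)
    (p : R -> 'rV[R]_n -> R) :=
  [/\ in_Linfty_L1Linfty p,
      forall t, t \in `[0, T] ->
        {ae vol, forall x, Omega x -> 0 <= p t x} /\
        (\int[vol]_(x in Omega) (p t x)%:E = 1)%E,
      narrowly_continuous p &
      exists g, [/\ spatial_gradient p g,
        forall i, in_Lebesgue vol_tx 1%E (`]0, T[ `*` Omega)
          (fun z => flux p g z.1 z.2 ord0 i) &
        weak_formulation p0 p (flux p g)]].

End fixed_domain.

End Fokker_Planck.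

(* Main.v *)
Require Import Defs.
From HB Require Import structures.
From mathcomp Require Import all_boot all_order all_algebra.
From mathcomp Require Import all_classical all_reals all_analysis.
From mathcomp Require Import measurable_realfun ring lra.

Set Implicit Arguments.
Unset Strict Implicit.
Unset Printing Implicit Defensive.

Import Order.TTheory GRing.Theory Num.Theory.
Import numFieldNormedType.Exports.

Local Open Scope classical_set_scope.
Local Open Scope ring_scope.

(** Let w = p - q.  The natural test function is a potential of w, and what should
    decrease is a negative norm of w: the drift is only bounded, so no integration
    by parts may fall on it.  The argument is run on finite-dimensional spaces of
    smooth functions, where only scalar functions of time have to be differentiated.

    For phi smooth on the whole space, the pairing c_phi(t) of w(t) with phi over
    Omega is continuous by narrow continuity.  Test functions chi(t) phi(x) are
    allowed whatever phi does on the boundary, and the initial data cancel, so c_phi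
    is the primitive of the pairing of the flux w f - a grad w with grad phi, where
    a = sigma^2 / 2 ([primitive_of_weak]).  Let e_k be an H^1(Omega)-orthonormal
    basis of the span of the N first functions of a countable family of bumps
    ([galerkin_basis]), and let E_N be the sum of the squares of the c_(e_k): it is
    the square of the norm of w in the dual of this Galerkin space.  Squares of
    primitives being primitives ([sqr_primitive]), the derivative of E_N is twice the
    pairing of the flux with grad v, where v is the Riesz representative of w in the
    Galerkin space.  The H^1 product of v with w is the L^2 product of w with the H^1
    projection of w; this is at least half the square of the L^2 norm of w, minus
    half the square rho_N of the H^1 distance from w to the Galerkin space.  The
    diffusion therefore absorbs the drift term w f . grad v, by Young's inequality
    and the bound on f alone ([flux_pair_le]).  Gronwall's inequality bounds E_N by a
    constant times the integral of rho_N ([energy_le]), which tends to 0 by dominated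
    convergence as soon as the family is dense in H^1(Omega).  Then c_phi vanishes
    for every bump phi of the family, hence w(t) = 0 ([solutions_agree]).

    The density ([weak_jet_approximable]) is where the Lipschitz boundary enters: near
    each point of the closure, Omega is stable under small translations in a cone of
    directions ([Lipschitz_inward]).  A localized H^1 function is mollified by a kernel
    shifted along this cone, so that only its values inside Omega are used
    ([approximable_local]), and the convolution is a limit of Riemann sums, which are
    combinations of rational bumps ([approximable_kernel]).  A Neumann series takes the
    place of the division in a partition of unity. *)

(** * Smooth functions *)

Section smooth_theory.
Context {R : realType}.
Implicit Types U V W : normedModType R.

(** Smoothness is the largest class of differentiable functions stable under
    directional differentiation; smoothness proofs below exhibit such a class,
    which avoids any formula for iterated derivatives. *)
Lemma smooth_coind V (P : (V -> R) -> Prop) :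
  (forall g, P g -> (forall x, differentiable g x) /\
                    (forall v, P ('D_v g))) ->
  forall g, P g -> smooth g.
Proof.
move=> H g Pg vs x.
suff : P (foldr (fun v h => 'D_v h) g vs) by move=> /H[].
by elim: vs => //= v vs IH; apply (H _ IH).2.
Qed.

Lemma smooth_differentiable V (g : V -> R) x : smooth g -> differentiable g x.
Proof. by move=> /(_ [::]); apply. Qed.

Lemma smooth_derivable V (g : V -> R) x v : smooth g -> derivable g x v.
Proof. by move=> sg; apply/diff_derivable/smooth_differentiable. Qed.

Lemma smooth_derive V (g : V -> R) v : smooth g -> smooth ('D_v g).
Proof. by move=> sg vs x; have := sg (rcons vs v) x; rewrite foldr_rcons. Qed.

Lemma smooth_continuous V (g : V -> R) : smooth g -> continuous g.
Proof.
by move=> sg x; apply: differentiable_continuous; exact: smooth_differentiable.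
Qed.

(** The algebra generated by the smooth functions: by the Leibniz rule it is a
    class of the kind required by [smooth_coind]. *)
Inductive smooth_alg V : (V -> R) -> Prop :=
| SmoothBase g : smooth g -> smooth_alg g
| SmoothAdd g h : smooth_alg g -> smooth_alg h -> smooth_alg (g + h)
| SmoothMul g h : smooth_alg g -> smooth_alg h -> smooth_alg (g * h).

Let smooth_alg_diff V (g : V -> R) : smooth_alg g ->
  (forall x, differentiable g x) /\ (forall v, smooth_alg ('D_v g)).
Proof.
elim=> {g} [g sg|g h _ [dg Dg] _ [dh Dh]|g h Ag [dg Dg] Ah [dh Dh]]; split.
- by move=> x; exact: smooth_differentiable.
- by move=> v; apply: SmoothBase; exact: smooth_derive.
- by move=> x; exact: differentiableD.
- move=> v; rewrite (_ : 'D_v _ = 'D_v g + 'D_v h); first exact: SmoothAdd.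
  by apply/funext => x; rewrite deriveD//; exact: diff_derivable.
- by move=> x; exact: differentiableM.
- move=> v; rewrite (_ : 'D_v _ = g * 'D_v h + h * 'D_v g).
    by apply: SmoothAdd; apply: SmoothMul.
  by apply/funext => x; rewrite deriveM//; exact: diff_derivable.
Qed.

Lemma smoothD V (g h : V -> R) : smooth g -> smooth h -> smooth (g + h).
Proof.
move=> sg sh; apply: (smooth_coind (@smooth_alg_diff V)).
by apply: SmoothAdd; exact: SmoothBase.
Qed.

Lemma smoothM V (g h : V -> R) : smooth g -> smooth h -> smooth (g * h).
Proof.
move=> sg sh; apply: (smooth_coind (@smooth_alg_diff V)).
by apply: SmoothMul; exact: SmoothBase.
Qed.

Lemma smooth_cst V (c : R) : smooth (cst c : V -> R).
Proof.
apply: (@smooth_coind _ (fun g => exists c, g = cst c)); last by exists c.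
move=> _ [k ->]; split=> [x|v]; first exact: differentiable_cst.
by exists 0; apply/funext => x; exact: derive_cst.
Qed.

Lemma smoothZ V (k : R) (g : V -> R) : smooth g -> smooth (fun x => k * g x).
Proof.
by move=> sg; have := smoothM (@smooth_cst V k) sg.
Qed.

Lemma smooth_sum V I (s : seq I) (g : I -> V -> R) :
  (forall i, smooth (g i)) -> smooth (\sum_(i <- s) g i).
Proof.
move=> sg; elim: s => [|i s IH]; first by rewrite big_nil; exact: smooth_cst.
by rewrite big_cons; exact: smoothD.
Qed.

Lemma smooth_prod V I (s : seq I) (g : I -> V -> R) :
  (forall i, smooth (g i)) -> smooth (\prod_(i <- s) g i).
Proof.
move=> sg; elim: s => [|i s IH]; first by rewrite big_nil; exact: smooth_cst.
by rewrite big_cons; exact: smoothM.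
Qed.

Lemma smoothX V (g : V -> R) k : smooth g -> smooth (g ^+ k).
Proof.
move=> sg; elim: k => [|k IH]; first by rewrite expr0; exact: smooth_cst.
by rewrite exprS; exact: smoothM.
Qed.

Lemma derive_comp_affine V W (L : {linear V -> W}) (c : W) (g : W -> R) v x :
  continuous L -> differentiable g (L x + c) ->
  differentiable (fun y => g (L y + c)) x /\
  'D_v (fun y => g (L y + c)) x = 'D_(L v) g (L x + c).
Proof.
move=> cL dg; pose A : V -> W := (L : V -> W) + cst c.
have dL y : differentiable L y by exact: linear_differentiable.
have dc y : differentiable (cst c : V -> W) y by exact: differentiable_cst.
have dA y : differentiable A y by exact: differentiableD.
have diffA y : 'd A y = L :> (V -> W).
  rewrite diffD// diff_cst diff_lin//.
  by apply/funext => z /=; rewrite /GRing.add_fun/= addr0.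
have dgA : differentiable (g \o A) x by exact: differentiable_comp.
by split=> //; rewrite !deriveE// [LHS](_ : _ = 'd (g \o A) x v)// diff_comp//=
  (congr1 (@^~ v) (diffA x)).
Qed.

Lemma smooth_comp_affine V W (L : {linear V -> W}) (c : W) (g : W -> R) :
  continuous L -> smooth g -> smooth (fun y => g (L y + c)).
Proof.
move=> cL sg.
apply: (@smooth_coind _ (fun k => exists2 g, smooth g & k = fun y => g (L y + c)));
  last by exists g.
move=> _ {sg}[{}g sg ->]; split=> [x|v].
  exact: (derive_comp_affine 0 cL (smooth_differentiable _ sg)).1.
exists ('D_(L v) g); first exact: smooth_derive.
apply/funext => y.
exact: (derive_comp_affine v cL (smooth_differentiable _ sg)).2.
Qed.

End smooth_theory.

Section flat.
Context {R : realType}.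
Implicit Types (p : {poly R}) (x : R).

(** These functions form a family stable under differentiation, to which
    [smooth_coind] applies. *)
Definition flat p x : R := if 0 < x then p.[x^-1] * expR (- x^-1) else 0.

Lemma poly_expRN_bounded p :
  exists C, forall y, 0 <= y -> `|p.[y]| * expR (- y) <= C.
Proof.
exists (\sum_(i < size p) `|p`_i| * i`!%:R) => y y0.
rewrite horner_coef.
apply: (@le_trans _ _ ((\sum_(i < size p) `|p`_i| * y ^+ i) * expR (- y))).
  rewrite ler_wpM2r ?expR_ge0//; apply: le_trans (ler_norm_sum _ _ _) _.
  by apply: ler_sum => i _; rewrite normrM (ger0_norm (exprn_ge0 _ y0)).
rewrite mulr_suml; apply: ler_sum => i _; rewrite -mulrA.
apply: ler_wpM2l => //; rewrite expRN ler_pdivrMr ?expR_gt0//.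
case: (nat_of_ord i) => [|k].
  rewrite expr0 fact0 mul1r; apply: le_trans (expR_ge1Dx y).
  by rewrite lerDl.
have := expR_ge1Dxn k y0; rewrite -lerBrDl => /le_trans - /(_ (expR y)).
rewrite gerBl ler01 => /(_ isT).
by rewrite ler_pdivrMr ?ltr0n ?fact_gt0// mulrC.
Qed.

(** The quadratic bound gives flat functions a zero derivative at the junction
    point 0. *)
Lemma flat_quadratic p : exists C, forall x, `|flat p x| <= C * x ^+ 2.
Proof.
have [C HC] := poly_expRN_bounded ('X^2 * p).
exists C => x; rewrite /flat; case: ifPn => x0; last first.
  rewrite normr0 mulr_ge0 ?sqr_ge0//; apply: le_trans (HC 0 (lexx _)).
  by rewrite mulr_ge0 ?expR_ge0.
have y0 : 0 <= x^-1 by rewrite invr_ge0 ltW.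
have := HC _ y0; rewrite hornerM hornerXn normrM (ger0_norm (exprn_ge0 _ y0)).
rewrite normrM (ger0_norm (expR_ge0 _)) exprVn -mulrA => HCx.
have x20 : 0 < x ^+ 2 by exact: exprn_gt0.
by rewrite [leRHS]mulrC -(ler_pdivrMl _ _ x20).
Qed.

Lemma is_derive_quadratic (g : R -> R) C : (forall x, `|g x| <= C * x ^+ 2) ->
  is_derive (0 : R) 1 g 0.
Proof.
move=> gC.
have C0 : 0 <= C by have := gC 1; rewrite expr1n mulr1; exact: le_trans.
have g0 : g 0 = 0.
  by apply/eqP; rewrite -normr_eq0 eq_le normr_ge0 andbT (le_trans (gC 0))//
    expr0n mulr0.
have cg : h^-1 *: ((g \o shift 0) (h *: (1 : R)) - g 0) @[h --> 0^'] --> (0 : R).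
  apply/cvgrPdist_le => /= e e0; near=> h.
  rewrite g0 subr0 addr0 sub0r normrN normrZ normfV.
  have h0 : 0 < `|h| by rewrite normr_gt0; near: h; exact: nbhs_dnbhs_neq.
  rewrite ler_pdivrMl// (le_trans (gC _))// [_ *: _]mulr1.
  rewrite -real_normK ?num_real// expr2 mulrA (mulrC `|h|) ler_wpM2r//.
  have C1 : 0 < C + 1 by rewrite ltr_wpDl.
  apply: (@le_trans _ _ ((C + 1) * `|h|)); first by rewrite ler_wpM2r// lerDl.
  rewrite mulrC -ler_pdivlMr//; near: h; apply: dnbhs0_le; by rewrite divr_gt0// ltr_wpDl.
split; first by apply/cvg_ex; exists 0.
exact/cvg_lim.
Unshelve. all: by end_near.
Qed.

Lemma is_derive_flat p x :
  is_derive x 1 (flat p) (flat ('X^2 * (p - p^`())) x).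
Proof.
have [x0|x0|->] := ltgtP x 0.
- have nx : \near x, flat p x = cst 0 x.
    near=> y; rewrite /flat ifF//; apply/negbTE; rewrite -leNgt; apply: ltW.
    by near: y; exact: lt_nbhsl.
  rewrite {2}/flat ltNge (ltW x0)/=; split.
    apply: near_eq_derivable (derivable_cst (0 : R) _ _).
    by near=> y; apply/esym; near: y.
  by rewrite (near_eq_derive _ nx) derive_cst.
- have nx : \near x, flat p x = p.[x^-1] * expR (- x^-1).
    near=> y; rewrite /flat ifT//; near: y; exact: lt_nbhsr.
  have dV : is_derive x 1 (fun y : R => y^-1) (- x ^- 2 *: 1).
    by apply: (@is_deriveV _ id); rewrite gt_eqF.
  have dN : is_derive x 1 (fun y : R => - y^-1) (- (- x ^- 2 *: 1)).
    exact: (@is_deriveN _ _ _ (fun y : R => y^-1)).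
  have [dP eP] := is_deriveM (is_derive1_comp (is_derive_poly p x^-1) dV)
    (@is_derive1_comp _ _ (fun y : R => - y^-1) _ _ _
       (is_derive_expR (- x^-1)) dN).
  have nx' : \near x, p.[x^-1] * expR (- x^-1) = flat p x.
    by near=> y; apply/esym; near: y.
  split; first exact: near_eq_derivable nx' dP.
  rewrite (near_eq_derive _ nx) [LHS]eP /= {1}/flat x0 hornerM hornerXn.
  rewrite !hornerE /GRing.scale/= exprVn.
  by ring.
have [C HC] := flat_quadratic p.
by rewrite {2}/flat ltxx; exact: is_derive_quadratic HC.
Unshelve. all: by end_near.
Qed.
End flat.

Section smooth_bumps.
Context {R : realType}.

Lemma smooth_flat (p : {poly R}) : smooth (flat p).
Proof.
apply: (@smooth_coind _ _ (fun g => exists p (c : R), g = (fun x => c * flat p x))); last first.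
  by exists p, 1; apply/funext => x; rewrite mul1r.
move=> _ [{}p [c ->]].
have D (x : R) : is_derive x 1 (fun x => c * flat p x) (c * flat ('X^2 * (p - p^`())) x).
  exact: (is_deriveZ c (is_derive_flat p x)).
have dp (x : R) : differentiable (fun x => c * flat p x) x.
  by apply/derivable1_diffP; have [] := D x.
split=> // v; exists ('X^2 * (p - p^`())), (v * c); apply/funext => x.
have [_ E] := D x.
by rewrite deriveE// diff1E// derive1E E [LHS]mulrA.
Qed.

(** The smooth function exp(-1/x) for x > 0, extended by 0. *)
Definition cutoff : R -> R := flat 1.

Lemma cutoffE x : cutoff x = if 0 < x then expR (- x^-1) else 0.
Proof. by rewrite /cutoff /flat; case: ifP; rewrite ?hornerC ?mul1r. Qed.

Lemma smooth_cutoff : smooth cutoff. Proof. exact: smooth_flat. Qed.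

Lemma cutoff_ge0 x : 0 <= cutoff x.
Proof. by rewrite cutoffE; case: ifP => // _; exact: expR_ge0. Qed.

Lemma cutoff_gt0 x : (0 < cutoff x) = (0 < x).
Proof. by rewrite cutoffE; case: ifP => //; rewrite ?expR_gt0 ?ltxx. Qed.

Lemma cutoff_eq0 x : x <= 0 -> cutoff x = 0.
Proof. by rewrite cutoffE leNgt => /negbTE ->. Qed.

Lemma cutoff_le1 x : cutoff x <= 1.
Proof.
rewrite cutoffE; case: ifP => // x0.
by rewrite -expR0 ler_expR oppr_le0 invr_ge0 ltW.
Qed.

Lemma cutoff_cvg x : cutoff (k.+1%:R * x) @[k --> \oo] --> ((0 < x)%R%:R : R).
Proof.
case: ltP => x0 /=; last first.
  under eq_fun do rewrite cutoff_eq0 ?mulr_ge0_le0//.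
  exact: cvg_cst.
have -> : (fun k => cutoff (k.+1%:R * x)) = (fun k => expR (- (k.+1%:R^-1 * x^-1))).
  by apply/funext => k; rewrite cutoffE ifT ?mulr_gt0// invfM.
rewrite -[1%:R]expR0; apply: continuous_cvg; first exact: continuous_expR.
rewrite -oppr0 -(mul0r x^-1); apply: cvgN; apply: cvgMl.
exact: cvg_harmonic.
Qed.

Variable n : nat.
Implicit Types (a b x y v : 'rV[R]_n) (i : 'I_n).

Definition box a b : set 'rV[R]_n :=
  [set x | forall i, a 0 i < x 0 i < b 0 i].

Definition cbox a b : set 'rV[R]_n :=
  [set x | forall i, a 0 i <= x 0 i <= b 0 i].

(** Smooth functions that are positive exactly on the open box; they increase
    to its indicator as k grows. *)
Definition bump k a b x : R :=
  \prod_(i < n) (cutoff (k.+1%:R * (x 0 i - a 0 i)) *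
                 cutoff (k.+1%:R * (b 0 i - x 0 i))).

Lemma coord_linear_continuous i :
  exists2 L : {linear 'rV[R]_n -> R}, continuous L & forall x, L x = x 0 i.
Proof.
have lc : linear (fun x : 'rV[R]_n => x 0 i) by move=> k x y; rewrite !mxE.
pose L : {linear 'rV[R]_n -> R} :=
  HB.pack (fun x : 'rV[R]_n => x 0 i) (GRing.isLinear.Build _ _ _ _ _ lc).
by exists L => // x; exact: coord_continuous.
Qed.

Lemma smooth_cutoff_comp (V : normedModType R) (L : {linear V -> R}) (c : R) :
  continuous L -> smooth (fun y : V => cutoff (L y + c)).
Proof. by move=> cL; apply: smooth_comp_affine => //; exact: smooth_cutoff. Qed.

Lemma smooth_bump k a b : smooth (bump k a b).
Proof.
have -> : bump k a b = \prod_(i < n)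
    ((fun x => cutoff (k.+1%:R * (x 0 i - a 0 i))) *
     (fun x => cutoff (k.+1%:R * (b 0 i - x 0 i)))).
  apply/funext => x.
  by rewrite (big_morph (fun g : 'rV[R]_n -> R => g x) (id1 := 1) (op1 := *%R)).
apply: smooth_prod => i; have [L cL LE] := coord_linear_continuous i.
have cZ (c : R) : continuous (c \*: L) 
  by move=> x; exact: (@cvgM _ _ _ _ (cst c) L c (L x) (cvg_cst _) (cL x)).
apply: smoothM.
  have := @smooth_cutoff_comp _ (k.+1%:R \*: L) (- (k.+1%:R * a 0 i)) (cZ _).
  by under eq_fun do rewrite /= LE -mulrBr.
have := @smooth_cutoff_comp _ (- k.+1%:R \*: L) (k.+1%:R * b 0 i) (cZ _).
under eq_fun do rewrite /= LE [_ *: _]mulNr addrC -mulrBr.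
exact.
Qed.

Lemma bump_ge0 k a b x : 0 <= bump k a b x.
Proof. by apply: prodr_ge0 => i _; rewrite mulr_ge0 ?cutoff_ge0. Qed.

Lemma bump_le1 k a b x : bump k a b x <= 1.
Proof.
apply: prodr_ile1 => i _; rewrite mulr_ge0 ?cutoff_ge0//=.
by rewrite mulr_ile1 ?cutoff_ge0 ?cutoff_le1.
Qed.

Lemma bump_gt0 k a b x : box a b x -> 0 < bump k a b x.
Proof.
move=> abx; apply: prodr_gt0 => i _; have /andP[ax xb] := abx i.
by rewrite mulr_gt0// cutoff_gt0 mulr_gt0// subr_gt0.
Qed.

Lemma bump_eq0 k a b x : ~ box a b x -> bump k a b x = 0.
Proof.
move=> /existsNP[i /negP]; rewrite negb_and -!leNgt => abx.
rewrite /bump (bigD1 i)//=.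
case/orP : abx => H.
  by rewrite cutoff_eq0 ?mul0r// mulr_ge0_le0// subr_le0.
by rewrite [X in _ * X * _]cutoff_eq0 ?mulr0 ?mul0r// mulr_ge0_le0// subr_le0.
Qed.

Lemma bump_cvg a b x : bump k a b x @[k --> \oo] --> (\1_(box a b) x : R).
Proof.
have -> : \1_(box a b) x =
    \prod_(i < n) ((0 < x 0 i - a 0 i)%R%:R * (0 < b 0 i - x 0 i)%R%:R) :> R.
  rewrite indicE; case: (boolP (x \in box a b)) => [|/negP].
    rewrite inE => abx; rewrite big1// => i _.
    by have /andP[ax xb] := abx i; rewrite !subr_gt0 ax xb mulr1.
  rewrite inE => /existsNP[i /negP]; rewrite negb_and => abx.
  rewrite (bigD1 i)//= !subr_gt0.
  by case/orP : abx => /negbTE ->; rewrite ?(mul0r, mulr0).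
rewrite /bump; elim: (index_enum _) => [|i r IH].
  under eq_fun do rewrite big_nil.
  by rewrite big_nil; exact: cvg_cst.
under eq_fun do rewrite big_cons.
rewrite big_cons; apply: cvgM IH.
by apply: cvgM; exact: cutoff_cvg.
Qed.

Lemma bump_shift k a b x y : bump k a b (x + y) = bump k (a - y) (b - y) x.
Proof.
apply: eq_bigr => i _; rewrite !mxE; congr (cutoff (_ * _) * cutoff (_ * _)).
  by ring.
by ring.
Qed.

Lemma cbox_compact a b : compact (cbox a b).
Proof.
have -> : cbox a b = [set x | forall i, [set` `[a 0 i, b 0 i]] (x 0 i)].
  by apply/seteqP; split=> x /= H i; have := H i; rewrite ?in_itv.
apply: (@rV_compact R n (fun i => [set` `[a 0 i, b 0 i]])) => i.
exact: segment_compact.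
Qed.

Lemma box_cbox a b : box a b `<=` cbox a b.
Proof. by move=> x abx i; have /andP[/ltW -> /ltW ->] := abx i. Qed.

End smooth_bumps.

(** * Lebesgue measure on the space of row vectors *)

Section borel_rV.
Context {R : realType} {n : nat}.
Implicit Types (A : set 'rV[R]_n) (a b : 'rV[rat]_n).

Definition qbox a b : set 'rV[R]_n := box (map_mx ratr a) (map_mx ratr b).

Definition qboxes : set (set 'rV[R]_n) := [set A | exists a b, A = qbox a b].

Lemma ratr_max (x y : rat) : ratr (Num.max x y) = Num.max (ratr x) (ratr y) :> R.
Proof. by rewrite /Order.max ltr_rat; case: ifP. Qed.

Lemma ratr_min (x y : rat) : ratr (Num.min x y) = Num.min (ratr x) (ratr y) :> R.
Proof. by rewrite /Order.min ltr_rat; case: ifP. Qed.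

Lemma setI_closed_qboxes : setI_closed qboxes.
Proof.
move=> _ _ [a [b ->]] [a' [b' ->]].
exists (\row_i Num.max (a 0 i) (a' 0 i)), (\row_i Num.min (b 0 i) (b' 0 i)).
apply/seteqP; split=> x.
  move=> [/= H1 H2] i; have := H1 i; have := H2 i; rewrite !mxE ratr_max ratr_min.
  by rewrite gt_max lt_min => /andP[-> ->] /andP[-> ->].
move=> /= H; split=> i; have := H i; rewrite !mxE ratr_max ratr_min gt_max lt_min.
  by move=> /andP[/andP[-> _] /andP[-> _]].
by move=> /andP[/andP[_ ->] /andP[_ ->]].
Qed.

Lemma measurable_box (a b : 'rV[R]_n) : measurable (box a b).
Proof.
have -> : box a b =
    \bigcap_(i in [set: 'I_n]) ((fun x : 'rV[R]_n => x ord0 i) @^-1` `]a 0 i, b 0 i[).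
  apply/seteqP; split=> x /= H i; have := H i; rewrite /= in_itv//=.
  by move=> /(_ Logic.I).
apply: fin_bigcap_measurable; first exact: finite_finset.
move=> i _; rewrite -[X in measurable X]setTI.
by apply: measurable_coord_rV => //; exact: measurable_itv.
Qed.

Lemma measurable_cbox (a b : 'rV[R]_n) : measurable (cbox a b).
Proof.
have -> : cbox a b =
    \bigcap_(i in [set: 'I_n]) ((fun x : 'rV[R]_n => x ord0 i) @^-1` `[a 0 i, b 0 i]).
  apply/seteqP; split=> x /= H i; have := H i; rewrite /= in_itv//=.
  by move=> /(_ Logic.I).
apply: fin_bigcap_measurable; first exact: finite_finset.
move=> i _; rewrite -[X in measurable X]setTI.
by apply: measurable_coord_rV => //; exact: measurable_itv.
Qed.

Lemma qbox_nbhs (x : 'rV[R]_n) (e : R) : 0 < e ->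
  exists a b, qbox a b x /\
    forall y, cbox (map_mx ratr a) (map_mx ratr b) y -> `|x - y| < e.
Proof.
move=> e0.
have Ha i : exists q : rat, x 0 i - e / 2 < ratr q < x 0 i.
  have /rat_in_itvoo[q] : x 0 i - e / 2 < x 0 i by rewrite ltrBlDr ltrDl divr_gt0.
  by rewrite in_itv => Hq; exists q.
have Hb i : exists q : rat, x 0 i < ratr q < x 0 i + e / 2.
  have /rat_in_itvoo[q] : x 0 i < x 0 i + e / 2 by rewrite ltrDl divr_gt0.
  by rewrite in_itv => Hq; exists q.
have [a aP] := choice Ha; have [b bP] := choice Hb.
exists (\row_i a i), (\row_i b i); split.
  by move=> i; rewrite !mxE; have /andP[_ ->] := aP i; have /andP[-> _] := bP i.
move=> y xy.
have : ball x e y.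
  split=> // i j; rewrite (ord1 i) /ball/=.
  have := xy j; rewrite !mxE => /andP[H1 H2].
  have /andP[H3 H4] := aP j; have /andP[H5 H6] := bP j.
  by rewrite ltr_norml; apply/andP; split; lra.
by rewrite -ball_normE.
Qed.

Lemma open_qbox_cover A : open A ->
  A = \bigcup_(ab in [set ab : 'rV[rat]_n * 'rV[rat]_n |
         cbox (map_mx ratr ab.1) (map_mx ratr ab.2) `<=` A])
      qbox ab.1 ab.2.
Proof.
move=> oA; apply/seteqP; split=> [x Ax|x [ab /= abA abx]]; last first.
  by apply: abA; exact: box_cbox.
have /nbhs_ballP[e /= e0 eA] : nbhs x A by exact: open_nbhs_nbhs.
have [a [b [abx abe]]] := qbox_nbhs x e0.
by exists (a, b) => //= y /abe xy; apply: eA; rewrite -ball_normE.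
Qed.

Lemma qbox_countable (P : set ('rV[rat]_n * 'rV[rat]_n)) d
    (T : sigmaRingType d) (F : 'rV[rat]_n * 'rV[rat]_n -> set T) :
  (forall ab, P ab -> measurable (F ab)) -> measurable (\bigcup_(ab in P) F ab).
Proof.
move=> mF; rewrite bigcup_mkcond; apply: countable_bigcupT_measurable.
  exact: countableP.
move=> ab; case: ifPn => [|_]; last exact: measurable0.
by rewrite inE; exact: mF.
Qed.

Lemma open_measurable_rV A : open A -> measurable A.
Proof.
by move=> /open_qbox_cover ->; apply: qbox_countable => ab _; exact: measurable_box.
Qed.

(** Open sets are countable unions of rational boxes.  The density and uniqueness
    arguments below reduce to this countable pi-system. *)
Lemma measurable_rV_qboxes : @measurable _ 'rV[R]_n = <<s qboxes >>.
Proof.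
apply/seteqP; split; last first.
  apply: smallest_sub; first exact: sigma_algebra_measurable.
  by move=> _ [a [b ->]]; exact: measurable_box.
apply: smallest_sub; first exact: smallest_sigma_algebra.
move=> A; rewrite -bigcup_seq/= => -[i _ [B mB <-]].
have mi : measurable_fun [set: g_sigma_algebraType qboxes]
    (fun x : 'rV[R]_n => x ord0 i).
  apply: (measurability _ (RGenOInfty.measurableE R)) => _ [_ [c ->] <-].
  rewrite setTI.
  have -> : (fun x : 'rV[R]_n => x ord0 i) @^-1` `]c, +oo[ =
      \bigcup_(ab in [set ab : 'rV[rat]_n * 'rV[rat]_n | c <= ratr (ab.1 0 i)])
        qbox ab.1 ab.2.
    apply/seteqP; split=> [x /=|x [ab /= cab /(_ i)]].
      rewrite in_itv/= andbT => cx.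
      have e0 : 0 < x 0 i - c by rewrite subr_gt0.
      have [a [b [abx abe]]] := qbox_nbhs x e0.
      exists (a, b) => //=.
      pose y := \row_j (if j == i then ratr (a 0 i) else x 0 j) : 'rV[R]_n.
      have yab : cbox (map_mx ratr a) (map_mx ratr b) y.
        move=> j; rewrite !mxE; case: eqP => [->|_].
          rewrite lexx/=; have := abx i; rewrite !mxE => /andP[/ltW + /ltW].
          exact: le_trans.
        by have := box_cbox abx j; rewrite !mxE.
      have : ball_ (fun x => `|x|) x (x 0 i - c) y by exact: abe.
      rewrite -mx_norm_ball.
      move=> [_ /(_ 0 i)]; rewrite /ball/= !mxE eqxx ltr_norml => /andP[_].
      by rewrite ltrD2l ltrN2 => /ltW.
    rewrite !mxE => /andP[H _]; rewrite /= in_itv/= andbT.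
    exact: le_lt_trans H.
  apply: (@qbox_countable _ _ (g_sigma_algebraType qboxes)) => ab _.
  by apply: sub_sigma_algebra; exists ab.1, ab.2.
exact: (mi measurableT B mB).
Qed.

Lemma continuous_measurable_rV (g : 'rV[R]_n -> R) :
  continuous g -> measurable_fun setT g.
Proof.
move=> cg; apply: (measurability _ (RGenOInfty.measurableE R)).
move=> _ [_ [c ->] <-].
rewrite setTI; apply: open_measurable_rV.
by apply: open_comp => [x _|]; [exact: cg|exact: interval_open].
Qed.

End borel_rV.

Section lebesgue_rV_theory.
Context {R : realType}.
Local Notation vol := (lebesgue_rV R).
Local Notation leb := (@lebesgue_measure R).
Local Open Scope ereal_scope.

Lemma vol_succE n (A : set 'rV[R]_n.+1) :
  vol n.+1 A = (vol n \x leb) (@cons_rV R n @^-1` A).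
Proof. by []. Qed.

Lemma vol_cbox_lty n (a b : 'rV[R]_n) : vol n (cbox a b) < +oo.
Proof.
elim: n => [|n IH] in a b *.
  by rewrite /= /lebesgue_rV0 diracE; case: (_ \in _); rewrite ?ltry.
rewrite vol_succE.
have -> : @cons_rV R n @^-1` cbox a b =
   cbox (\row_i a ord0 (lift ord0 i)) (\row_i b ord0 (lift ord0 i)) `*`
   `[a ord0 ord0, b ord0 ord0].
  apply/seteqP; split=> [z /= H|z /= [H1 H2] i].
    split; first by move=> i; have := H (lift ord0 i); rewrite cons_rVS !mxE.
    by have := H ord0; rewrite cons_rV0 /= in_itv.
  case: (unliftP ord0 i) => [j|] ->; last by rewrite cons_rV0; rewrite /= in_itv in H2.
  by have := H1 j; rewrite cons_rVS !mxE.
rewrite product_measure1E//; last exact: measurable_cbox.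
have Hl : leb `[a ord0 ord0, b ord0 ord0] < +oo.
  by rewrite lebesgue_measure_itv /= ; case: ifP; rewrite // -EFinB ltry.
by apply: lte_mul_pinfty => //; rewrite ge0_fin_numE//; exact: IH.
Qed.

Lemma lebesgue_measure_translate (c : R) (A : set R) : measurable A ->
  leb ((fun x => x + c)%R @^-1` A) = leb A.
Proof.
move=> mA.
have mc : measurable_fun setT ((fun x => x + c)%R : measurableTypeR R -> measurableTypeR R).
  exact: measurable_funD.
rewrite -[LHS]/(pushforward leb ((fun x => x + c)%R : _ -> measurableTypeR R) A).
apply/esym/(@lebesgue_measure_unique _ (pushforward leb _)) => //= _ [[a b]] _ <-.
rewrite /pushforward.
have -> : ((fun x => x + c)%R @^-1` `]a, b]) = [set` `](a - c)%R, (b - c)%R]].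
  by apply/seteqP; split=> x /=; rewrite !in_itv/= ltrBlDr lerBrDr.
rewrite !lebesgue_measure_itv/= !lte_fin ltrD2r.
by case: ifP => // _; rewrite -!EFinB; congr EFin; ring.
Qed.

Lemma measurable_translate n (v : 'rV[R]_n) :
  measurable_fun setT (fun x : 'rV[R]_n => x + v)%R.
Proof.
apply: measurable_fun_rVP => i; under eq_fun do rewrite mxE.
by apply: measurable_funD => //; exact: measurable_coord_rV.
Qed.

Lemma vol_translate n (v : 'rV[R]_n) (A : set 'rV[R]_n) : measurable A ->
  vol n ((fun x => x + v)%R @^-1` A) = vol n A.
Proof.
elim: n => [|n IH] in v A *.
  move=> _; congr (_ _); apply/seteqP; split=> x /=; rewrite [v]thinmx0 ?addr0//.
move=> mA; rewrite !vol_succE /product_measure1.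
have mB : measurable (@cons_rV R n @^-1` A).
  by rewrite -[X in measurable X]setTI; exact: measurable_cons_rV.
pose v' : 'rV[R]_n := \row_i v ord0 (lift ord0 i).
have consD z s : (cons_rV (z, s) + v = cons_rV (z + v', s + v ord0 ord0))%R.
  apply/rowP => i; rewrite mxE.
  case: (unliftP ord0 i) => [j|] ->; last by rewrite !cons_rV0.
  by rewrite !cons_rVS/= !mxE.
pose F := leb \o xsection (@cons_rV R n @^-1` A).
have mF : measurable_fun setT F by exact: measurable_fun_xsection.
transitivity (\int[vol n]_z F (z + v')%R).
  apply: eq_integral => z _ /=; rewrite /F/= -[RHS](lebesgue_measure_translate (v ord0 ord0)).
    congr (leb _); apply/seteqP; split=> s; rewrite /xsection/= !inE/= consD//.
  exact: measurable_xsection.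
rewrite -[LHS]/(\int[vol n]_(z in (fun x => x + v')%R @^-1` setT)
   (F \o (fun x => x + v')%R) z).
rewrite -(ge0_integral_pushforward (measurable_translate v'))//.
apply: eq_measure_integral => [|mv B mB' _].
  exact: measurable_translate.
exact: IH.
Qed.

Lemma ge0_integral_translate n (v : 'rV[R]_n) (F : 'rV[R]_n -> \bar R) :
  measurable_fun setT F -> (forall x, 0 <= F x) ->
  \int[vol n]_x F (x + v)%R = \int[vol n]_x F x.
Proof.
move=> mF F0.
rewrite -[LHS]/(\int[vol n]_(z in (fun x => x + v)%R @^-1` setT)
   (F \o (fun x => x + v)%R) z).
rewrite -(ge0_integral_pushforward (measurable_translate v))//.
apply: eq_measure_integral => [|mv B mB' _].
  exact: measurable_translate.
exact: vol_translate.
Qed.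

End lebesgue_rV_theory.

(** * Square-integrable functions *)

Section L2.
Context d (X : measurableType d) {R : realType}.
Variable mu : {measure set X -> \bar R}.
Implicit Types (D : set X) (u v w b g : X -> R).

Definition L2 D u :=
  measurable_fun D u /\ mu.-integrable D (EFin \o (fun x => u x ^+ 2)).

Lemma integrable_le D u g : measurable D -> measurable_fun D u ->
  (forall x, D x -> `|u x| <= g x) -> mu.-integrable D (EFin \o g) ->
  mu.-integrable D (EFin \o u).
Proof.
move=> mD mu_ ug ig; apply: le_integrable ig => //; first exact/measurable_EFinP.
by move=> x Dx /=; rewrite lee_fin (le_trans (ug x Dx))// ler_norm.
Qed.

Lemma RintegralD' D u v : measurable D ->
  mu.-integrable D (EFin \o u) -> mu.-integrable D (EFin \o v) ->
  \int[mu]_(x in D) (u x + v x) = \int[mu]_(x in D) u x + \int[mu]_(x in D) v x.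
Proof. by move=> mD iu iv; rewrite -RintegralD. Qed.

Lemma integrable_addR D u v : measurable D ->
  mu.-integrable D (EFin \o u) -> mu.-integrable D (EFin \o v) ->
  mu.-integrable D (EFin \o (fun x => u x + v x)).
Proof.
move=> mD iu iv; have := integrableD mD iu iv.
by apply: eq_integrable.
Qed.

Lemma integrable_subR D u v : measurable D ->
  mu.-integrable D (EFin \o u) -> mu.-integrable D (EFin \o v) ->
  mu.-integrable D (EFin \o (fun x => u x - v x)).
Proof.
move=> mD iu iv; have := integrableB mD iu iv.
by apply: eq_integrable.
Qed.

Lemma integrable_scaleR D k u : measurable D ->
  mu.-integrable D (EFin \o u) -> mu.-integrable D (EFin \o (fun x => k * u x)).
Proof.
move=> mD iu; have := integrableZl mD k iu.
by apply: eq_integrable.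
Qed.

Lemma integrable_sumR D I (s : seq I) (F : I -> X -> R) : measurable D ->
  (forall i, mu.-integrable D (EFin \o F i)) ->
  mu.-integrable D (EFin \o (fun x => \sum_(i <- s) F i x)).
Proof.
move=> mD iF; elim: s => [|i s IH].
  under [X in _ \o X]eq_fun do rewrite big_nil.
  exact: integrable0.
under [X in _ \o X]eq_fun do rewrite big_cons.
exact: integrable_addR.
Qed.

Lemma Rintegral_sum D I (s : seq I) (F : I -> X -> R) : measurable D ->
  (forall i, mu.-integrable D (EFin \o F i)) ->
  \int[mu]_(x in D) (\sum_(i <- s) F i x) = \sum_(i <- s) \int[mu]_(x in D) F i x.
Proof.
move=> mD iF; elim: s => [|i s IH].
  by under eq_Rintegral do rewrite big_nil; rewrite Rintegral_cst// mul0r big_nil.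
under eq_Rintegral do rewrite big_cons.
by rewrite big_cons -IH RintegralD'//; exact: integrable_sumR.
Qed.

Lemma integrable_bddM D b u C : measurable D -> measurable_fun D b ->
  (forall x, D x -> `|b x| <= C) -> mu.-integrable D (EFin \o u) ->
  mu.-integrable D (EFin \o (fun x => b x * u x)).
Proof.
move=> mD mb bC iu.
apply: (@integrable_le _ _ (fun x => C * `|u x|)) => //.
- by apply: measurable_funM => //; apply/measurable_EFinP; exact: measurable_int iu.
- by move=> x Dx; rewrite normrM ler_wpM2r// bC.
- by apply: integrable_scaleR => //; exact: integrable_norm.
Qed.

Lemma L2_mul D u v : measurable D -> L2 D u -> L2 D v ->
  mu.-integrable D (EFin \o (fun x => u x * v x)).
Proof.
move=> mD [mu_ iu] [mv iv].
apply: (@integrable_le _ _ (fun x => u x ^+ 2 + v x ^+ 2)) => //.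
- exact: measurable_funM.
- move=> x _; rewrite normrM; have := sqr_ge0 (`|u x| - `|v x|).
  rewrite -[u x ^+ 2]real_normK ?num_real// -[v x ^+ 2]real_normK ?num_real//.
  have := mulr_ge0 (normr_ge0 (u x)) (normr_ge0 (v x)).
  by nra.
- exact: integrable_addR.
Qed.

Lemma L2_scale D k u : measurable D -> L2 D u -> L2 D (fun x => k * u x).
Proof.
move=> mD [mu_ iu]; split; first exact: measurable_funM.
under [X in _ \o X]eq_fun do rewrite exprMn.
exact: integrable_scaleR.
Qed.

Lemma L2_add D u v : measurable D -> L2 D u -> L2 D v -> L2 D (fun x => u x + v x).
Proof.
move=> mD Lu Lv; split; first by apply: measurable_funD; [case: Lu|case: Lv].
have -> : (fun x => (u x + v x) ^+ 2) =
   (fun x => (u x ^+ 2 + v x ^+ 2) + (u x * v x + u x * v x)).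
  by apply/funext => x; ring.
apply: integrable_addR => //; apply: integrable_addR => //;
  by [case: Lu|case: Lv|exact: L2_mul].
Qed.

Lemma L2_opp D u : measurable D -> L2 D u -> L2 D (fun x => - u x).
Proof.
move=> mD /(L2_scale (-1) mD); by under eq_fun do rewrite mulN1r.
Qed.

Lemma L2_sub D u v : measurable D -> L2 D u -> L2 D v -> L2 D (fun x => u x - v x).
Proof. by move=> mD Lu /(L2_opp mD); exact: L2_add. Qed.

Lemma L2_le D u g : measurable D -> measurable_fun D u ->
  (forall x, D x -> `|u x| <= g x) -> L2 D g -> L2 D u.
Proof.
move=> mD mu_ ug [mg ig]; split => //.
apply: integrable_le ig => //; first exact: measurable_funX.
move=> x Dx; rewrite normrX lerXn2r ?nnegrE ?ug//.
by apply: le_trans (ug x Dx).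
Qed.

Lemma L2_cst D k : measurable D -> (mu D < +oo)%E -> L2 D (cst k).
Proof.
move=> mD Dfin; split; first exact: measurable_cst.
have -> : (fun x => (cst k : X -> R) x ^+ 2) = cst (k ^+ 2) by [].
apply/integrableP; split; first by apply/measurable_EFinP; exact: measurable_cst.
rewrite -[X in (X < _)%E]/(\int[mu]_(x in D) (cst `|k ^+ 2|%:E) x)%E.
by rewrite integral_cst//; apply: lte_mul_pinfty.
Qed.

Lemma L2_bounded D u C : measurable D -> (mu D < +oo)%E ->
  measurable_fun D u -> (forall x, D x -> `|u x| <= C) -> L2 D u.
Proof.
by move=> mD Dfin mu_ uC; apply: (L2_le (g := cst C)) => //; exact: L2_cst.
Qed.

Lemma L2_bddM D b u C : measurable D -> measurable_fun D b ->
  (forall x, D x -> `|b x| <= C) -> L2 D u -> L2 D (fun x => b x * u x).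
Proof.
move=> mD mb bC Lu; have [mu_ _] := Lu.
have LCu : L2 D (fun x => `|C * u x|).
  have [m i] := L2_scale C mD Lu; split; first exact: measurableT_comp.
  by under [X in _ \o X]eq_fun do rewrite real_normK ?num_real//.
apply: L2_le LCu => //; first exact: measurable_funM.
move=> x Dx; rewrite !normrM ler_wpM2r//.
exact: le_trans (bC x Dx) (ler_norm _).
Qed.

Lemma integrable_L2 D u : measurable D -> (mu D < +oo)%E -> L2 D u ->
  mu.-integrable D (EFin \o u).
Proof.
move=> mD Dfin Lu; have := L2_mul mD (L2_cst 1 mD Dfin) Lu.
by under [X in _ \o X]eq_fun do rewrite mul1r.
Qed.

Lemma Rintegral_sqr_ge0 D u : 0 <= \int[mu]_(x in D) (u x ^+ 2).
Proof. by apply: Rintegral_ge0 => x _; exact: sqr_ge0. Qed.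

Lemma Rintegral_sqrD D u v : measurable D -> L2 D u -> L2 D v ->
  \int[mu]_(x in D) ((u x + v x) ^+ 2) <=
  2 * \int[mu]_(x in D) (u x ^+ 2) + 2 * \int[mu]_(x in D) (v x ^+ 2).
Proof.
move=> mD Lu Lv.
have iu := Lu.2; have iv := Lv.2.
rewrite -!RintegralZl// -RintegralD'//; try exact: integrable_scaleR.
apply: le_Rintegral => //.
- exact: (L2_add mD Lu Lv).2.
- by apply: integrable_addR => //; exact: integrable_scaleR.
- by move=> x _; have := sqr_ge0 (u x - v x); lra.
Qed.

Lemma Rintegral_cvg D (F : nat -> X -> R) u g : measurable D ->
  (forall k, measurable_fun D (F k)) -> measurable_fun D u ->
  (forall x, D x -> F ^~ x @ \oo --> u x) ->
  mu.-integrable D (EFin \o g) ->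
  (forall k x, D x -> `|F k x| <= g x) ->
  \int[mu]_(x in D) F k x @[k --> \oo] --> \int[mu]_(x in D) u x.
Proof.
move=> mD mF mu_ Fu ig Fg.
have [||||iu _ H] := @dominated_convergence _ _ _ mu D mD (fun k => EFin \o F k)
  (EFin \o u) (EFin \o g) _ _ _ ig.
- by move=> k; exact/measurable_EFinP.
- exact/measurable_EFinP.
- by apply: aeW => x Dx; apply: cvg_EFin; [exact: nearW|exact: Fu].
- by apply: aeW => x k Dx; rewrite lee_fin; exact: Fg.
apply: fine_cvg; rewrite fineK//; exact: integrable_fin_num.
Qed.

(** The errors u - F k are dominated by 2 g, whose square is integrable. *)
Lemma L2_cvg D (F : nat -> X -> R) u g : measurable D ->
  (forall k, measurable_fun D (F k)) -> measurable_fun D u ->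
  (forall x, D x -> F ^~ x @ \oo --> u x) ->
  L2 D g -> (forall k x, D x -> `|F k x| <= g x) ->
  L2 D u /\ \int[mu]_(x in D) ((u x - F k x) ^+ 2) @[k --> \oo] --> (0 : R).
Proof.
move=> mD mF mu_ Fu Lg Fg.
have ug x : D x -> `|u x| <= g x.
  move=> Dx; have : `|F k x| @[k --> \oo] --> `|u x| by apply: cvg_norm; exact: Fu.
  move=> cFu; rewrite -(cvg_lim _ cFu)//; apply: limr_le; first exact: cvgP cFu.
  by apply: nearW => k; exact: Fg.
have Lu : L2 D u by exact: L2_le ug Lg.
split => //.
rewrite [X in _ --> X](_ : _ = \int[mu]_(x in D) (0 : R)); last first.
  by rewrite Rintegral_cst// mul0r.
apply: (@Rintegral_cvg _ _ _ (fun x => 4 * g x ^+ 2)) => //.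
- by move=> k; apply: measurable_funX; exact: measurable_funB.
- move=> x Dx; have c0 : u x - F k x @[k --> \oo] --> (0 : R).
    by rewrite -(subrr (u x)); apply: cvgB; [exact: cvg_cst|exact: Fu].
  under eq_fun do rewrite expr2.
  by have h := cvgM c0 c0; rewrite mulr0 in h; exact: h.
- by apply: integrable_scaleR => //; case: Lg.
- move=> k x Dx; rewrite normrX.
  have h1 := ug x Dx; have h2 := Fg k x Dx.
  have h : `|u x - F k x| <= 2 * g x.
    by rewrite (le_trans (ler_normB _ _))//; lra.
  rewrite (_ : 4 * _ = (2 * g x) ^+ 2); last by ring.
  by rewrite lerXn2r// nnegrE// (le_trans _ h).
Qed.

Lemma Rintegral_restrict_ge0_eq0 D u : measurable D ->
  mu.-integrable D (EFin \o u) -> (forall x, D x -> 0 <= u x) ->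
  \int[mu]_(x in D) u x = 0 -> {ae mu, forall x, D x -> u x = 0}.
Proof.
move=> mD iu u0 Iu.
have I0 : (\int[mu]_(x in D) `|(EFin \o u) x| = 0)%E.
  rewrite -[RHS](_ : (\int[mu]_(x in D) u x)%:E = 0%E); last by rewrite Iu.
  rewrite fineK; last exact: integrable_fin_num.
  by apply: eq_integral => x; rewrite inE => Dx; rewrite gee0_abs// lee_fin u0.
have := (ae_eq_integral_abs mu mD (measurable_int mu iu)).1 I0.
by apply: filterS => x h Dx; have [] := h Dx.
Qed.

End L2.

(** * Rational boxes as test sets *)

Section box_tests.
Context {R : realType} {n : nat}.
Local Notation vol := (lebesgue_rV R n).
Implicit Types (D A : set 'rV[R]_n) (U : 'rV[R]_n -> R).

Lemma coord_le_norm (x : 'rV[R]_n) i : `|x 0 i| <= `|x|.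
Proof.
rewrite [leRHS]mx_normrE; exact: (le_bigmax _ (fun ij => `|x ij.1 ij.2|) (0, i)).
Qed.

Lemma norm_le_coord (x : 'rV[R]_n) c : 0 <= c -> (forall i, `|x 0 i| <= c) -> `|x| <= c.
Proof.
move=> c0 xc; rewrite [leLHS]mx_normrE; apply: bigmax_le => // -[j i] _ /=.
by rewrite ord1.
Qed.

Definition qcube (k : nat) : set 'rV[R]_n :=
  qbox (const_mx (- k%:R)) (const_mx k%:R).

Lemma qcubeE k x : qcube k x <-> forall i, - k%:R < x 0 i < k%:R.
Proof.
by split=> H i; have := H i; rewrite !mxE rmorphN/= ratr_nat.
Qed.

Lemma qcube_norm k x : `|x| < k%:R -> qcube k x.
Proof.
move=> xk; apply/qcubeE => i; rewrite -ltr_norml; apply: le_lt_trans xk.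
exact: coord_le_norm.
Qed.

Lemma qcube_near x : \forall k \near \oo, qcube k x.
Proof.
near=> k; apply: qcube_norm; near: k; exact: nbhs_infty_gtr.
Unshelve. all: by end_near.
Qed.

Lemma measurable_qbox a b : measurable (qbox a b : set 'rV[R]_n).
Proof. exact: measurable_box. Qed.

Lemma vol_box_lty (a b : 'rV[R]_n) : (vol (box a b) < +oo)%E.
Proof.
apply: le_lt_trans (vol_cbox_lty a b); apply: le_measure; rewrite ?inE.
- exact: measurable_box.
- exact: measurable_cbox.
- exact: box_cbox.
Qed.

Lemma restrict_cvg U (F : nat -> set 'rV[R]_n) x :
  (\forall k \near \oo, F k x) -> (U \_ (F k)) x @[k --> \oo] --> U x.
Proof.
move=> Fx; apply: cvg_near_cst; near=> k; rewrite patchE ifT// inE.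
by near: k.
Unshelve. all: by end_near.
Qed.

(** The sets on which the integral of U vanishes form a Dynkin class, which
    contains the pi-system of rational boxes. *)
Lemma ae_eq0_qbox D U : measurable D -> vol.-integrable D (EFin \o U) ->
  (forall a b, \int[vol]_(x in D `&` qbox a b) U x = 0) ->
  {ae vol, forall x, D x -> U x = 0}.
Proof.
move=> mD iU U0.
have mU := measurable_int _ iU.
have mU' : measurable_fun D U by exact/measurable_EFinP.
have iS A : measurable A -> vol.-integrable (D `&` A) (EFin \o U).
  by move=> mA; apply: integrableS iU => //; exact: measurableI.
have fin A : measurable A ->
    (\int[vol]_(x in D `&` A) (U x)%:E)%E = (\int[vol]_(x in D `&` A) U x)%:E.
  move=> mA; rewrite fineK//; apply: integrable_fin_num; last exact: iS.
  exact: measurableI.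
have PT : (\int[vol]_(x in D) (U x)%:E = 0)%E.
  have := fin setT measurableT; rewrite setIT => ->; congr EFin.
  have : \int[vol]_(x in D) (U \_ (qcube k)) x @[k --> \oo] -->
         \int[vol]_(x in D) U x.
    apply: (@Rintegral_cvg _ _ _ _ _ _ _ (fun x => `|U x|)) => //.
    - move=> k; apply/(measurable_restrict _ (measurable_qbox _ _) mD).
      by apply: measurable_funS mU'.
    - by move=> x _; apply: restrict_cvg; exact: qcube_near.
    - exact: integrable_norm.
    - by move=> k x _; rewrite patchE; case: ifP => // _; rewrite normr0.
  move/(cvg_lim (@Rhausdorff _)) => <-.
  under eq_fun do rewrite -Rintegral_mkcondr U0.
  by apply: cvg_lim => //; exact: cvg_cst.
have H A : measurable A -> (\int[vol]_(x in D `&` A) (U x)%:E = 0)%E.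
  rewrite measurable_rV_qboxes.
  apply: (dynkin_induction measurable_rV_qboxes setI_closed_qboxes
    (P := fun A => (\int[vol]_(x in D `&` A) (U x)%:E = 0)%E)).
  - by rewrite setIT.
  - by move=> _ [a [b ->]]; rewrite fin ?U0//; exact: measurable_qbox.
  - move=> S mS; rewrite !fin//; last exact: measurableC.
    have : \int[vol]_(x in D) U x = 0.
      by rewrite /Rintegral PT.
    have -> : \int[vol]_(x in D) U x = \int[vol]_(x in D `&` S) U x +
                                      \int[vol]_(x in D `&` ~` S) U x.
      rewrite -Rintegral_setU//; first by rewrite -setIUr setUv setIT.
      - exact: measurableI.
      - by apply: measurableI => //; exact: measurableC.
      - by rewrite -setIUr setUv setIT.
      - by apply/disj_setPS => x [[_ ?] [_ ?]].
    by move=> + [SU] => /eqP; rewrite SU add0r => /eqP ->.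
  - move=> F mF tF F0; rewrite setI_bigcupr integral_bigcup//.
    + by rewrite eseries0// => i _ _; exact: F0.
    + exact: trivIset_setIl.
    + by move=> k; exact: measurableI.
    + by rewrite -setI_bigcupr; apply: iS; exact: bigcupT_measurable.
have : ae_eq vol D (EFin \o U) (cst 0%E).
  apply: integral_ae_eq => // E ED mE.
  by rewrite integral0 -[in LHS](setIidr ED) H.
by apply: filterS => x h Dx; have [] := h Dx.
Qed.

End box_tests.

(** * Continuity of translations in the quadratic mean *)

Section translation_continuity.
Import HBNNSimple.
Context {R : realType} {n : nat}.
Local Notation vol := (lebesgue_rV R n).
Local Notation L2 := (L2 vol setT).
Implicit Types (A : set 'rV[R]_n) (U V : 'rV[R]_n -> R) (z : 'rV[R]_n).

Let mT : measurable [set: 'rV[R]_n] := measurableT.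

Lemma L2_translate z U : L2 U ->
  L2 (fun x => U (x + z)) /\ \int[vol]_x (U (x + z) ^+ 2) = \int[vol]_x (U x ^+ 2).
Proof.
move=> [mU iU].
have mUz : measurable_fun setT (fun x : 'rV[R]_n => U (x + z)).
  exact: (measurableT_comp mU (measurable_translate z)).
have mU2 : measurable_fun setT (fun x => (U x ^+ 2)%:E).
  by apply/measurable_EFinP; exact: measurable_funX.
have E : (\int[vol]_x (U (x + z)%R ^+ 2)%:E = \int[vol]_x (U x ^+ 2)%:E)%E.
  apply: (ge0_integral_translate z mU2) => x; rewrite lee_fin; exact: sqr_ge0.
split; last by rewrite /Rintegral E.
split => //; apply/integrableP; split.
  by apply/measurable_EFinP; exact: measurable_funX.
have /integrableP[_] := iU.
under eq_integral do rewrite /= ger0_norm ?sqr_ge0//.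
by under [in X in _ -> X]eq_integral do rewrite /= ger0_norm ?sqr_ge0//; rewrite E.
Qed.

Definition tcont U := L2 U /\ forall e, 0 < e ->
  exists2 r, 0 < r & forall z, `|z| < r ->
    \int[vol]_x ((U (x + z) - U x) ^+ 2) <= e.

Lemma tcont_seq U : L2 U ->
  (forall z_ : nat -> 'rV[R]_n, (forall k, `|z_ k| < k.+1%:R^-1) ->
     \int[vol]_x ((U (x + z_ k) - U x) ^+ 2) @[k --> \oo] --> (0 : R)) ->
  tcont U.
Proof.
move=> LU H; split=> // e e0; apply: contrapT => noR.
have Hz (k : nat) : exists z, `|z| < k.+1%:R^-1 /\
    e < \int[vol]_x ((U (x + z) - U x) ^+ 2).
  apply: contrapT => noz; apply: noR; exists (k.+1%:R^-1) => // z zk.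
  by rewrite leNgt; apply/negP => ez; apply: noz; exists z.
have [z_ zP] := choice Hz.
have /cvgrPdist_lt/(_ e e0)[N _ HN] := H z_ (fun k => (zP k).1).
have := HN N (leqnn N); rewrite /= sub0r normrN ltNge => /negP; apply.
by rewrite (le_trans _ (ler_norm _))// ltW// (zP N).2.
Qed.

(** Translations are isometries: the error made in replacing U by V is the same
    before and after a translation. *)
Lemma tcont_close U : L2 U ->
  (forall e, 0 < e -> exists2 V, tcont V & \int[vol]_x ((U x - V x) ^+ 2) <= e) ->
  tcont U.
Proof.
move=> LU H; split=> // e e0.
have e1 : 0 < e / 10 by rewrite divr_gt0.
have [V [LV HV] UV] := H _ e1; have [r r0 Hr] := HV _ e1.
exists r => // z /Hr Vz.
have LUV : L2 (fun x => U x - V x) by exact: L2_sub.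
have [LUVz EUVz] := L2_translate z LUV.
have LVz : L2 (fun x => V (x + z) - V x).
  by apply: L2_sub => //; exact: (L2_translate z LV).1.
have LUV' : L2 (fun x => V x - U x) by exact: L2_sub.
have -> : \int[vol]_x ((U (x + z) - U x) ^+ 2) = \int[vol]_x
  (((U (x + z) - V (x + z)) + ((V (x + z) - V x) + (V x - U x))) ^+ 2).
  by apply: eq_Rintegral => x _; congr (_ ^+ 2); ring.
apply: le_trans (Rintegral_sqrD mT LUVz (L2_add mT LVz LUV')) _.
have H2 := Rintegral_sqrD mT LVz LUV'.
have E2 : \int[vol]_x ((V x - U x) ^+ 2) = \int[vol]_x ((U x - V x) ^+ 2).
  by apply: eq_Rintegral => x _; ring.
rewrite E2 in H2; rewrite EUVz; lra.
Qed.

Lemma tcont_cvg U g (F : nat -> 'rV[R]_n -> R) : measurable_fun setT U ->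
  (forall k, tcont (F k)) -> (forall x, F ^~ x @ \oo --> U x) ->
  L2 g -> (forall k x, `|F k x| <= g x) -> tcont U.
Proof.
move=> mU TF FU Lg Fg.
have [LU cU] := L2_cvg mT (fun k => (TF k).1.1) mU (fun x _ => FU x) Lg
  (fun k x _ => Fg k x).
apply: tcont_close => // e e0.
have /cvgrPdist_le/(_ e e0)[N _ HN] := cU.
exists (F N) => //; apply: le_trans (HN N (leqnn N)).
by rewrite sub0r normrN ler_norm.
Qed.

Lemma tcontZ k U : tcont U -> tcont (fun x => k * U x).
Proof.
move=> [LU HU]; split; first exact: L2_scale.
move=> e e0; have k1 : 0 < k ^+ 2 + 1 by rewrite ltr_wpDl ?sqr_ge0.
have [r r0 Hr] := HU (e / (k ^+ 2 + 1)) (divr_gt0 e0 k1).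
exists r => // z /Hr; rewrite ler_pdivlMr// => H; apply: le_trans H.
have Li : L2 (fun x => U (x + z) - U x).
  by apply: L2_sub => //; exact: (L2_translate z LU).1.
under eq_Rintegral do rewrite -mulrBr exprMn.
rewrite RintegralZl//; last exact: Li.2.
rewrite mulrC ler_wpM2l//; last by rewrite lerDl.
exact: Rintegral_sqr_ge0.
Qed.

Lemma tcontD U V : tcont U -> tcont V -> tcont (fun x => U x + V x).
Proof.
move=> [LU HU] [LV HV]; split; first exact: L2_add.
move=> e e0; have e4 : 0 < e / 4 by rewrite divr_gt0.
have [r r0 Hr] := HU _ e4; have [s s0 Hs] := HV _ e4.
exists (Num.min r s); first by rewrite lt_min r0.
move=> z; rewrite lt_min => /andP[/Hr h1 /Hs h2].
have Li : L2 (fun x => U (x + z) - U x).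
  by apply: L2_sub => //; exact: (L2_translate z LU).1.
have Lj : L2 (fun x => V (x + z) - V x).
  by apply: L2_sub => //; exact: (L2_translate z LV).1.
have -> : \int[vol]_x ((U (x + z) + V (x + z) - (U x + V x)) ^+ 2) =
  \int[vol]_x (((U (x + z) - U x) + (V (x + z) - V x)) ^+ 2).
  by apply: eq_Rintegral => x _; congr (_ ^+ 2); ring.
by apply: le_trans (Rintegral_sqrD mT Li Lj) _; lra.
Qed.

Lemma L2_indic A : measurable A -> (vol A < +oo)%E -> L2 (\1_A : _ -> R).
Proof.
move=> mA Afin; split; first exact: measurable_indic.
have -> : (fun x => (\1_A x : R) ^+ 2) = \1_A.
  by apply/funext => x; rewrite indicE; case: (_ \in _); rewrite ?expr1n ?expr0n.
have : vol.-integrable A (EFin \o cst (1 : R)).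
  by have [_] := L2_cst 1 mA Afin; under [X in _ \o X]eq_fun do rewrite expr1n.
move/(integrable_mkcond _ mA); apply: eq_integrable => // x _.
by rewrite patchE /= indicE; case: ifP.
Qed.

Lemma tcont_bump k (a b : 'rV[R]_n) : tcont (bump k a b).
Proof.
have mb : measurable_fun setT (bump k a b).
  apply: continuous_measurable_rV; exact/smooth_continuous/smooth_bump.
have Lb (c d : 'rV[R]_n) : L2 (\1_(box c d) : _ -> R).
  by apply: L2_indic; [exact: measurable_box|exact: vol_box_lty].
have bb x : `|bump k a b x| <= \1_(box a b) x.
  rewrite ger0_norm ?bump_ge0// indicE; case: (boolP (x \in _)) => [_|].
    exact: bump_le1.
  by rewrite notin_setE => /bump_eq0 ->.
have Lbump : L2 (bump k a b) by apply: L2_le (Lb a b) => // x _; exact: bb.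
apply: tcont_seq => // z_ zk.
pose c := (a - const_mx 1)%R; pose d := (b + const_mx 1)%R.
have mbz (j : nat) : measurable_fun setT (fun x : 'rV[R]_n => bump k a b (x + z_ j)).
  exact: (measurableT_comp mb (measurable_translate (z_ j))).
have dom x j : `|bump k a b (x + z_ j)| <= \1_(box c d) x.
  rewrite ger0_norm ?bump_ge0// [leRHS]indicE; case: (boolP (x \in _)) => [_|].
    exact: bump_le1.
  rewrite notin_setE => H; rewrite bump_eq0// => abx; apply: H => i.
  have := abx i; rewrite !mxE => /andP[h1 h2].
  have : `|z_ j 0 i| < 1.
    apply: le_lt_trans (coord_le_norm _ _) _; apply: lt_le_trans (zk j) _.
    by rewrite invf_le1// ler1n.
  by rewrite ltr_norml => /andP[h3 h4]; apply/andP; split; lra.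
have z0 : z_ j @[j --> \oo] --> (0 : 'rV[R]_n).
  apply/cvgr0Pnorm_lt => e e0; near=> j; apply: lt_trans (zk j) _.
  near: j; exact: near_infty_natSinv_lt (PosNum e0).
have [||_ cH] := @L2_cvg _ _ _ vol setT (fun j x => bump k a b (x + z_ j))
  (bump k a b) (\1_(box c d)) mT mbz mb _ (Lb _ _).
- move=> x _; have := @smooth_continuous _ _ _ (smooth_bump k a b) x.
  move=> cx; have cz : x + z_ j @[j --> \oo] --> x.
    by rewrite -[X in _ --> X]addr0; apply: cvgD => //; exact: cvg_cst.
  by have H := continuous_cvg _ cx cz; exact: H.
- by move=> j x _; exact: dom.
apply: cvg_trans cH; apply: near_eq_cvg; near=> j.
by apply: eq_Rintegral => x _; ring.
Unshelve. all: by end_near.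
Qed.

Lemma tcont_qbox a b : tcont (\1_(qbox a b) : 'rV[R]_n -> R).
Proof.
apply: (@tcont_cvg _ (\1_(qbox a b)) (fun k => bump k (map_mx ratr a) (map_mx ratr b))).
- by apply: measurable_indic; exact: measurable_qbox.
- by move=> k; exact: tcont_bump.
- by move=> x; exact: bump_cvg.
- by apply: L2_indic; [exact: measurable_box|exact: vol_box_lty].
- move=> k x; rewrite ger0_norm ?bump_ge0// indicE; case: (boolP (x \in _)) => [_|].
    exact: bump_le1.
  by rewrite notin_setE => /bump_eq0 ->.
Qed.

(** A Dynkin argument from the rational boxes; the cubes keep the measures finite. *)
Lemma tcont_indic A k : measurable A -> tcont (\1_(A `&` qcube k) : 'rV[R]_n -> R).
Proof.
move=> mA; have := mA; rewrite measurable_rV_qboxes.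
have mQ : measurable (qcube k : set 'rV[R]_n) by exact: measurable_qbox.
have LQ : L2 (\1_(qcube k) : _ -> R) by exact: (tcont_qbox _ _).1.
apply: (dynkin_induction measurable_rV_qboxes setI_closed_qboxes
  (P := fun A => tcont (\1_(A `&` qcube k)))).
- by rewrite setTI; exact: tcont_qbox.
- move=> _ [a [b ->]].
  have [a' [b' ->]] : qboxes (qbox a b `&` qcube k : set 'rV[R]_n).
    by apply: setI_closed_qboxes; [exists a, b|do 2 eexists].
  exact: tcont_qbox.
- move=> S mS TS.
  have -> : (\1_(~` S `&` qcube k) : 'rV[R]_n -> R) =
      (fun x => \1_(qcube k) x + -1 * \1_(S `&` qcube k) x).
    apply/funext => x; rewrite !indicE !in_setI in_setC.
    by case: (x \in S); case: (x \in qcube k) => /=; lra.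
  by apply: tcontD; [exact: tcont_qbox|exact: tcontZ].
- move=> F mF tF TF.
  apply: (@tcont_cvg _ (\1_(qcube k)) (fun j x => \sum_(i < j) \1_(F i `&` qcube k) x)).
  + by apply: measurable_indic; apply: measurableI => //; exact: bigcupT_measurable.
  + elim=> [|j IH].
      under eq_fun => x do rewrite big_ord0 -(mul0r (\1_(qcube k) x)).
      by apply: tcontZ; exact: tcont_qbox.
    by under eq_fun do rewrite big_ord_recr/=; exact: tcontD.
  + move=> x; have [[i _ [Fx Qx]]|nx] := pselect ((\bigcup_i (F i `&` qcube k)) x).
      rewrite indicE mem_set; last by split=> //; exists i.
      apply: cvg_near_cst; near=> j.
      have ij : (i < j)%N by near: j; exact: nbhs_infty_gt.
      rewrite (bigD1 (Ordinal ij))//= indicE mem_set// big1 ?addr0// => l li.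
      rewrite indicE memNset// => -[Fl _].
      move/trivIsetP : tF => /(_ l i Logic.I Logic.I li)/seteqP[+ _].
      by move=> /(_ x); apply.
    rewrite indicE memNset; last first.
      by move=> [[i _ Fx] Qx]; apply: nx; exists i.
    apply: cvg_near_cst; near=> j; rewrite big1// => l _.
    by rewrite indicE memNset// => -[Fx Qx]; apply: nx; exists l.
  + exact: LQ.
  + move=> j x; rewrite ger0_norm ?sumr_ge0//.
    case: (pselect (exists i : 'I_j, (F i `&` qcube k) x)) => [[i Fi]|nx]; last first.
      rewrite big1// => i _; rewrite indicE memNset// => Fi; apply: nx.
      by exists i.
    rewrite (bigD1 i)//= big1 ?addr0.
      by rewrite !indicE !mem_set//; case: Fi.
    move=> l li; rewrite indicE memNset// => -[Fl _].
    move/trivIsetP : tF => /(_ l i Logic.I Logic.I li)/seteqP[+ _].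
    by move=> /(_ x); apply; split=> //; case: Fi.
Unshelve. all: by end_near.
Qed.

(** The positive and negative parts are limits of simple functions cut off by
    cubes. *)
Lemma L2_tcont U : L2 U -> tcont U.
Proof.
have H V : (forall x, 0 <= V x) -> L2 V -> tcont V.
  move=> V0 [mV iV].
  have mVE : measurable_fun setT (EFin \o V) by exact/measurable_EFinP.
  pose g := nnsfun_approx mT mVE.
  have cg (x : 'rV[R]_n) : g k x @[k --> \oo] --> V x.
    have := @cvg_nnsfun_approx _ _ _ _ mT _ mVE (fun y _ => V0 y) x Logic.I.
    exact: fine_cvg.
  have gV k (x : 'rV[R]_n) : 0 <= g k x <= V x.
    rewrite fun_ge0 /= -(cvg_lim _ (cg x))//.
    apply: limr_ge; first exact: cvgP (cg x).
    near=> m; have km : (k <= m)%N by near: m; exact: nbhs_infty_ge.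
    by have /lefP := nd_nnsfun_approx mT mVE km; apply.
  apply: (@tcont_cvg _ V (fun k x => g k x * \1_(qcube k) x)) => //.
  - move=> k.
    have -> : (fun x => g k x * \1_(qcube k) x) = (fun x =>
        \sum_(y <- finmap.enum_fset (fset_set (range (g k)))) y * \1_((g k @^-1` [set y]) `&` qcube k) x).
      apply/funext => x; rewrite {1}fimfunE fsbig_finite//= mulr_suml.
      by apply: eq_bigr => y _; rewrite -mulrA indicI.
    elim: (finmap.enum_fset _) => [|y s IH].
      have -> : (fun x : 'rV[R]_n => \sum_(y <- [::]) y * \1_((g k @^-1` [set y]) `&` qcube k) x) =
                (fun x : 'rV[R]_n => 0 * \1_(qcube k) x).
        by apply/funext => x; rewrite big_nil mul0r.
      by apply: tcontZ; exact: tcont_qbox.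
    under eq_fun do rewrite big_cons.
    by apply: tcontD => //; apply: tcontZ; apply: tcont_indic; exact: measurable_sfunP.
  - move=> x; rewrite -[X in _ --> X]mulr1; apply: cvgM.
      exact: cg.
    apply: cvg_near_cst; near=> k; rewrite indicE mem_set//.
    near: k; exact: qcube_near.
  - move=> k x; have /andP[h1 h2] := gV k x; rewrite ger0_norm; last first.
      by rewrite mulr_ge0.
    by rewrite indicE; case: (_ \in _); rewrite ?mulr1 ?mulr0 ?V0.
move=> [mU iU].
have -> : U = (fun x => Num.max (U x) 0 + -1 * Num.max (- U x) 0).
  by apply/funext => x; case: (leP (U x) 0) => h; case: (leP (- U x) 0) => h'; lra.
apply: tcontD; last apply: tcontZ.
  apply: H => [x|]; first by rewrite le_max lexx orbT.
  apply: (L2_le (g := fun x => `|U x|)) => //.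
  - exact: measurable_maxr.
  - by move=> x _; case: (leP (U x) 0) => h; rewrite ?normr0.
  - split; first exact: measurableT_comp.
    by under [X in _ \o X]eq_fun do rewrite real_normK ?num_real//.
apply: H => [x|]; first by rewrite le_max lexx orbT.
apply: (L2_le (g := fun x => `|U x|)) => //.
- by apply: measurable_maxr => //; exact: measurableT_comp.
- by move=> x _; case: (leP (- U x) 0) => h; rewrite ?normr0 ?normrN.
- split; first exact: measurableT_comp.
  by under [X in _ \o X]eq_fun do rewrite real_normK ?num_real//.
Unshelve. all: by end_near.
Qed.

End translation_continuity.

(** * Mollification *)

Section measurable_sections.
Context d1 d2 (T1 : measurableType d1) (T2 : measurableType d2) {R : realType}.
Variable m2 : {sigma_finite_measure set T2 -> \bar R}.

Lemma measurable_integral_section (f : T1 * T2 -> \bar R) :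
  measurable_fun setT f ->
  measurable_fun setT (fun x => \int[m2]_y f (x, y))%E.
Proof.
move=> mf; under eq_fun do rewrite integralE.
apply: emeasurable_funB.
  rewrite [X in measurable_fun _ X](_ : _ = fubini_F m2 (f^\+)%E).
    by apply: measurable_fun_fubini_tonelli_F => //; exact: measurable_funepos.
  by apply/funext => x; apply: eq_integral => y _; rewrite !funeposE.
rewrite [X in measurable_fun _ X](_ : _ = fubini_F m2 (f^\-)%E); last first.
  by apply/funext => x; apply: eq_integral => y _; rewrite !funenegE.
by apply: measurable_fun_fubini_tonelli_F => //; exact: measurable_funeneg.
Qed.

Lemma measurable_Rintegral_section (f : T1 * T2 -> R) :
  measurable_fun setT f ->
  measurable_fun setT (fun x => \int[m2]_y f (x, y)).
Proof.
move=> mf; apply: (measurableT_comp (f := fine)) => //.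
by apply: (measurable_integral_section (f := EFin \o f)); exact/measurable_EFinP.
Qed.

End measurable_sections.

Section jensen.
Context d (X : measurableType d) {R : realType}.
Variable mu : {measure set X -> \bar R}.

(** The variance of U under the probability density rho is nonnegative. *)
Lemma jensen_sqr (D : set X) (rho U : X -> R) (a : R) : measurable D ->
  (forall x, D x -> 0 <= rho x) ->
  mu.-integrable D (EFin \o rho) ->
  mu.-integrable D (EFin \o (fun x => rho x * U x)) ->
  mu.-integrable D (EFin \o (fun x => rho x * U x ^+ 2)) ->
  \int[mu]_(x in D) rho x = 1 ->
  mu.-integrable D (EFin \o (fun x => rho x * (U x - a) ^+ 2)) /\
  (\int[mu]_(x in D) (rho x * U x) - a) ^+ 2 <=
  \int[mu]_(x in D) (rho x * (U x - a) ^+ 2).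
Proof.
move=> mD rho0 ir iU iU2 r1.
have E b x : rho x * (U x - b) ^+ 2 =
    rho x * U x ^+ 2 + ((- 2 * b) * (rho x * U x) + b ^+ 2 * rho x) by ring.
have ib b : mu.-integrable D (EFin \o (fun x => rho x * (U x - b) ^+ 2)).
  under [X in _ \o X]eq_fun do rewrite E.
  by apply: integrable_addR => //; apply: integrable_addR => //;
    exact: integrable_scaleR.
have Ib b : \int[mu]_(x in D) (rho x * (U x - b) ^+ 2) =
    \int[mu]_(x in D) (rho x * U x ^+ 2)
    + (- 2 * b * \int[mu]_(x in D) (rho x * U x) + b ^+ 2).
  under eq_Rintegral do rewrite E.
  rewrite RintegralD'//; last by apply: integrable_addR => //; exact: integrable_scaleR.
  rewrite RintegralD'//; try exact: integrable_scaleR.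
  by rewrite !RintegralZl// r1 mulr1.
split; first exact: ib.
have : 0 <= \int[mu]_(x in D) (rho x * (U x - \int[mu]_(x in D) (rho x * U x)) ^+ 2).
  by apply: Rintegral_ge0 => x Dx; rewrite mulr_ge0 ?rho0 ?sqr_ge0.
rewrite !Ib; nra.
Qed.

End jensen.

Lemma vol_box_gt0 {R : realType} n (a b : 'rV[R]_n) : (forall i, a 0 i < b 0 i) ->
  (0 < lebesgue_rV R n (box a b))%E.
Proof.
elim: n => [|n IH] in a b * => ab.
  rewrite /= /lebesgue_rV0 diracE mem_set ?lte01// => -[] //.
rewrite vol_succE.
have -> : @cons_rV R n @^-1` box a b =
   box (\row_i a ord0 (lift ord0 i)) (\row_i b ord0 (lift ord0 i)) `*`
   `]a ord0 ord0, b ord0 ord0[.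
  apply/seteqP; split=> [z /= H|z /= [H1 H2] i].
    split; first by move=> i; have := H (lift ord0 i); rewrite cons_rVS !mxE.
    by have := H ord0; rewrite cons_rV0 /= in_itv.
  case: (unliftP ord0 i) => [j|] ->; last by rewrite cons_rV0; rewrite /= in_itv in H2.
  by have := H1 j; rewrite cons_rVS !mxE.
rewrite product_measure1E//; last exact: measurable_box.
apply: mule_gt0; first by apply: IH => i; rewrite !mxE.
by rewrite /= lebesgue_measure_itv/= lte_fin ab -EFinB lte_fin subr_gt0.
Qed.

Section mollifier.
Context {R : realType} {n : nat}.
Local Notation vol := (lebesgue_rV R n).
Implicit Types (A : set 'rV[R]_n) (U V : 'rV[R]_n -> R) (z c : 'rV[R]_n).

Let mT : measurable [set: 'rV[R]_n] := measurableT.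

(** An even smooth bump supported in the cube of half-side r. *)
Definition hat (r : R) : 'rV[R]_n -> R := bump 0 (const_mx (- r)) (const_mx r).

Lemma hatN r x : hat r (- x) = hat r x.
Proof.
apply: eq_bigr => i _; rewrite !mxE mulrC; congr (cutoff (_ * _) * cutoff (_ * _)); ring.
Qed.

Lemma hat_ge0 r x : 0 <= hat r x. Proof. exact: bump_ge0. Qed.

Lemma hat_le1 r x : hat r x <= 1. Proof. exact: bump_le1. Qed.

Lemma smooth_hat r : smooth (hat r). Proof. exact: smooth_bump. Qed.

Lemma measurable_hat r : measurable_fun setT (hat r).
Proof. by apply: continuous_measurable_rV; apply: smooth_continuous; exact: smooth_hat. Qed.

Lemma hat_eq0 r (x : 'rV[R]_n) : ~ (forall i, `|x 0 i| < r) -> hat r x = 0.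
Proof.
by move=> H; apply: bump_eq0 => H'; apply: H => i; have := H' i; rewrite !mxE ltr_norml.
Qed.

Lemma integrable_hat r : vol.-integrable setT (EFin \o hat r).
Proof.
have [[mb ib] _] := tcont_bump 0 (const_mx (- r) : 'rV[R]_n) (const_mx r).
apply: (integrable_le (g := \1_(box (const_mx (- r)) (const_mx r)))) => //.
  move=> x _; rewrite ger0_norm ?hat_ge0// indicE.
  case: (boolP (x \in _)) => [_|]; first exact: hat_le1.
  by rewrite notin_setE => /bump_eq0 H; rewrite /hat H.
have [_] := L2_indic (measurable_box (const_mx (- r)) (const_mx r))
  (vol_box_lty (const_mx (- r) : 'rV[R]_n) (const_mx r)).
apply: eq_integrable => // x _ /=; congr EFin.
by rewrite indicE; case: (_ \in _); rewrite ?expr1n ?expr0n.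
Qed.

Definition hat_mass (r : R) : R := \int[vol]_x hat r x.

Lemma hat_mass_gt0 r : 0 < r -> 0 < hat_mass r.
Proof.
move=> r0; rewrite lt_neqAle Rintegral_ge0 ?andbT => [|x _]; last exact: hat_ge0.
apply/eqP => I0.
have H : {ae vol, forall x, setT x -> hat r x = 0}.
  exact: (Rintegral_restrict_ge0_eq0 mT (integrable_hat r) (fun x _ => hat_ge0 r x)
  (esym I0)).
have [N [mN N0 HN]] := H.
have : vol (box (const_mx (- r)) (const_mx r) : set 'rV[R]_n) = 0%E.
  apply/eqP; rewrite -measure_le0 -N0; apply: le_measure; rewrite ?inE//.
    exact: measurable_box.
  move=> x bx; apply: HN => /= /(_ Logic.I).
  by move: (@bump_gt0 _ _ 0 _ _ _ bx) => /gt_eqF/eqP.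
apply/eqP; rewrite gt_eqF//; apply: vol_box_gt0 => i.
by rewrite !mxE; lra.
Qed.

(** Convolution with a normalized hat of width r shifted by c. *)
Definition mollify (r : R) c U x : R :=
  (hat_mass r)^-1 * \int[vol]_y (hat r (x - y + c) * U y).

Lemma measurable_hat_shift r c : measurable_fun setT (fun y : 'rV[R]_n => hat r (c - y)).
Proof.
apply: (measurableT_comp (measurable_hat r)).
apply: measurable_fun_rVP => i; under eq_fun do rewrite !mxE.
by apply: measurable_funB => //; exact: measurable_coord_rV.
Qed.

Lemma integral_hat_shift r c :
  (\int[vol]_y (hat r (c - y))%:E = (hat_mass r)%:E)%E.
Proof.
have mh : measurable_fun setT (EFin \o hat r).
  by apply/measurable_EFinP; exact: measurable_hat.
rewrite /hat_mass fineK; last by apply: integrable_fin_num => //; exact: integrable_hat.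
rewrite -(ge0_integral_translate (- c) mh); last by move=> x; rewrite lee_fin hat_ge0.
by apply: eq_integral => y _ /=; rewrite -[in RHS]hatN opprB addrC.
Qed.

Lemma integrable_hat_shift r c : vol.-integrable setT (EFin \o (fun y => hat r (c - y))).
Proof.
apply/integrableP; split; first by apply/measurable_EFinP; exact: measurable_hat_shift.
under eq_integral do rewrite /= ger0_norm ?hat_ge0//.
by rewrite integral_hat_shift ltry.
Qed.

Lemma L2_hat_shift r c : L2 vol setT (fun y => hat r (c - y)).
Proof.
split; first exact: measurable_hat_shift.
apply: (@integrable_le _ _ _ vol setT (fun y => hat r (c - y) ^+ 2)
  (fun y => hat r (c - y))) => //.
- by apply: measurable_funX; exact: measurable_hat_shift.
- move=> y _; rewrite ger0_norm ?sqr_ge0// expr2.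
  by rewrite ler_piMr ?hat_ge0 ?hat_le1.
- exact: integrable_hat_shift.
Qed.

Lemma measurable_mollify r c U : measurable_fun setT U ->
  measurable_fun setT (mollify r c U).
Proof.
move=> mU; apply: measurable_funM => //.
pose f (xy : 'rV[R]_n * 'rV[R]_n) := hat r (xy.1 - xy.2 + c) * U xy.2.
suff mf : measurable_fun setT f by exact: (measurable_Rintegral_section vol mf).
apply: measurable_funM; last exact: (measurableT_comp mU measurable_snd).
apply: (measurableT_comp (measurable_hat r)); apply: measurable_fun_rVP => i.
under eq_fun do rewrite !mxE.
apply: measurable_funD => //; apply: measurable_funB;
  by apply: (measurableT_comp (measurable_coord_rV i)).
Qed.

(** The error is a mean of the differences U (z + x) - U x, to which [jensen_sqr]
    applies. *)
Lemma mollify_sqr_le r c U x : 0 < r -> L2 vol setT U ->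
  ((((mollify r c U x - U x) ^+ 2)%:E) <=
   \int[vol]_z ((hat_mass r)^-1 * (hat r (c - z) * (U (z + x)%R - U x) ^+ 2))%:E)%E.
Proof.
move=> r0 LU; have k0 := hat_mass_gt0 r0.
pose rho y := (hat_mass r)^-1 * hat r (x + c - y).
have mrho : measurable_fun setT rho by apply: measurable_funM => //; exact: measurable_hat_shift.
have rho0 y : 0 <= rho y by rewrite mulr_ge0 ?hat_ge0// invr_ge0 ltW.
have irho : vol.-integrable setT (EFin \o rho).
  by apply: integrable_scaleR => //; exact: integrable_hat_shift.
have rho1 : \int[vol]_y rho y = 1.
  rewrite RintegralZl//; last exact: integrable_hat_shift.
  by rewrite /Rintegral integral_hat_shift/= mulVf// gt_eqF.
have rhoU : vol.-integrable setT (EFin \o (fun y => rho y * U y)).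
  apply: L2_mul => //; apply: L2_scale => //; exact: L2_hat_shift.
have rhoU2 : vol.-integrable setT (EFin \o (fun y => rho y * U y ^+ 2)).
  apply: (integrable_bddM (C := (hat_mass r)^-1)) => //; last by case: LU.
  by move=> y _; rewrite ger0_norm// ler_piMr ?hat_le1// invr_ge0 ltW.
have [iJ J] := jensen_sqr (U x) mT (fun y _ => rho0 y) irho rhoU rhoU2 rho1.
have -> : mollify r c U x = \int[vol]_y (rho y * U y).
  rewrite /mollify -RintegralZl//; last first.
    by apply: L2_mul => //; under eq_fun do rewrite addrAC; exact: L2_hat_shift.
  by apply: eq_Rintegral => y _; rewrite mulrA /rho addrAC.
apply: (@le_trans _ _ (\int[vol]_y (rho y * (U y - U x) ^+ 2))%:E).
  by rewrite lee_fin.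
rewrite fineK; last exact: integrable_fin_num.
pose F y := (rho y * (U y - U x) ^+ 2)%:E.
rewrite -[leLHS]/(\int[vol]_y F y)%E -(ge0_integral_translate x (F := F)).
- rewrite le_eqVlt; apply/orP; left; apply/eqP/eq_integral => z _.
  have xcz : x + c - (z + x) = c - z by rewrite (addrC z) opprD addrACA subrr add0r.
  by rewrite /F /rho xcz -mulrA.
- apply/measurable_EFinP; apply: measurable_funM => //.
  by apply: measurable_funX; apply: measurable_funB => //; case: LU.
- by move=> y; rewrite lee_fin mulr_ge0 ?sqr_ge0.
Qed.

(** By [mollify_sqr_le] and Tonelli, the error is a mean of the quadratic errors
    of the translations by z, where z is at distance at most r from c, hence
    shorter than s. *)
Lemma mollify_near U e : 0 < e -> L2 vol setT U ->
  exists2 s, 0 < s & forall r c, 0 < r -> r + `|c| < s ->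
  (\int[vol]_x ((mollify r c U x - U x) ^+ 2)%:E <= e%:E)%E.
Proof.
move=> e0 LU; have [_ /(_ e e0)[s s0 Hs]] := L2_tcont LU.
exists s => // r c r0 rcs.
have k0 := hat_mass_gt0 r0.
have mU := LU.1.
pose G (xz : 'rV[R]_n * 'rV[R]_n) :=
  ((hat_mass r)^-1 * (hat r (c - xz.2) * (U (xz.2 + xz.1)%R - U xz.1) ^+ 2))%:E.
have mG : measurable_fun setT G.
  apply/measurable_EFinP; apply: measurable_funM => //; apply: measurable_funM.
    exact: (measurableT_comp (measurable_hat_shift r c) measurable_snd).
  apply: measurable_funX; apply: measurable_funB.
    apply: (measurableT_comp mU); apply: measurable_fun_rVP => i.
    under eq_fun do rewrite mxE.
    by apply: measurable_funD; apply: (measurableT_comp (measurable_coord_rV i)).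
  exact: (measurableT_comp mU measurable_fst).
have G0 xz : (0 <= G xz)%E.
  by rewrite lee_fin mulr_ge0 ?invr_ge0 ?(ltW k0)// mulr_ge0 ?hat_ge0 ?sqr_ge0.
apply: (@le_trans _ _ (\int[vol]_x \int[vol]_z G (x, z))%E).
  apply: ge0_le_integral => //.
  - by move=> x _; rewrite lee_fin sqr_ge0.
  - apply/measurable_EFinP; apply: measurable_funX; apply: measurable_funB => //.
    exact: measurable_mollify.
  - exact: measurable_integral_section.
  - by move=> x _; exact: mollify_sqr_le.
rewrite fubini_tonelli//.
apply: (@le_trans _ _ (\int[vol]_z (((hat_mass r)^-1 * e) * hat r (c - z))%:E)%E).
  have mGt : measurable_fun setT (fun z => \int[vol]_x G (x, z))%E.
    exact: measurable_fun_fubini_tonelli_G.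
  apply: ge0_le_integral => //.
  - by move=> z _; apply: integral_ge0 => x _; exact: G0.
  - apply/measurable_EFinP; apply: measurable_funM => //; exact: measurable_hat_shift.
  - move=> z _; rewrite /G /=.
    under eq_integral do rewrite mulrA EFinM.
    have [Lz _] := L2_translate z LU.
    have [mLz iLz] := L2_sub mT Lz LU.
    rewrite (_ : (\int[vol]_x _ = ((hat_mass r)^-1 * hat r (c - z))%:E *
       \int[vol]_x ((U (x + z)%R - U x) ^+ 2)%:E)%E); last first.
      rewrite -integralZl//; apply: eq_integral => x _.
      by rewrite [(z + x)%R]addrC.
    have [zs|zs] := ltP `|z| s.
      have -> : (\int[vol]_x ((U (x + z)%R - U x) ^+ 2)%:E)%E =
         (\int[vol]_x ((U (x + z)%R - U x) ^+ 2))%:E.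
        by rewrite fineK//; exact: integrable_fin_num.
      rewrite -EFinM lee_fin mulrAC ler_wpM2r ?hat_ge0// ler_wpM2l ?Hs//.
      by rewrite invr_ge0 ltW.
    rewrite hat_eq0 ?mulr0 ?mul0e// => H.
    have : `|c - z| <= r.
      by apply: norm_le_coord; [exact: ltW|move=> i; exact/ltW/H].
    move=> H1; have := ler_normD (c - z) (- c); rewrite addrAC subrr add0r !normrN.
    lra.
under eq_integral do rewrite EFinM.
rewrite integralZl//; last exact: integrable_hat_shift.
by rewrite integral_hat_shift -EFinM lee_fin mulrAC mulVf ?mul1r// gt_eqF.
Qed.

End mollifier.

(** * Density of a countable family of bumps in the first Sobolev space *)

Section jets.
Context {R : realType} {n : nat}.
Implicit Types (u v phi psi : 'rV[R]_n -> R) (g : 'I_n -> 'rV[R]_n -> R).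
Implicit Types (j : 'I_n.+1) (i : 'I_n).

(** A function and its gradient are handled as one family of n+1 functions, the
    function itself having index 0. *)
Definition jetof u g j : 'rV[R]_n -> R :=
  if unlift ord0 j is Some i then g i else u.

Definition jet phi := jetof phi (fun i => 'D_(delta_mx ord0 i) phi).

Lemma jetof0 u g : jetof u g ord0 = u.
Proof. by rewrite /jetof unlift_none. Qed.

Lemma jetofS u g i : jetof u g (lift ord0 i) = g i.
Proof. by rewrite /jetof liftK. Qed.

Lemma smooth_jet phi j : smooth phi -> smooth (jet phi j).
Proof.
move=> sphi; rewrite /jet /jetof; case: unliftP => // i _.
exact: smooth_derive.
Qed.

Lemma jet_cst0 j x : jet (cst 0) j x = 0.
Proof. by rewrite /jet /jetof; case: unliftP => // i _; rewrite derive_cst. Qed.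

Lemma jetD phi psi j x : smooth phi -> smooth psi ->
  jet (fun x => phi x + psi x) j x = jet phi j x + jet psi j x.
Proof.
move=> s1 s2; rewrite /jet /jetof; case: unliftP => // i _.
by rewrite -[LHS]/('D__ (phi + psi) x) deriveD//; exact: smooth_derivable.
Qed.

Lemma jetZ k phi j x : smooth phi ->
  jet (fun x => k * phi x) j x = k * jet phi j x.
Proof.
move=> s1; rewrite /jet /jetof; case: unliftP => // i _.
by rewrite -[LHS]/('D__ (k \*: phi) x) deriveZ//; exact: smooth_derivable.
Qed.

Lemma jet_sum I (s : seq I) (F : I -> 'rV[R]_n -> R) j x :
  (forall k, smooth (F k)) ->
  jet (fun x => \sum_(k <- s) F k x) j x = \sum_(k <- s) jet (F k) j x.
Proof.
move=> sF; elim: s => [|k s IH].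
  rewrite big_nil [X in jet X](_ : _ = cst 0) ?jet_cst0//.
  by apply/funext => y; rewrite big_nil.
rewrite big_cons -IH -jetD//.
  by congr (jet _ _ _); apply/funext => y; rewrite big_cons.
have := smooth_sum s sF; rewrite (_ : \sum_(k <- s) F k = fun x => \sum_(k <- s) F k x)//.
by apply/funext => y; rewrite (big_morph (fun g : 'rV[R]_n -> R => g y) (id1 := 0) (op1 := +%R)).
Qed.

Lemma jet_shift phi c j x : smooth phi ->
  jet (fun x => phi (x + c)) j x = jet phi j (x + c).
Proof.
move=> s1; rewrite /jet /jetof; case: unliftP => // i _.
have [_ ->//] := @derive_comp_affine _ _ _
  (idfun : {linear 'rV[R]_n -> 'rV[R]_n}) c phi (delta_mx ord0 i) x
  (fun _ => cvg_id) (smooth_differentiable _ s1).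
Qed.

Definition fam (l : nat) : 'rV[R]_n -> R :=
  if unpickle l is Some (a, b, k) then bump k (map_mx (@ratr R) a) (map_mx ratr b)
  else cst 0.

Lemma smooth_fam l : smooth (fam l).
Proof.
rewrite /fam; case: unpickle => [[[a b] k]|]; first exact: smooth_bump.
exact: smooth_cst.
Qed.

Definition comb (N : nat) (c : nat -> R) : 'rV[R]_n -> R :=
  fun x => \sum_(l < N) c l * fam l x.

Lemma smooth_comb N c : smooth (comb N c).
Proof.
have := @smooth_sum R 'rV[R]_n _ (index_enum 'I_N) (fun l x => c l * fam l x)
  (fun l => smoothZ (c l) (smooth_fam l)).
rewrite (_ : \sum_(l <- _) _ = comb N c)//.
apply/funext => y.
by rewrite (big_morph (fun g : 'rV[R]_n -> R => g y) (id1 := 0) (op1 := +%R)).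
Qed.

Definition in_span phi := exists N c, phi = comb N c.

Lemma comb_widen N M c : (N <= M)%N ->
  comb N c = comb M (fun l => if (l < N)%N then c l else 0).
Proof.
move=> NM; apply/funext => x; rewrite /comb.
rewrite (big_ord_widen M (fun l => c l * fam l x) NM) big_mkcond.
by apply: eq_bigr => l _; case: ifP => // _; rewrite mul0r.
Qed.

Lemma in_span_smooth phi : in_span phi -> smooth phi.
Proof. by move=> [N [c ->]]; exact: smooth_comb. Qed.

Lemma in_span0 : in_span (cst 0).
Proof. by exists 0%N, (cst 0); apply/funext => x; rewrite /comb big_ord0. Qed.

Lemma in_spanD phi psi : in_span phi -> in_span psi ->
  in_span (fun x => phi x + psi x).
Proof.
move=> [N [c ->]] [M [d ->]].
rewrite (comb_widen c (leq_maxl N M)) (comb_widen d (leq_maxr N M)).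
exists (maxn N M), (fun l => (if (l < N)%N then c l else 0) +
  (if (l < M)%N then d l else 0)); apply/funext => x.
by rewrite /comb -big_split/=; apply: eq_bigr => l _; rewrite mulrDl.
Qed.

Lemma in_spanZ k phi : in_span phi -> in_span (fun x => k * phi x).
Proof.
move=> [N [c ->]]; exists N, (fun l => k * c l); apply/funext => x.
by rewrite /comb mulr_sumr; apply: eq_bigr => l _; rewrite mulrA.
Qed.

Lemma in_span_bump a b k : in_span (bump k (map_mx (@ratr R) a) (map_mx ratr b)).
Proof.
exists (pickle (a, b, k)).+1, (fun l => (l == pickle (a, b, k))%:R).
apply/funext => x; rewrite /comb big_ord_recr/= eqxx mul1r big1 ?add0r.
  by rewrite /fam pickleK.
by move=> l _; rewrite ltn_eqF// mul0r.
Qed.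

Lemma in_span_sum I (s : seq I) (F : I -> 'rV[R]_n -> R) :
  (forall k, in_span (F k)) -> in_span (fun x => \sum_(k <- s) F k x).
Proof.
move=> sF; elim: s => [|k s IH].
  by under eq_fun do rewrite big_nil; exact: in_span0.
by under eq_fun do rewrite big_cons; exact: in_spanD.
Qed.

End jets.

Lemma cvg_sumR {R : realType} I (s : seq I) (F : I -> nat -> R) (l : I -> R) :
  (forall i, F i k @[k --> \oo] --> l i) ->
  \sum_(i <- s) F i k @[k --> \oo] --> \sum_(i <- s) l i.
Proof.
move=> H; elim: s => [|i s IH].
  by under eq_fun do rewrite big_nil; rewrite big_nil; exact: cvg_cst.
under eq_fun do rewrite big_cons.
by rewrite big_cons; exact: cvgD.
Qed.

Section approximable.
Context {R : realType} {n : nat}.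
Variable Omega : set 'rV[R]_n.
Hypothesis oOmega : open Omega.
Hypothesis bOmega : bounded_set Omega.
Local Notation vol := (lebesgue_rV R n).
Local Notation L2 := (L2 vol Omega).
Implicit Types (phi psi zeta : 'rV[R]_n -> R).
Implicit Types (U V : 'I_n.+1 -> 'rV[R]_n -> R) (j : 'I_n.+1) (i : 'I_n).

Lemma mOmega : measurable Omega.
Proof. exact: open_measurable_rV. Qed.

Lemma Omega_cube : exists M : R, forall x, Omega x -> `|x| < M.
Proof.
have [M [_ HM]] := bOmega; exists (M + 2) => x Ox.
have := HM (M + 1); rewrite ltrDl ltr01 => /(_ isT x Ox) /=.
by move=> /le_lt_trans; apply; lra.
Qed.

Lemma vol_Omega_lty : (vol Omega < +oo)%E.
Proof.
have [M HM] := Omega_cube.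
apply: le_lt_trans (vol_cbox_lty (const_mx (- M) : 'rV[R]_n) (const_mx M)).
apply: le_measure; rewrite ?inE//; [exact: mOmega|exact: measurable_cbox|].
move=> x /HM xM i; rewrite !mxE -ler_norml.
by apply: le_trans (coord_le_norm _ _) _; exact: ltW.
Qed.

Lemma compact_closure_Omega : compact (closure Omega).
Proof.
apply: bounded_closed_compact; last exact: closed_closure.
have [M HM] := Omega_cube.
exists M; split; first exact: num_real.
move=> K MK x cx; apply: contrapT => /negP; rewrite -ltNge => Kx.
have [y [Oy]] : Omega `&` ball x (`|x| - K) !=set0.
  apply: cx; apply: nbhsx_ballx; by rewrite subr_gt0.
rewrite -ball_normE /ball_/= => xy.
have := ler_normD (x - y) y; rewrite subrK; have := HM y Oy; lra.
Qed.

Lemma continuous_bounded_Omega phi : continuous phi ->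
  exists2 C, 0 < C & forall x, closure Omega x -> `|phi x| <= C.
Proof.
move=> cphi.
have : compact (phi @` closure Omega).
  apply: continuous_compact; last exact: compact_closure_Omega.
  by apply: continuous_subspaceT.
move=> /compact_bounded[M [_ HM]]; exists (`|M| + 1); first by rewrite ltr_wpDl.
move=> x cx; apply: HM; last by exists x.
by rewrite (le_lt_trans (ler_norm _))// ltrDl.
Qed.

Lemma smooth_L2 phi : smooth phi -> L2 phi.
Proof.
move=> sphi; have cphi := smooth_continuous sphi.
have [C _ HC] := continuous_bounded_Omega cphi.
apply: (L2_bounded (C := C)) => //; [exact: mOmega|exact: vol_Omega_lty| |].
  by apply: measurable_funTS; exact: continuous_measurable_rV.
by move=> x Ox; apply: HC; exact: subset_closure.
Qed.

Lemma jet_L2 phi j : smooth phi -> L2 (jet phi j).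
Proof. by move=> s; exact/smooth_L2/smooth_jet. Qed.

(** The closure of the span of the family for the H^1 norm on Omega, inside all
    (n+1)-tuples of square-integrable functions. *)
Definition approximable U := (forall j, L2 (U j)) /\
  forall e, 0 < e -> exists2 phi, in_span phi &
    \sum_j \int[vol]_(x in Omega) ((U j x - jet phi j x) ^+ 2) <= e.

Lemma approximable_close U : (forall j, L2 (U j)) ->
  (forall e, 0 < e -> exists2 V, approximable V &
    \sum_j \int[vol]_(x in Omega) ((U j x - V j x) ^+ 2) <= e) ->
  approximable U.
Proof.
move=> LU H; split=> // e e0; have e4 : 0 < e / 4 by rewrite divr_gt0.
have [V [LV HV] UV] := H _ e4; have [phi sphi Vphi] := HV _ e4.
exists phi => //.
apply: (@le_trans _ _ (\sum_j (2 * \int[vol]_(x in Omega) ((U j x - V j x) ^+ 2) +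
   2 * \int[vol]_(x in Omega) ((V j x - jet phi j x) ^+ 2)))).
  apply: ler_sum => j _.
  have := @Rintegral_sqrD _ _ _ vol Omega (fun x => U j x - V j x)
    (fun x => V j x - jet phi j x) mOmega.
  under eq_Rintegral do rewrite addrA subrK.
  apply; apply: L2_sub => //; try exact: mOmega.
  by apply: jet_L2; exact: in_span_smooth.
rewrite big_split/= -!mulr_sumr; lra.
Qed.

Lemma approximable_cvg U (F : nat -> 'I_n.+1 -> 'rV[R]_n -> R)
    (g : 'I_n.+1 -> 'rV[R]_n -> R) :
  (forall k, approximable (F k)) -> (forall j, measurable_fun Omega (U j)) ->
  (forall j x, Omega x -> F k j x @[k --> \oo] --> U j x) ->
  (forall j, L2 (g j)) -> (forall k j x, Omega x -> `|F k j x| <= g j x) ->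
  approximable U.
Proof.
move=> aF mU FU Lg Fg.
have H j := L2_cvg mOmega (fun k => ((aF k).1 j).1) (mU j) (FU j) (Lg j)
  (fun k => @Fg k j).
apply: approximable_close => [j|e e0]; first exact: (H j).1.
have : (fun k => \sum_j \int[vol]_(x in Omega) ((U j x - F k j x) ^+ 2)) @ \oo
    --> \sum_(j < n.+1) (0 : R).
  apply: cvg_sumR => j; exact: (H j).2.
rewrite big1// => /cvgrPdist_le/(_ e e0)[N _ HN].
exists (F N) => //; apply: le_trans (HN N (leqnn N)).
by rewrite sub0r normrN ler_norm.
Qed.

Lemma approximableD U V : approximable U -> approximable V ->
  approximable (fun j x => U j x + V j x).
Proof.
move=> [LU HU] [LV HV]; split=> [j|e e0]; first by apply: L2_add => //; exact: mOmega.
have e4 : 0 < e / 4 by rewrite divr_gt0.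
have [phi sphi Hphi] := HU _ e4; have [psi spsi Hpsi] := HV _ e4.
exists (fun x => phi x + psi x); first exact: in_spanD.
have sp := in_span_smooth sphi; have sq := in_span_smooth spsi.
apply: (@le_trans _ _ (\sum_j (2 * \int[vol]_(x in Omega) ((U j x - jet phi j x) ^+ 2) +
   2 * \int[vol]_(x in Omega) ((V j x - jet psi j x) ^+ 2)))).
  apply: ler_sum => j _.
  have := @Rintegral_sqrD _ _ _ vol Omega (fun x => U j x - jet phi j x)
    (fun x => V j x - jet psi j x) mOmega.
  under [in X in _ -> X]eq_Rintegral do rewrite jetD// opprD addrACA.
  by apply; apply: L2_sub => //; (exact: mOmega || exact: jet_L2).
rewrite big_split/= -!mulr_sumr; lra.
Qed.

Lemma approximableZ c U : approximable U -> approximable (fun j x => c * U j x).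
Proof.
move=> [LU HU]; split=> [j|e e0]; first by apply: L2_scale => //; exact: mOmega.
have c1 : 0 < c ^+ 2 + 1 by rewrite ltr_wpDl ?sqr_ge0.
have [phi sphi] := HU _ (divr_gt0 e0 c1).
rewrite ler_pdivlMr// => H; exists (fun x => c * phi x); first exact: in_spanZ.
have sp := in_span_smooth sphi.
apply: le_trans H; rewrite mulrC mulr_sumr; apply: ler_sum => j _.
under eq_Rintegral do rewrite jetZ// -mulrBr exprMn.
have LUp : L2 (fun x => U j x - jet phi j x).
  by apply: L2_sub => //; (exact: mOmega || exact: jet_L2).
rewrite RintegralZl//; [|exact: mOmega|exact: LUp.2].
by rewrite ler_wpM2r ?Rintegral_sqr_ge0// lerDl.
Qed.

Lemma approximable_span phi : in_span phi -> approximable (jet phi).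
Proof.
move=> sphi; split=> [j|e e0]; first exact/jet_L2/in_span_smooth.
exists phi => //; rewrite big1 ?ltW// => j _.
under eq_Rintegral do rewrite subrr expr0n.
by rewrite Rintegral_cst ?mul0r//; exact: mOmega.
Qed.

Lemma approximable_eq U V : (forall j x, Omega x -> U j x = V j x) ->
  approximable U -> approximable V.
Proof.
move=> UV [LU HU].
have LV j : L2 (V j).
  have [mU iU] := LU j; split.
    by apply: eq_measurable_fun mU => x; rewrite inE => /UV.
  by apply: eq_integrable iU => //; [exact: mOmega|move=> x; rewrite inE => /UV /= ->].
split=> // e /HU[phi sphi H]; exists phi => //.
apply: le_trans H; rewrite le_eqVlt; apply/orP; left; apply/eqP.
apply: eq_bigr => j _; apply: eq_Rintegral => x.
by rewrite inE => /UV ->.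
Qed.

End approximable.

Section kernel_sums.
Context {R : realType} {n : nat}.
Variable Omega : set 'rV[R]_n.
Hypothesis oOmega : open Omega.
Hypothesis bOmega : bounded_set Omega.
Local Notation vol := (lebesgue_rV R n).
Local Notation L2 := (L2 vol Omega).
Local Notation approximable := (approximable Omega).

Let mO : measurable Omega. Proof. exact: mOmega. Qed.
Let Ofin : (vol Omega < +oo)%E. Proof. exact: vol_Omega_lty. Qed.

Lemma closed_cbox (a b : 'rV[R]_n) : closed (cbox a b).
Proof.
have -> : cbox a b =
    \bigcap_(i in [set: 'I_n]) ((fun x : 'rV[R]_n => x ord0 i) @^-1` `[a 0 i, b 0 i]).
  apply/seteqP; split=> x /= H i; have := H i; rewrite /= in_itv//=.
  by move=> /(_ Logic.I).
apply: closed_bigI => i _; apply: closed_comp => [x _|]; last exact: interval_closed.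
exact: coord_continuous.
Qed.

Lemma jet_bump_eq0 k (a b : 'rV[R]_n) j x : ~ cbox a b x -> jet (bump k a b) j x = 0.
Proof.
move=> nx; rewrite /jet /jetof; case: unliftP => [i _|_]; last first.
  by apply: bump_eq0 => /box_cbox.
rewrite (@near_eq_derive _ _ _ _ (cst 0)) ?derive_cst//.
have : nbhs x (~` cbox a b).
  by apply: open_nbhs_nbhs; split=> //; apply: closed_openC; exact: closed_cbox.
apply: filterS => y ny; apply: bump_eq0 => /box_cbox.
exact: ny.
Qed.

Lemma jet_bump_bounded k (a b : 'rV[R]_n) j :
  exists2 C, 0 < C & forall x, `|jet (bump k a b) j x| <= C.
Proof.
have cj : continuous (jet (bump k a b) j).
  exact/smooth_continuous/smooth_jet/smooth_bump.
have : compact (jet (bump k a b) j @` cbox a b).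
  apply: continuous_compact; last exact: cbox_compact.
  exact: continuous_subspaceT.
move=> /compact_bounded[M [_ HM]]; exists (`|M| + 1); first by rewrite ltr_wpDl.
move=> x; have [cx|cx] := pselect (cbox a b x).
  apply: HM; last by exists x.
  by rewrite (le_lt_trans (ler_norm _))// ltrDl.
by rewrite jet_bump_eq0// normr0 ltW// ltr_wpDl.
Qed.

Let itv_shift (a k c s x : R) :
  (a - k + s <= x < a - k + c + s) = (a <= x - s + k < a + c).
Proof. by congr (_ && _); apply/idP/idP => h; lra. Qed.

Let dist_cell (a c s x y e : R) : a + s <= y -> y < a + c + s -> c <= e ->
  `|x - y + s - (x - a)| <= e.
Proof. by move=> h1 h2 h3; rewrite ler_norml; apply/andP; split; lra. Qed.

(** A convolution of a hat with an integrable function is a limit of Riemann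
    sums over grids of rational points, hence of combinations of the family. *)
Lemma approximable_kernel (m : nat) (s : 'rV[R]_n) (U : 'rV[R]_n -> R) :
  vol.-integrable Omega (EFin \o U) ->
  approximable (fun j x =>
    \int[vol]_(y in Omega) (jet (hat m.+1%:R^-1) j (x - y + s) * U y)).
Proof.
move=> iU; set r := m.+1%:R^-1 : R.
have mU : measurable_fun Omega U by apply/measurable_EFinP; exact: measurable_int iU.
have sh : smooth (hat r : 'rV[R]_n -> R) by exact: smooth_hat.
have cj j : continuous (jet (hat r) j : 'rV[R]_n -> R).
  exact/smooth_continuous/smooth_jet.
have /choice[C HC] : forall j, exists C, 0 < C /\ forall x : 'rV[R]_n, `|jet (hat r) j x| <= C.
  by move=> j; have [C C0 H] := jet_bump_bounded 0 (const_mx (- r) : 'rV[R]_n) (const_mx r) j; exists C.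
have [M HM] := Omega_cube bOmega.
(* Omega lies in the cube of half-side K centered at s. *)
pose K := (Num.truncn (M + `|s|)).+1.
have HK x i : Omega x -> `|x 0 i - s 0 i| < K%:R.
  move=> Ox; apply: (@lt_le_trans _ _ (M + `|s|)); last exact/ltW/truncnS_gt.
  apply: le_lt_trans (ler_normB _ _) _; apply: ltr_leD.
    exact: le_lt_trans (coord_le_norm _ _) (HM _ Ox).
  exact: coord_le_norm.
(* Grid of step 1/(N+1).  The translation by s, which may be irrational, is put
   in the cells, so that the corners q, hence the bumps, stay rational. *)
pose J (N : nat) : finType := {ffun 'I_n -> 'I_(N.+1 * (2 * K))}.
pose q N (j : J N) : 'rV[rat]_n := \row_i ((j i)%:R / N.+1%:R - K%:R).
pose cell N (j : J N) : set 'rV[R]_n := \bigcap_(i in [set: 'I_n])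
   ((fun x : 'rV[R]_n => x ord0 i) @^-1`
      `[ratr (q N j 0 i) + s 0 i, ratr (q N j 0 i) + N.+1%:R^-1 + s 0 i[).
have mcell N j : measurable (cell N j).
  apply: fin_bigcap_measurable; first exact: finite_finset.
  move=> i _; rewrite -[X in measurable X]setTI.
  by apply: measurable_coord_rV => //; exact: measurable_itv.
have mind N j : measurable_fun Omega (\1_(cell N j) : 'rV[R]_n -> R).
  by apply: measurable_indic; exact: mcell.
have qE N (j : J N) i : ratr (q N j 0 i) = (j i)%:R / N.+1%:R - K%:R :> R.
  by rewrite !mxE rmorphB/= fmorph_div/= !ratr_nat.
have cellP N j x : cell N j x <-> forall i,
    (j i)%:R <= N.+1%:R * (x 0 i - s 0 i + K%:R) < (j i).+1%:R.
  have N0 : 0 < N.+1%:R :> R by [].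
  have E i : (ratr (q N j 0 i) + s 0 i <= x 0 i < ratr (q N j 0 i) + N.+1%:R^-1 + s 0 i) =
      ((j i)%:R <= N.+1%:R * (x 0 i - s 0 i + K%:R) < (j i).+1%:R).
    rewrite qE -(ler_pdivrMl _ _ N0) -(ltr_pdivlMl _ _ N0) -(natr1 (j i)) mulrDr mulr1.
    rewrite ![N.+1%:R^-1 * _]mulrC.
    exact: itv_shift.
  split=> [H i|H i _]; first by rewrite -E; have := H i Logic.I; rewrite /= in_itv.
  by rewrite /= in_itv/= E.
have cell_ex N x : Omega x -> exists j, cell N j x /\
    forall j', j' != j -> ~ cell N j' x.
  move=> Ox; pose t i := N.+1%:R * (x 0 i - s 0 i + K%:R).
  have t0 i : 0 <= t i.
    rewrite mulr_ge0//; have := HK x i Ox; rewrite ltr_norml => /andP[h _]; lra.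
  have tlt i : (Num.truncn (t i) < N.+1 * (2 * K))%N.
    rewrite -(ltr_nat R); have /andP[h _] := truncn_itv (t0 i).
    apply: le_lt_trans h _; rewrite natrM ltr_pM2l// natrM.
    have := HK x i Ox; rewrite ltr_norml => /andP[_ h]; lra.
  exists [ffun i => Ordinal (tlt i)]; split.
    by apply/cellP => i; rewrite ffunE /=; exact: truncn_itv.
  move=> j' /eqP nj /cellP H; apply: nj; apply/ffunP => i; rewrite ffunE.
  by apply/val_inj => /=; apply/esym; apply: truncn_def; exact: H.
pose w N (j : J N) := \int[vol]_(y in Omega) (\1_(cell N j) y * U y).
pose b N (j : J N) : 'rV[R]_n -> R :=
   bump 0 (map_mx ratr (q N j - const_mx m.+1%:R^-1))
          (map_mx ratr (q N j + const_mx m.+1%:R^-1)).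
have qr : ratr (m.+1%:R^-1) = r by rewrite fmorphV rmorph_nat.
have bE N (j : J N) : b N j = fun x => hat r (x + - map_mx ratr (q N j)).
  apply/funext => x; rewrite /hat bump_shift; congr (bump _ _ _ _).
    apply/rowP => i; rewrite !mxE rmorphB [X in _ - X = _]qr opprK addrC.
    by [].
  apply/rowP => i; rewrite !mxE rmorphD [X in _ + X = _]qr opprK addrC.
  by [].
pose phi N : 'rV[R]_n -> R := fun x => \sum_(j : J N) w N j * b N j x.
have sphi N : in_span (phi N).
  by apply: in_span_sum => j; apply: in_spanZ; exact: in_span_bump.
have i1 N (j : J N) : vol.-integrable Omega (EFin \o (fun y => \1_(cell N j) y * U y)).
  apply: (@integrable_bddM _ _ _ vol Omega (\1_(cell N j)) U 1) => //.
  by move=> x _; rewrite indicE; case: (_ \in _); rewrite ?normr1 ?normr0.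
(* The Riemann sum as an integral: the kernel is frozen at the corner of the cell
   of y. *)
pose ker N j x y := \sum_(k : J N) (\1_(cell N k) y * jet (hat r) j (x - map_mx ratr (q N k))).
have kerE N j x y k : Omega y -> cell N k y -> 
    (forall j', j' != k -> ~ cell N j' y) ->
    ker N j x y = jet (hat r) j (x - map_mx ratr (q N k)).
  move=> Oy ky nk; rewrite /ker (bigD1 k)//= indicE mem_set// mul1r big1 ?addr0//.
  by move=> l lk; rewrite indicE memNset ?mul0r//; exact: nk.
have jphi N j x : jet (phi N) j x = \int[vol]_(y in Omega) (ker N j x y * U y).
  rewrite jet_sum; last by move=> k; apply: smoothZ; exact: smooth_bump.
  transitivity (\sum_(k : J N) \int[vol]_(y in Omega)
      (jet (hat r) j (x - map_mx ratr (q N k)) * (\1_(cell N k) y * U y))).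
    apply: eq_bigr => k _; rewrite jetZ; last exact: smooth_bump.
    by rewrite bE jet_shift// RintegralZl// mulrC.
  rewrite -Rintegral_sum//; last by move=> k; exact: integrable_scaleR.
  apply: eq_Rintegral => y _; rewrite mulr_suml; apply: eq_bigr => k _.
  by rewrite mulrA [X in X * U y]mulrC.
have kerC N j x y : Omega y -> `|ker N j x y| <= C j.
  by move=> Oy; have [k [ky nk]] := cell_ex N y Oy; rewrite (kerE _ _ _ _ k)// (HC j).2.
have iCU j : vol.-integrable Omega (EFin \o (fun y => C j * `|U y|)).
  by apply: integrable_scaleR => //; exact: integrable_norm.
apply: (@approximable_cvg _ _ _ oOmega bOmega _ (fun N => jet (phi N))
  (fun j => cst (\int[vol]_(y in Omega) (C j * `|U y|)))).
- by move=> N; exact: approximable_span.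
- move=> j; apply: measurable_funTS.
  under eq_fun do rewrite Rintegral_mkcond.
  pose f (xy : 'rV[R]_n * 'rV[R]_n) := jet (hat r) j (xy.1 - xy.2 + s) * (U \_ Omega) xy.2.
  have mf : measurable_fun setT f.
    apply: measurable_funM.
      apply: (measurableT_comp (continuous_measurable_rV (cj j))).
      apply: measurable_fun_rVP => i; under eq_fun do rewrite !mxE.
      apply: measurable_funD => //; apply: measurable_funB;
        by apply: (measurableT_comp (measurable_coord_rV i)).
    apply: (measurableT_comp (f := U \_ Omega)) => //.
    by apply/(measurable_restrictT _ mO).
  have := measurable_Rintegral_section vol mf.
  apply: eq_measurable_fun => x _; apply: eq_Rintegral => y _.
  by rewrite /f /= !patchE; case: ifP => // _; rewrite mulr0.
- move=> j x Ox; under eq_fun do rewrite jphi.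
  apply: (@Rintegral_cvg _ _ _ _ _ _ _ (fun y => C j * `|U y|)) => //.
  + move=> N; apply: measurable_funM => //; rewrite /ker.
    apply: measurable_sum => k.
    exact: (@measurable_funM _ _ _ _ (\1_(cell N k)) (cst _)).
  + apply: measurable_funM => //; apply: measurable_funTS.
    apply: (measurableT_comp (continuous_measurable_rV (cj j))).
    apply: measurable_fun_rVP => i; under eq_fun do rewrite !mxE.
    by apply: measurable_funD => //; apply: measurable_funB => //; exact: measurable_coord_rV.
  + move=> y Oy; apply: cvgM; last exact: cvg_cst.
    pose k N := sval (cid (cell_ex N y Oy)).
    have kP N : cell N (k N) y /\ forall j', j' != k N -> ~ cell N j' y.
      exact: svalP (cid (cell_ex N y Oy)).
    under eq_fun => N do rewrite (kerE N j x y (k N) Oy (kP N).1 (kP N).2).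
    have cq : x - map_mx ratr (q N (k N)) @[N --> \oo] --> x - y + s.
      apply/cvgrPdist_le => e e0; near=> N.
      have Ne : N.+1%:R^-1 <= e by apply/ltW; near: N; exact: near_infty_natSinv_lt (PosNum e0).
      apply: norm_le_coord; first exact: ltW.
      move=> i; have := (kP N).1 i Logic.I; rewrite /= in_itv/= => /andP[h1 h2].
      have zi : (map_mx ratr (q N (k N)) : 'rV[R]_n) 0 i = ratr (q N (k N) 0 i).
        by rewrite mxE.
      move: (map_mx _ _) zi => z zi; rewrite !mxE zi.
      exact: dist_cell h1 h2 Ne.
    have H := continuous_cvg _ (cj j _) cq; exact: H.
  + by move=> N y Oy; rewrite normrM ler_wpM2r// kerC.
- by move=> j; exact: L2_cst.
- move=> N j x Ox; rewrite jphi /=.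
  have ik : vol.-integrable Omega (EFin \o (fun y => ker N j x y * U y)).
    apply: (integrable_bddM (C := C j)) => //; last by move=> y; exact: kerC.
    apply: measurable_sum => k.
    exact: (@measurable_funM _ _ _ _ (\1_(cell N k)) (cst _)).
  apply: le_trans (le_normr_Rintegral mO ik) _.
  apply: le_Rintegral => //; first exact: integrable_norm.
  by move=> y Oy; rewrite normrM ler_wpM2r// kerC.
Unshelve. all: by end_near.
Qed.

End kernel_sums.

Local Notation L2_on := L2.

Section weak_jets.
Context {R : realType} {n : nat}.
Variable Omega : set 'rV[R]_n.
Hypothesis oOmega : open Omega.
Hypothesis bOmega : bounded_set Omega.
Local Notation vol := (lebesgue_rV R n).
Local Notation L2 := (L2 vol Omega).
Local Notation approximable := (approximable Omega).
Implicit Types (phi psi zeta : 'rV[R]_n -> R).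
Implicit Types (U V : 'I_n.+1 -> 'rV[R]_n -> R) (j : 'I_n.+1) (i : 'I_n).

Let mO : measurable Omega. Proof. exact: mOmega. Qed.
Let Ofin : (vol Omega < +oo)%E. Proof. exact: vol_Omega_lty. Qed.

(** The elements of H^1(Omega), each with its weak gradient. *)
Definition weak_jet U := (forall j, L2 (U j)) /\
  forall phi, Cc_infty Omega phi -> forall i,
    \int[vol]_(x in Omega) (U ord0 x * 'D_(delta_mx ord0 i) phi x) =
    - \int[vol]_(x in Omega) (U (lift ord0 i) x * phi x).

(** The Leibniz rule on jets. *)
Definition mulj zeta U : 'I_n.+1 -> 'rV[R]_n -> R :=
  jetof (fun x => zeta x * U ord0 x)
        (fun i x => zeta x * U (lift ord0 i) x +
                    'D_(delta_mx ord0 i) zeta x * U ord0 x).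

Lemma smooth_bddM phi u : smooth phi -> L2 u -> L2 (fun x => phi x * u x).
Proof.
move=> sphi Lu; have cphi := smooth_continuous sphi.
have [C _ HC] := continuous_bounded_Omega bOmega cphi.
apply: (L2_bddM (C := C)) => //.
  by apply: measurable_funTS; exact: continuous_measurable_rV.
by move=> x Ox; apply: HC; exact: subset_closure.
Qed.

Lemma mulj_L2 zeta U j : smooth zeta -> (forall j, L2 (U j)) -> L2 (mulj zeta U j).
Proof.
move=> sz LU; rewrite /mulj /jetof; case: unliftP => [i|] _.
  apply: L2_add => //; apply: smooth_bddM => //; exact: smooth_derive.
exact: smooth_bddM.
Qed.

(** The geometric content of a Lipschitz boundary: near Z there is an open cone of
    directions, around e, along which small translations do not leave Omega. *)
Definition inward (Z : set 'rV[R]_n) (e : 'rV[R]_n) (del tau : R) :=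
  forall (x v : 'rV[R]_n) eps, Omega x -> (forall i, `|v 0 i - e 0 i| <= del) ->
    0 < eps <= tau -> Z (x + eps *: v) -> Omega (x + eps *: v).

Lemma derive_reflect phi c (y v : 'rV[R]_n) : smooth phi ->
  'D_v (fun y => phi (c - y)) y = - 'D_v phi (c - y).
Proof.
move=> sphi.
have cN : continuous (-%R : 'rV[R]_n -> 'rV[R]_n) by exact: opp_continuous.
have [_] := @derive_comp_affine _ _ _ (-%R : {linear 'rV[R]_n -> 'rV[R]_n}) c phi v y
  cN (smooth_differentiable _ sphi).
under eq_fun do rewrite addrC.
move=> ->; rewrite addrC !deriveE ?raddfN//; exact: smooth_differentiable.
Qed.

Lemma smooth_reflect phi c : smooth phi -> smooth (fun y : 'rV[R]_n => phi (c - y)).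
Proof.
move=> sphi.
have cN : continuous (-%R : 'rV[R]_n -> 'rV[R]_n) by exact: opp_continuous.
have := @smooth_comp_affine _ _ _ (-%R : {linear 'rV[R]_n -> 'rV[R]_n}) c phi
  cN sphi.
rewrite (_ : (fun y : 'rV[R]_n => phi (c - y)) = fun y => phi (- y + c))//.
by apply/funext => y; rewrite addrC.
Qed.

(** For x in Omega, even close to the boundary, the translated hat times zeta is
    supported in Omega as a function of y, and may be used as a test function:
    differentiating the hat amounts to an integration by parts. *)
Lemma mollified_jet Z e del tau zeta U r eps x j :
  closed Z -> inward Z e del tau -> smooth zeta -> (forall y, ~ Z y -> zeta y = 0) ->
  weak_jet U -> 0 < eps <= tau -> r <= eps * del -> Omega x ->
  \int[vol]_(y in Omega) (jet (hat r) j (x - y + eps *: e) * (zeta y * U ord0 y)) =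
  \int[vol]_(y in Omega) (hat r (x - y + eps *: e) * mulj zeta U j y).
Proof.
move=> cZ iZ sz zZ [LU wU] /andP[eps0 epstau] rdel Ox.
rewrite /jet /mulj /jetof; case: unliftP => [i _|//].
set c := x + eps *: e.
have cE y : x - y + eps *: e = c - y by rewrite addrAC.
under eq_Rintegral do rewrite cE.
under [RHS]eq_Rintegral do rewrite cE.
have sh := @smooth_hat R n r.
pose psi := ((fun y => hat r (c - y)) : 'rV[R]_n -> R) * zeta.
have sh' : smooth (fun y : 'rV[R]_n => hat r (c - y)) by exact: smooth_reflect.
have spsi : smooth psi by exact: smoothM.
have Cpsi : Cc_infty Omega psi.
  split => //; exists (cbox (c - const_mx r) (c + const_mx r) `&` Z); split.
  - by apply: compact_closedI => //; exact: cbox_compact.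
    (* The direction from x to y is (y - x) / eps, which is del-close to e. *)
  - move=> y [yc Zy].
    have yE : y = x + eps *: (eps^-1 *: (y - x)).
      by rewrite scalerA mulfV ?gt_eqF// scale1r addrC subrK.
    rewrite yE; apply: (iZ _ _ _ Ox) => //; last by rewrite -yE.
      move=> i'; have := yc i'; rewrite !mxE => /andP[h1 h2].
      rewrite -(ler_pM2l eps0) -[X in X * _]gtr0_norm// -normrM mulrBr mulrA.
      rewrite mulfV ?gt_eqF// mul1r; apply: le_trans rdel.
      by rewrite ler_norml; apply/andP; split; lra.
    by rewrite eps0.
  - move=> y; rewrite -/(~ _) => /not_andP[nc|nZ]; rewrite /psi mulrfctE.
      rewrite hat_eq0 ?mul0r// => H; apply: nc => i'.
      have := H i'; rewrite !mxE ltr_norml => /andP[h1 h2].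
      by apply/andP; split; lra.
    by rewrite zZ ?mulr0.
have := wU _ Cpsi i.
have E y : 'D_(delta_mx ord0 i) psi y =
    - ('D_(delta_mx ord0 i) (hat r) (c - y) * zeta y) +
     hat r (c - y) * 'D_(delta_mx ord0 i) zeta y.
  rewrite deriveM; [|exact: smooth_derivable..].
  rewrite derive_reflect// /GRing.scale/=; ring.
have i1 : vol.-integrable Omega
    (EFin \o (fun y => 'D_(delta_mx ord0 i) (hat r) (c - y) * (zeta y * U ord0 y))).
  apply: L2_mul => //; last exact: smooth_bddM.
  apply: smooth_L2 => //.
  exact: (smooth_reflect c (smooth_derive _ sh)).
have i2 : vol.-integrable Omega
    (EFin \o (fun y => hat r (c - y) * ('D_(delta_mx ord0 i) zeta y * U ord0 y))).
  apply: L2_mul => //; first exact: smooth_L2.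
  by apply: smooth_bddM => //; exact: smooth_derive.
have i3 : vol.-integrable Omega
    (EFin \o (fun y => hat r (c - y) * (zeta y * U (lift ord0 i) y))).
  apply: L2_mul => //; first exact: smooth_L2.
  exact: smooth_bddM.
have -> : \int[vol]_(y in Omega) (U ord0 y * 'D_(delta_mx ord0 i) psi y) =
   \int[vol]_(y in Omega) (hat r (c - y) * ('D_(delta_mx ord0 i) zeta y * U ord0 y) -
     'D_(delta_mx ord0 i) (hat r) (c - y) * (zeta y * U ord0 y)).
  by apply: eq_Rintegral => y _; rewrite E; ring.
have -> : \int[vol]_(y in Omega) (hat r (c - y) *
     (zeta y * U (lift ord0 i) y + 'D_(delta_mx ord0 i) zeta y * U ord0 y)) =
   \int[vol]_(y in Omega) (hat r (c - y) * (zeta y * U (lift ord0 i) y) +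
     hat r (c - y) * ('D_(delta_mx ord0 i) zeta y * U ord0 y)).
  by apply: eq_Rintegral => y _; ring.
have -> : \int[vol]_(y in Omega) (U (lift ord0 i) y * psi y) =
   \int[vol]_(y in Omega) (hat r (c - y) * (zeta y * U (lift ord0 i) y)).
  by apply: eq_Rintegral => y _; rewrite /psi mulrfctE; ring.
rewrite RintegralB//  RintegralD'//; lra.
Qed.

(** Mollification by a hat shifted along e: the values of U that contribute at a
    point x of Omega are those around x + eps e, inside Omega.  The mollified jet
    is thus the jet of a smooth function, up to the boundary. *)
Lemma approximable_local Z e del tau zeta U :
  closed Z -> 0 < del -> 0 < tau -> inward Z e del tau ->
  smooth zeta -> (forall y, ~ Z y -> zeta y = 0) ->
  weak_jet U -> approximable (mulj zeta U).
Proof.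
move=> cZ del0 tau0 iZ sz zZ wU.
have LW j : L2 (mulj zeta U j) by apply: mulj_L2 => //; case: wU.
have LW0 j : L2_on vol setT (mulj zeta U j \_ Omega).
  have [mW iW] := LW j; split; first by apply/(measurable_restrictT _ mO).
  move/(integrable_mkcond _ mO) : iW; apply: eq_integrable => // x _ /=.
  by rewrite !patchE; case: ifP => //=; rewrite expr0n.
apply: approximable_close => // a a0.
have an0 : 0 < a / n.+1%:R by rewrite divr_gt0.
have /choice[s sP] : forall j, exists s, 0 < s /\ forall r c, 0 < r -> r + `|c| < s ->
  (\int[vol]_x ((mollify r c (mulj zeta U j \_ Omega) x - (mulj zeta U j \_ Omega) x) ^+ 2)%:E
    <= (a / n.+1%:R)%:E)%E.
  by move=> j; have [s s0 H] := mollify_near an0 (LW0 j); exists s.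
have [m [m1 m2]] : exists m : nat, m.+1%:R^-1 / del <= tau /\
    forall j, m.+1%:R^-1 + `|(m.+1%:R^-1 / del) *: e| < s j.
  have h1 : \forall m \near \oo, m.+1%:R^-1 / del <= tau.
    near=> m; rewrite ler_pdivrMr//; apply/ltW; near: m.
    exact: near_infty_natSinv_lt (PosNum (mulr_gt0 tau0 del0)).
  have h2 j : \forall m \near \oo, m.+1%:R^-1 + `|(m.+1%:R^-1 / del) *: e| < s j.
    have k0 : 0 < 1 + `|e| / del by rewrite ltr_wpDr// divr_ge0// ltW.
    near=> m; rewrite normrZ ger0_norm; last by rewrite divr_ge0// ltW.
    have -> : m.+1%:R^-1 + m.+1%:R^-1 / del * `|e| = m.+1%:R^-1 * (1 + `|e| / del).
      by rewrite mulrDr mulr1 mulrA mulrAC.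
    rewrite -ltr_pdivlMr//; near: m.
    exact: near_infty_natSinv_lt (PosNum (divr_gt0 (sP j).1 k0)).
  have h3 : \forall m \near \oo, forall j, m.+1%:R^-1 + `|(m.+1%:R^-1 / del) *: e| < s j.
    exact: filter_forall.
  have [m] := filter_ex (filterI h1 h3).
  by case=> m1 m2; exists m.
(* The shift r / del is the smallest that keeps the support of the hat in the cone. *)
set r := m.+1%:R^-1 in m1 m2; set c := (r / del) *: e in m2.
have r0 : 0 < r by rewrite invr_gt0.
have iW : vol.-integrable Omega (EFin \o (fun y => zeta y * U ord0 y)).
  have := integrable_L2 mO Ofin (LW ord0); rewrite /mulj jetof0; exact.
have aV := approximableZ oOmega bOmega (hat_mass (n := n) r)^-1
  (approximable_kernel oOmega bOmega m c iW).
exists (fun j x => (hat_mass (n := n) r)^-1 *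
   \int[vol]_(y in Omega) (jet (hat r) j (x - y + c) * (zeta y * U ord0 y))) => //.
apply: (@le_trans _ _ (\sum_(j < n.+1) (a / n.+1%:R))); last first.
  by rewrite sumr_const card_ord -[leLHS]mulr_natr divfK.
apply: ler_sum => j _.
have E x : Omega x -> (hat_mass (n := n) r)^-1 *
   \int[vol]_(y in Omega) (jet (hat r) j (x - y + c) * (zeta y * U ord0 y)) =
   mollify r c (mulj zeta U j \_ Omega) x.
  move=> Ox; rewrite /mollify; congr (_ * _).
  have eps0 : 0 < r / del <= tau by rewrite divr_gt0.
  have rdel : r <= r / del * del by rewrite divfK// gt_eqF.
  rewrite (mollified_jet j cZ iZ sz zZ wU eps0 rdel Ox).
  rewrite Rintegral_mkcond; apply: eq_Rintegral => y _.
  by rewrite !patchE; case: ifP => //; rewrite mulr0.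
have H := (sP j).2 r c r0 (m2 j).
have iD : vol.-integrable Omega (EFin \o (fun x => (mulj zeta U j x -
    (hat_mass (n := n) r)^-1 * \int[vol]_(y in Omega) (jet (hat r) j (x - y + c) *
      (zeta y * U ord0 y))) ^+ 2)).
  by have [] := L2_sub mO (LW j) (aV.1 j).
rewrite -lee_fin fineK; last exact: integrable_fin_num.
apply: le_trans H.
rewrite -[leLHS]/(\int[vol]_(x in Omega) ((mulj zeta U j x - _) ^+ 2)%:E)%E.
rewrite (eq_integral (fun x => ((mollify r c (mulj zeta U j \_ Omega) x -
   (mulj zeta U j \_ Omega) x) ^+ 2)%:E)); last first.
  move=> x; rewrite inE => Ox; rewrite E// patchE mem_set//.
  by congr (_%:E); ring.
apply: ge0_subset_integral => //.
  apply/measurable_EFinP; apply: measurable_funX; apply: measurable_funB.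
    by apply: measurable_mollify; case: (LW0 j).
  by case: (LW0 j).
by move=> x _; rewrite lee_fin sqr_ge0.
Unshelve. all: by end_near.
Qed.

End weak_jets.

Section density.
Context {R : realType} {n : nat}.
Variable Omega : set 'rV[R]_n.
Hypothesis oOmega : open Omega.
Hypothesis bOmega : bounded_set Omega.
Local Notation vol := (lebesgue_rV R n).
Local Notation L2 := (L2 vol Omega).
Local Notation approximable := (approximable Omega).
Local Notation weak_jet := (weak_jet Omega).
Implicit Types (phi psi zeta : 'rV[R]_n -> R).
Implicit Types (U V : 'I_n.+1 -> 'rV[R]_n -> R) (j : 'I_n.+1) (i : 'I_n).

Let mO : measurable Omega. Proof. exact: mOmega. Qed.
Let Ofin : (vol Omega < +oo)%E. Proof. exact: vol_Omega_lty. Qed.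

Lemma open_box (a b : 'rV[R]_n) : open (box a b).
Proof.
have -> : box a b = [set x | 0 < bump 0 a b x].
  apply/seteqP; split=> x /=; first exact: bump_gt0.
  by move=> h; apply: contrapT => /(bump_eq0 0) h0; rewrite h0 ltxx in h.
apply: (@open_comp _ _ (bump 0 a b) [set y | 0 < y]); last exact: open_gt.
by move=> x _; apply: smooth_continuous; exact: smooth_bump.
Qed.

(** The k first terms of the geometric series are at least a ^+ k. *)
Lemma natr_geometric_le (a : R) k : 0 <= a < 1 -> k%:R * a ^+ k <= (1 - a)^-1.
Proof.
move=> /andP[a0 a1].
rewrite -[leRHS]mul1r ler_pdivlMr ?subr_gt0// mulrC.
apply: (@le_trans _ _ ((1 - a) * \sum_(l < k) a ^+ l)).
  rewrite ler_wpM2l ?subr_ge0 ?(ltW a1)// mulr_natl.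
  rewrite -[X in _ *+ X <= _](card_ord k) -sumr_const.
  by apply: ler_sum => l _; apply: ler_wiXn2l => //; (exact: ltW || exact: ltnW).
have := subrX1 a k; rewrite -[a - 1]opprB mulNr => /eqP.
rewrite eq_sym eqr_oppLR opprB => /eqP ->.
by rewrite gerBl exprn_ge0.
Qed.

Lemma mulj_sum I (s : seq I) (F : I -> 'rV[R]_n -> R) U j x :
  (forall c, smooth (F c)) ->
  mulj (fun x => \sum_(c <- s) F c x) U j x = \sum_(c <- s) mulj (F c) U j x.
Proof.
move=> sF; rewrite /mulj /jetof; case: unliftP => [i _|_].
  rewrite big_split/= -!mulr_suml; congr (_ + _ * _).
  have := jet_sum s (lift ord0 i) x sF; rewrite /jet jetofS => ->.
  by apply: eq_bigr => c _; rewrite jetofS.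
by rewrite mulr_suml.
Qed.

Lemma approximable_sum (I : eqType) (s : seq I) (F : I -> 'I_n.+1 -> 'rV[R]_n -> R) :
  (forall c, c \in s -> approximable (F c)) ->
  approximable (fun j x => \sum_(c <- s) F c j x).
Proof.
elim: s => [_|c s IH H].
  apply: (approximable_eq oOmega _ (approximable_span oOmega bOmega in_span0)).
  by move=> j x _; rewrite jet_cst0 big_nil.
have : approximable (fun j x => F c j x + \sum_(c <- s) F c j x).
  apply: approximableD => //; first by apply: H; rewrite mem_head.
  by apply: IH => c' c's; apply: H; rewrite inE c's orbT.
by apply: approximable_eq => // j x _; rewrite big_cons.
Qed.

Lemma L2_norm u : L2 u -> L2 (fun x => `|u x|).
Proof.
move=> [mu_ iu]; split; first exact: measurableT_comp.
by under [X in _ \o X]eq_fun do rewrite real_normK ?num_real//.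
Qed.

(** Localization by a finite cover of the closure of Omega.  Instead of dividing by
    the sum s of the bumps eta_c of the cover, the weights eta_c P are used, where P
    is a partial sum of the Neumann series of 1 / s: their sum 1 - a ^+ K, with
    a = 1 - s / N, tends to 1, and its gradient tends to 0 because K a ^+ (K - 1) does. *)
Theorem weak_jet_approximable U : Omega !=set0 ->
  (forall x0, closure Omega x0 -> exists rho e del tau,
     [/\ 0 < rho, 0 < del, 0 < tau &
      inward Omega (cbox (x0 - const_mx rho) (x0 + const_mx rho)) e del tau]) ->
  weak_jet U -> approximable U.
Proof.
move=> [w0 Ow0] Hloc wU.
have LU := wU.1.
have /choice[rho rhoP] : forall x0, exists rho, 0 < rho /\ (closure Omega x0 ->
    exists e del tau, [/\ 0 < del, 0 < tau &
      inward Omega (cbox (x0 - const_mx rho) (x0 + const_mx rho)) e del tau]).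
  move=> x0; have [cx0|ncx0] := pselect (closure Omega x0); last by exists 1.
  by have [rho [e [del [tau [? ? ? ?]]]]] := Hloc _ cx0; exists rho; split=> // _; exists e, del, tau.
pose B c := box (c - const_mx (rho c)) (c + const_mx (rho c)) : set 'rV[R]_n.
have Bc c : B c c.
  by move=> i; have := (rhoP c).1; rewrite !mxE => ?; apply/andP; split; lra.
have := compact_closure_Omega bOmega; rewrite compact_cover.
move=> /(_ _ (closure Omega) B) [c _|x cx|D' DO Dcov].
- exact: open_box.
- by exists x.
pose eta c : 'rV[R]_n -> R := bump 0 (c - const_mx (rho c)) (c + const_mx (rho c)).
have seta c : smooth (eta c) by exact: smooth_bump.
pose ds := finmap.enum_fset D'.
pose N := (size ds).+1.
have N0 : 0 < N%:R :> R by [].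
pose s x := \sum_(c <- ds) eta c x.
have ss : smooth s.
  have := smooth_sum ds seta; rewrite (_ : \sum_(k <- _) _ = s)//.
  by apply/funext => y; rewrite (big_morph (fun g : 'rV[R]_n -> R => g y) (id1 := 0) (op1 := +%R)).
have s_ge0 x : 0 <= s x by apply: sumr_ge0 => c _; exact: bump_ge0.
have s_le x : s x <= N%:R.
  apply: (@le_trans _ _ (\sum_(c <- ds) 1)).
    by apply: ler_sum => c _; exact: bump_le1.
  by rewrite big_const_seq count_predT iter_addr_0 ler_nat.
have s_gt0 x : closure Omega x -> 0 < s x.
  move=> /Dcov[c /= cD Bcx].
  rewrite /s (big_rem c)//=; apply: ltr_pwDl; first exact: bump_gt0.
  by apply: sumr_ge0 => c' _; exact: bump_ge0.
have [m [mpos sm]] : exists m, 0 < m /\ forall x, closure Omega x -> m <= s x.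
  have [||c cO cmin] := @compact_EVT_min _ _ s (closure Omega) _ (compact_closure_Omega bOmega).
  - by exists w0; exact: subset_closure.
  - by apply: continuous_subspaceT; exact: smooth_continuous.
  - exists (s c); split; first by apply: s_gt0; rewrite inE in cO.
    by move=> x cx; apply: cmin; rewrite inE.
pose a x := 1 - N%:R^-1 * s x.
have sa : smooth a.
  have := smoothD (smooth_cst (V := 'rV[R]_n) 1) (smoothZ (- N%:R^-1) ss).
  rewrite (_ : _ + _ = a)//.
  by apply/funext => x; rewrite /a addrfctE mulNr.
have a0 x : 0 <= a x by rewrite subr_ge0 ler_pdivrMl// mulr1.
pose kap := N%:R^-1 * m.
have kap0 : 0 < kap by rewrite mulr_gt0// invr_gt0.
have akap x : closure Omega x -> a x <= 1 - kap.
  by move=> cx; rewrite lerB// ler_pM2l ?invr_gt0// sm.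
have a1 x : closure Omega x -> a x < 1 by move=> /akap; lra.
(* The even exponents leave a factor a ^+ k once K a ^+ (K - 1) has been bounded by
   a geometric sum. *)
pose K k := (k.+1 * 2)%N.
pose zeta k x := 1 - a x ^+ K k.
have szeta k : smooth (zeta k).
  have := smoothD (smooth_cst (V := 'rV[R]_n) 1) (smoothZ (-1) (smoothX (K k) sa)).
  rewrite (_ : _ + _ = zeta k)//.
  by apply/funext => x; rewrite /zeta addrfctE mulN1r exprfctE.
have Dzeta k i x : 'D_(delta_mx ord0 i) (zeta k) x =
    - ((K k)%:R * a x ^+ (K k).-1 * 'D_(delta_mx ord0 i) a x).
  have -> : zeta k = cst 1 - a ^+ K k.
    by apply/funext => y; rewrite /zeta addrfctE exprfctE.
  rewrite deriveB; [|exact: derivable_cst|exact/derivableX/smooth_derivable].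
  by rewrite derive_cst sub0r deriveX//; exact: smooth_derivable.
have azeta k : approximable (mulj (zeta k) U).
  pose P x := N%:R^-1 * \sum_(l < K k) a x ^+ l.
  have sP : smooth P.
    apply: smoothZ; have := smooth_sum (index_enum 'I_(K k)) (fun l => smoothX l sa).
    rewrite (_ : \sum_(l <- _) _ = fun x => \sum_(l < K k) a x ^+ l)//.
    apply/funext => y; rewrite (big_morph (fun g : 'rV[R]_n -> R => g y) (id1 := 0) (op1 := +%R))//.
    by apply: eq_bigr => l _; rewrite exprfctE.
  have zE : zeta k = fun x => \sum_(c <- ds) (eta c x * P x).
    apply/funext => x; rewrite -mulr_suml -/(s x) /P mulrA (mulrC (s x)).
    have -> : N%:R^-1 * s x = 1 - a x by rewrite /a opprB addrCA subrr addr0.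
    by rewrite -[1 - a x]opprB mulNr -subrX1 opprB.
  have sF c : smooth (fun x => eta c x * P x) by exact: smoothM.
  have : approximable (fun j x => \sum_(c <- ds) mulj (fun x => eta c x * P x) U j x).
    apply: approximable_sum => c cds.
    have [e [del [tau [del0 tau0 iZ]]]] : exists e del tau, [/\ 0 < del, 0 < tau &
      inward Omega (cbox (c - const_mx (rho c)) (c + const_mx (rho c))) e del tau].
      by apply: (rhoP c).2; have := DO c cds; rewrite inE.
    apply: (approximable_local oOmega bOmega _ del0 tau0 iZ (sF c)) => //.
      exact: closed_cbox.
    move=> y ny; rewrite /eta bump_eq0 ?mul0r// => /box_cbox.
    exact: ny.
  by rewrite zE; apply: approximable_eq => // j x _; rewrite mulj_sum.
have /choice[Ca HCa] : forall j, exists C, 0 < C /\ forall x, closure Omega x -> `|jet a j x| <= C.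
  move=> j; have [C C0 HC] := continuous_bounded_Omega bOmega
    (smooth_continuous (smooth_jet j sa)).
  by exists C.
have pow_le k x : closure Omega x -> 0 <= (K k)%:R * a x ^+ (K k).-1 <= 2 * kap^-1 * a x ^+ k.
  move=> cx; apply/andP; split; first by rewrite mulr_ge0 ?exprn_ge0.
  have -> : (K k).-1 = (k.+1 + k)%N by rewrite /K muln2 -addnn addnS.
  rewrite exprD mulrA ler_wpM2r ?exprn_ge0// /K natrM mulrAC mulrC ler_wpM2l//.
  apply: le_trans (natr_geometric_le _ _) _; first by rewrite a0 a1.
  by rewrite lef_pV2 ?posrE ?subr_gt0 ?a1//; have := akap x cx; lra.
have pow_cvg x : closure Omega x -> a x ^+ k @[k --> \oo] --> (0 : R).
  by move=> cx; apply: cvg_expr; rewrite ger0_norm ?a0 ?a1.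
have powK_cvg x : closure Omega x -> a x ^+ K k @[k --> \oo] --> (0 : R).
  move=> cx; apply: (@squeeze_cvgr _ _ _ _ (cst 0) (fun k => a x ^+ k)).
  - near=> k; rewrite exprn_ge0//=; apply: ler_wiXn2l => //; first exact/ltW/a1.
    by rewrite /K muln2 -addnn addSn; apply: leqW; exact: leq_addr.
  - exact: cvg_cst.
  - exact: pow_cvg.
apply: (@approximable_cvg _ _ _ oOmega bOmega _ (fun k => mulj (zeta k) U)
  (fun j x => `|U j x| + (2 * kap^-1 * Ca j) * `|U ord0 x|)) => //.
- by move=> j; case: (LU j).
- move=> j x Ox; have cx : closure Omega x by exact: subset_closure.
  have z1 : zeta k x @[k --> \oo] --> (1 : R).
    rewrite -[X in _ --> X](subr0 1); apply: cvgB; [exact: cvg_cst|exact: powK_cvg].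
  rewrite /mulj /jetof; case: unliftP => [i ->|->]; last first.
    by rewrite -[X in _ --> X]mul1r; apply: cvgM => //; exact: cvg_cst.
  rewrite -[X in _ --> X]addr0; apply: cvgD.
    by rewrite -[X in _ --> X]mul1r; apply: cvgM => //; exact: cvg_cst.
  rewrite -(mul0r (U ord0 x)); apply: cvgM; last exact: cvg_cst.
  under eq_fun do rewrite Dzeta.
  rewrite -oppr0; apply: cvgN; rewrite -(mul0r ('D_(delta_mx ord0 i) a x)).
  apply: cvgM; last exact: cvg_cst.
  apply: (@squeeze_cvgr _ _ _ _ (cst 0) (fun k => 2 * kap^-1 * a x ^+ k)).
  - by near=> k; exact: pow_le.
  - exact: cvg_cst.
  - rewrite -(mulr0 (2 * kap^-1)); apply: cvgM; [exact: cvg_cst|exact: pow_cvg].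
- move=> j; apply: L2_add => //; first exact: L2_norm.
  by apply: L2_scale => //; exact: L2_norm.
- move=> k j x Ox; have cx : closure Omega x by exact: subset_closure.
  have z1 : `|zeta k x| <= 1.
    have h1 : 0 <= a x ^+ K k by exact: exprn_ge0.
    have h2 : a x ^+ K k <= 1 by apply: exprn_ile1 => //; exact/ltW/a1.
    by rewrite /zeta ger0_norm ?subr_ge0// gerBl.
  rewrite /mulj /jetof; case: unliftP => [i ji|->]; last first.
    rewrite normrM -[leLHS]addr0; apply: lerD; first by rewrite ler_piMl.
    by rewrite mulr_ge0// mulr_ge0 ?(ltW (HCa _).1)// mulr_ge0// invr_ge0 ltW.
  rewrite -ji; apply: le_trans (ler_normD _ _) _; rewrite !normrM.
  apply: lerD; first by rewrite ler_piMl.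
  rewrite ler_wpM2r// Dzeta normrN normrM; apply: ler_pM => //.
    have /andP[h1 h2] := pow_le k x cx; rewrite ger0_norm//.
    apply: le_trans h2 _; rewrite -[leRHS]mulr1 ler_wpM2l//.
      by rewrite mulr_ge0// invr_ge0 ltW.
    by apply: exprn_ile1 => //; exact/ltW/a1.
  by have := (HCa j).2 x cx; rewrite /jet ji jetofS.
Unshelve. all: by end_near.
Qed.

End density.

Section Lipschitz_charts.
Context {R : realType} {d : nat}.
Variable Omega : set 'rV[R]_d.+1.
Hypothesis LOmega : bounded_Lipschitz_domain Omega.

Let oOmega : open Omega. Proof. by case: LOmega. Qed.

Lemma mulmx_coord_le (Q : 'M[R]_d.+1) (u : 'rV[R]_d.+1) c j : 0 <= c ->
  (forall i, `|u 0 i| <= c) ->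
  `|(u *m Q) 0 j| <= c * \sum_k \sum_l `|Q k l|.
Proof.
move=> c0 uc; rewrite mxE; apply: le_trans (ler_norm_sum _ _ _) _.
rewrite mulr_sumr; apply: ler_sum => k _; rewrite normrM.
apply: ler_pM => //; rewrite (bigD1 j)//= lerDl; exact: sumr_ge0.
Qed.

(** At a boundary point, translations in the directions near the vertical axis
    of the chart stay above the Lipschitz graph. *)
Lemma Lipschitz_inward x0 : closure Omega x0 -> exists rho e del tau,
  [/\ 0 < rho, 0 < del, 0 < tau &
    inward Omega (cbox (x0 - const_mx rho) (x0 + const_mx rho)) e del tau].
Proof.
have cboxP rho (y : 'rV[R]_d.+1) : 0 < rho ->
    cbox (x0 - const_mx rho) (x0 + const_mx rho) y -> `|x0 - y| <= rho.
  move=> rho0 H; apply: norm_le_coord; first exact: ltW.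
  move=> i; have := H i; rewrite !mxE => /andP[h1 h2].
  by rewrite ler_norml; apply/andP; split; lra.
move=> cx0; have [Ox0|nOx0] := pselect (Omega x0).
  have /nbhs_ballP[e /= e0 eO] : nbhs x0 Omega by exact: open_nbhs_nbhs.
  exists (e / 2), 0, 1, 1; split; rewrite ?divr_gt0//.
  move=> x v eps _ _ _ /cboxP; rewrite divr_gt0// => /(_ isT) H.
  apply: eO; rewrite -ball_normE /ball_/=; apply: le_lt_trans H _.
  by rewrite ltr_pdivrMr// mulr_natr mulr2n ltrDl.
have [_ _ _ _ /(_ x0)[]] := LOmega; first by split=> // /interior_subset.
move=> Q [gam [QQ [L0 [_ HL0]] /nbhs_ballP[r /= r0 Hr]]].
have QTQ : Q^T *m Q = 1%:M by apply: mulmx1C.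
pose L := `|L0| + 1.
have L_gt0 : 0 < L by rewrite ltr_wpDl.
have HL a b : gam a - gam b <= L * `|a - b|.
  have LL : L0 < L by rewrite (le_lt_trans (ler_norm _))// ltrDl.
  by apply: le_trans (ler_norm _) _; exact: (HL0 L LL (a, b) (conj Logic.I Logic.I)).
have [e eQ] : exists e : 'rV[R]_d.+1, e *m Q = delta_mx 0 0.
  by exists (delta_mx 0 0 *m Q^T); rewrite -mulmxA QTQ mulmx1.
(* e is the vertical axis of the chart; given the size of Q and the Lipschitz
   constant, del is so small that a direction del-close to e is steeper than the
   graph. *)
pose C := \sum_k \sum_l `|Q k l|.
have C0 : 0 <= C by apply: sumr_ge0 => k _; apply: sumr_ge0.
have D0 : 0 < 2 * (C + 1) * (L + 1) by rewrite !mulr_gt0// ltr_wpDl// ltW.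
pose del := (2 * (C + 1) * (L + 1))^-1.
have del0 : 0 < del by rewrite invr_gt0.
have delC : del * C * (L + 1) < 1.
  rewrite /del -mulrA mulrC ltr_pdivrMr// mul1r.
  by have := mulr_ge0 C0 (ltW L_gt0); nra.
have main (v : 'rV[R]_d.+1) : (forall i, `|v 0 i - e 0 i| <= del) ->
    L * `|rsubmx (v *m Q : 'rV[R]_(1 + d))| < (v *m Q) 0 0.
  move=> ve.
  have vQ : v *m Q = delta_mx 0 0 + (v - e) *m Q by rewrite mulmxBl eQ addrC subrK.
  have H j : `|((v - e) *m Q) 0 j| <= del * C.
    by apply: mulmx_coord_le; [exact: ltW|move=> i; rewrite !mxE].
  have h1 : 1 - del * C <= (v *m Q) 0 0.
    have -> : (v *m Q) 0 0 = 1 + ((v - e) *m Q) 0 0.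
      by rewrite {1}vQ mxE [delta_mx _ _ _ _]mxE !eqxx.
    by have := H 0; rewrite ler_norml => /andP[h _]; lra.
  have h2 : `|rsubmx (v *m Q : 'rV[R]_(1 + d))| <= del * C.
    apply: norm_le_coord => [|i]; first by rewrite mulr_ge0// ltW.
    by rewrite mxE vQ mxE [delta_mx _ _ _ _]mxE eqxx/= add0r.
  have := ler_wpM2l (ltW L_gt0) h2; lra.
pose tau := r / (4 * (`|e| + del + 1)).
have k0 : 0 < `|e| + del + 1 by rewrite ltr_wpDl// addr_ge0// ltW.
have tau0 : 0 < tau by rewrite divr_gt0// mulr_gt0.
exists (r / 2), e, del, tau; split; [by rewrite divr_gt0|by []|by []|].
move=> x v eps Ox ve /andP[eps0 epstau] Zy.
set y := x + eps *: v in Zy *.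
have yx0 : `|x0 - y| <= r / 2 by apply: cboxP => //; rewrite divr_gt0.
have vn : `|v| <= `|e| + del.
  rewrite -(subrK e v) addrC; apply: le_trans (ler_normD _ _) _; rewrite lerD2l.
  by apply: norm_le_coord; [exact: ltW|move=> i; rewrite !mxE].
have xx0 : `|x0 - x| < r.
  have -> : x0 - x = (x0 - y) + eps *: v by rewrite /y opprD addrA subrK.
  apply: le_lt_trans (ler_normD _ _) _; rewrite normrZ gtr0_norm//.
  have h : eps * `|v| <= r / 4.
    apply: (@le_trans _ _ (tau * (`|e| + del + 1))).
      apply: ler_pM => //; first exact: ltW.
      by apply: le_trans vn _; rewrite lerDl.
    by rewrite /tau invfM mulrA mulfVK// gt_eqF.
  lra.
have Oxy z : `|x0 - z| < r -> Omega z <->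
    gam (rsubmx (z *m Q : 'rV[R]_(1 + d))) < (z *m Q) ord0 ord0.
  by move=> h; apply: Hr; rewrite -ball_normE.
apply/Oxy; first lra.
have /(Oxy x xx0) hx := Ox.
pose rs (z : 'rV[R]_d.+1) := rsubmx (z *m Q : 'rV[R]_(1 + d)).
have yQ : y *m Q = x *m Q + eps *: (v *m Q) by rewrite mulmxDl scalemxAl.
have rsy : rs y - rs x = eps *: rs v.
  have rsE z i : rs z 0 i = (z *m Q) 0 (rshift 1 i : 'I_d.+1) by rewrite mxE.
  apply/rowP => i; rewrite [LHS]mxE [X in _ + X]mxE [RHS]mxE !rsE yQ.
  by rewrite [X in X - _]mxE [X in _ + X - _]mxE addrAC subrr add0r.
have := HL (rs y) (rs x); rewrite rsy normrZ gtr0_norm// => h1.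
rewrite -/(rs y) yQ [ltRHS]mxE [X in _ + X]mxE.
have h2 : eps * (L * `|rs v|) < eps * (v *m Q) 0 0 by rewrite ltr_pM2l// main.
rewrite -/(rs x) in hx; lra.
Qed.

End Lipschitz_charts.

(** * Galerkin projections *)

Section gram_schmidt.
Context {R : realType} {V : lmodType R}.
Variable B : V -> V -> R.
Hypothesis BD : forall u v w, B (u + v) w = B u w + B v w.
Hypothesis BZ : forall k u w, B (k *: u) w = k * B u w.
Hypothesis BC : forall u v, B u v = B v u.
Hypothesis B_ge0 : forall u, 0 <= B u u.

Lemma BZr k u w : B w (k *: u) = k * B w u.
Proof. by rewrite BC BZ BC. Qed.

Lemma B0 w : B 0 w = 0.
Proof. by rewrite -(scale0r 0) BZ mul0r. Qed.

Lemma BB u v w : B (u - v) w = B u w - B v w.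
Proof. by rewrite BD -scaleN1r BZ mulN1r. Qed.

Lemma Bsum I (s : seq I) (F : I -> V) w :
  B (\sum_(i <- s) F i) w = \sum_(i <- s) B (F i) w.
Proof.
elim: s => [|i s IH]; first by rewrite !big_nil B0.
by rewrite !big_cons BD IH.
Qed.

(** Otherwise c - 2 L (k r) would be unbounded below as k varies. *)
Lemma linear_null (L : V -> R) c r : (forall k u, L (k *: u) = k * L u) ->
  (forall a, 0 <= c - 2 * L a + B a a) -> B r r = 0 -> L r = 0.
Proof.
move=> LZ H r0; apply/eqP/contraT => Lr.
have := H (((c + 1) / (2 * L r)) *: r).
rewrite LZ BZ BZr r0 !mulr0 addr0.
have -> : c - 2 * ((c + 1) / (2 * L r) * L r) = -1 by field.
by rewrite ler0N1.
Qed.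

Lemma null_B r v : B r r = 0 -> B r v = 0.
Proof.
move=> r0; apply: (@linear_null (fun u => B u v) (B v v)) r0 => [k u|a].
  exact: BZ.
have E : B (v - a) (v - a) = B v v - 2 * B a v + B a a.
  by rewrite BB [B v _]BC [B a (v - a)]BC !BB [B v a]BC; ring.
by rewrite -E.
Qed.

Lemma nullD r s : B r r = 0 -> B s s = 0 -> B (r + s) (r + s) = 0.
Proof. by move=> r0 s0; rewrite BD (null_B _ r0) (null_B _ s0) addr0. Qed.

Lemma nullZ k r : B r r = 0 -> B (k *: r) (k *: r) = 0.
Proof. by move=> r0; rewrite BZ BZr r0 !mulr0. Qed.

Definition orthonormal m (e : nat -> V) := forall i j, (i < m)%N -> (j < m)%N ->
  B (e i) (e j) = (i == j)%:R.

Definition proj m (e : nat -> V) u := \sum_(i < m) B u (e i) *: e i.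

Lemma B_comb m e (c : nat -> R) j : orthonormal m e -> (j < m)%N ->
  B (\sum_(i < m) c i *: e i) (e j) = c j.
Proof.
move=> oe jm; rewrite Bsum (bigD1 (Ordinal jm))//= BZ oe// eqxx mulr1 big1 ?addr0//.
move=> i ij; rewrite BZ oe// [_ == _](_ : _ = false) ?mulr0//.
by apply: contra_neqF ij => /eqP ij; exact/val_inj.
Qed.

Lemma B_comb2 m e (c d : nat -> R) : orthonormal m e ->
  B (\sum_(i < m) c i *: e i) (\sum_(i < m) d i *: e i) = \sum_(i < m) c i * d i.
Proof.
move=> oe; rewrite BC Bsum; apply: eq_bigr => i _.
by rewrite BZ BC B_comb// mulrC.
Qed.

(** The form is only semi-definite: vectors whose remainder is null are skipped, and
    the family may be shorter than N. *)
Lemma gram_schmidt (phi : nat -> V) N : exists m e, orthonormal m e /\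
  forall l, (l < N)%N -> B (phi l - proj m e (phi l)) (phi l - proj m e (phi l)) = 0.
Proof.
elim: N => [|N [m [e [oe He]]]]; first by exists 0%N, (fun=> 0).
set r := phi N - proj m e (phi N).
have [r0|r0] := eqVneq (B r r) 0.
  exists m, e; split=> // l; rewrite ltnS leq_eqVlt => /orP[/eqP ->//|]; exact: He.
have rpos : 0 < B r r by rewrite lt_def r0 B_ge0.
have re i : (i < m)%N -> B r (e i) = 0.
  by move=> im; rewrite BB (B_comb (fun i => B (phi N) (e i)) oe im) subrr.
pose k := (Num.sqrt (B r r))^-1.
pose e' i := if i == m then k *: r else e i.
have k2 : k * (k * B r r) = 1.
  rewrite mulrA -expr2 exprVn sqr_sqrtr ?mulVf//; exact: ltW.
have e'E i : (i < m)%N -> e' i = e i by move=> im; rewrite /e' ltn_eqF.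
have e'm : e' m = k *: r by rewrite /e' eqxx.
have oe' : orthonormal m.+1 e'.
  move=> i j; rewrite !ltnS leq_eqVlt => /orP[/eqP ->|im];
    rewrite leq_eqVlt => /orP[/eqP ->|jm].
  - by rewrite e'm BZ BZr k2 eqxx.
  - by rewrite e'm e'E// BZ re// mulr0 gtn_eqF.
  - by rewrite e'm e'E// BZr BC re// mulr0 ltn_eqF.
  - by rewrite !e'E// oe.
have proj' u : proj m.+1 e' u = proj m e u + (k * B u r) *: (k *: r).
  rewrite /proj big_ord_recr/= e'm BZr; congr (_ + _).
  by apply: eq_bigr => i _; rewrite e'E.
exists m.+1, e'; split=> // l; rewrite ltnS leq_eqVlt => /orP[/eqP ->|lN].
  rewrite proj'.
  have -> : B (phi N) r = B r r.
    have -> : B (phi N) r = B (r + proj m e (phi N)) r by rewrite subrK.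
    rewrite BD Bsum big1 ?addr0// => i _.
    by rewrite BZ [B (e i) r]BC re ?mulr0.
  rewrite scalerA (_ : k * B r r * k = 1) ?scale1r; last by rewrite mulrAC -mulrA.
  by rewrite opprD addrA subrr -(scale0r 0) BZ mul0r.
rewrite proj' opprD addrA; apply: nullD; first exact: He.
have -> : B (phi l) r = 0.
  have nl := He _ lN.
  have -> : B (phi l) r = B (phi l - proj m e (phi l)) r + B (proj m e (phi l)) r.
    by rewrite -BD subrK.
  rewrite null_B// add0r Bsum big1// => i _.
  by rewrite BZ [B (e i) r]BC re ?mulr0.
by rewrite mulr0 scale0r oppr0 B0.
Qed.

Definition projects m e u := B (u - proj m e u) (u - proj m e u) = 0.

Lemma projects0 m e : projects m e 0.
Proof.
rewrite /projects (_ : proj m e 0 = 0) ?subrr ?B0//.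
by rewrite /proj big1// => i _; rewrite B0 scale0r.
Qed.

Lemma projectsD m e u v : projects m e u -> projects m e v -> projects m e (u + v).
Proof.
move=> hu hv; rewrite /projects (_ : proj m e (u + v) = proj m e u + proj m e v).
  by rewrite opprD addrACA; exact: nullD.
by rewrite /proj -big_split/=; apply: eq_bigr => k _; rewrite BD scalerDl.
Qed.

Lemma projectsZ m e k u : projects m e u -> projects m e (k *: u).
Proof.
move=> hu; rewrite /projects (_ : proj m e (k *: u) = k *: proj m e u).
  by rewrite -scalerBr; exact: nullZ.
by rewrite /proj scaler_sumr; apply: eq_bigr => i _; rewrite BZ scalerA.
Qed.

Section best_approximation.
Variables (m : nat) (e : nat -> V).
Hypothesis oe : orthonormal m e.
Hypothesis span_e : forall a, B (a - proj m e a) (a - proj m e a) = 0.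
Variables (L : V -> R) (c : R).
Hypothesis LD : forall u v, L (u + v) = L u + L v.
Hypothesis LZ : forall k u, L (k *: u) = k * L u.
Hypothesis LB : forall a, 0 <= c - 2 * L a + B a a.

Lemma L_comb (d : nat -> R) :
  L (\sum_(i < m) d i *: e i) = \sum_(i < m) d i * L (e i).
Proof.
elim/big_rec2 : _ => [|i x y _ <-]; first by rewrite -(scale0r 0) LZ mul0r.
by rewrite LD LZ.
Qed.

(** Completing the square: the best approximation has coordinates L (e i). *)
Lemma dist_proj a : c - \sum_(i < m) L (e i) ^+ 2 <= c - 2 * L a + B a a.
Proof.
have L0 : L (a - proj m e a) = 0 by exact: linear_null LZ LB (span_e a).
have LE : L a = \sum_(i < m) B a (e i) * L (e i).
  by rewrite -(L_comb (fun i => B a (e i))) -[in LHS](subrK (proj m e a) a) LD L0 add0r.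
have BE : B a a = \sum_(i < m) B a (e i) ^+ 2.
  have n0 := null_B a (span_e a).
  have h : B a a = B (proj m e a) a by apply/eqP; rewrite -subr_eq0 -BB n0.
  rewrite h Bsum; apply: eq_bigr => i _.
  by rewrite BZ BC expr2.
rewrite LE BE -addrA lerD2l mulr_sumr -!sumrN -big_split/=.
by apply: ler_sum => i _; have := sqr_ge0 (L (e i) - B a (e i)); nra.
Qed.

Lemma dist_proj_eq (a := \sum_(i < m) L (e i) *: e i) :
  c - 2 * L a + B a a = c - \sum_(i < m) L (e i) ^+ 2.
Proof.
rewrite /a (L_comb (fun i => L (e i))) (B_comb2 (fun i => L (e i)) (fun i => L (e i)) oe).
rewrite -[X in 2 * X]/(\sum_(i < m) L (e i) * L (e i)).
under [in RHS]eq_bigr do rewrite expr2.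
ring.
Qed.

Lemma dist_proj_ge0 : 0 <= c - \sum_(i < m) L (e i) ^+ 2.
Proof. by rewrite -dist_proj_eq; exact: LB. Qed.

End best_approximation.

End gram_schmidt.

(** * Fubini's theorem for real-valued integrals *)

Section Rfubini.
Context d1 d2 (T1 : measurableType d1) (T2 : measurableType d2) {R : realType}.
Variable m1 : {sigma_finite_measure set T1 -> \bar R}.
Variable m2 : {sigma_finite_measure set T2 -> \bar R}.

Lemma integrable_fine d (T : measurableType d) (mu : {measure set T -> \bar R})
  (F : T -> \bar R) : mu.-integrable setT F ->
  mu.-integrable setT (EFin \o (fine \o F)) /\
  \int[mu]_x fine (F x) = fine (\int[mu]_x F x)%E.
Proof.
move=> iF; have mF := measurable_int _ iF.
have aeE : ae_eq mu setT F (EFin \o (fine \o F)).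
  have := integrable_ae measurableT iF.
  by apply: filterS => x /(_ Logic.I) Fx _ /=; rewrite fineK.
have mfF : measurable_fun setT (EFin \o (fine \o F)).
  by apply/measurable_EFinP; apply: (measurableT_comp (f := fine)).
split; last first.
  congr fine; apply: ae_eq_integral => //.
  by apply: filterS aeE => x h Dx; rewrite h.
have /integrableP[_ Foo] := iF; apply/integrableP; split => //.
suff -> : (\int[mu]_x `|(EFin \o (fine \o F)) x| = \int[mu]_x `|F x|)%E by [].
apply: ae_eq_integral => //; try exact: measurableT_comp.
by apply: filterS aeE => x h Dx /=; rewrite [in RHS]h.
Qed.

Lemma integrable_tensor (u : T1 -> R) (v : T2 -> R) :
  m1.-integrable setT (EFin \o u) -> m2.-integrable setT (EFin \o v) ->
  (m1 \x m2)%E.-integrable setT (EFin \o (fun z => u z.1 * v z.2)).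
Proof.
move=> /integrableP[mu_ uoo] /integrableP[mv voo].
have mu' : measurable_fun setT u by exact/measurable_EFinP.
have mv' : measurable_fun setT v by exact/measurable_EFinP.
apply/integrable12ltyP.
  apply/measurable_EFinP; apply: measurable_funM.
    exact: (measurableT_comp mu' measurable_fst).
  exact: (measurableT_comp mv' measurable_snd).
have v0 : (0 <= \int[m2]_y `|(v y)%:E|)%E by apply: integral_ge0.
have E x : (\int[m2]_y `|(u x * v y)%:E| = `|(u x)%:E| * \int[m2]_y `|(v y)%:E|)%E.
  rewrite -ge0_integralZl//; last exact: measurableT_comp.
  by apply: eq_integral => y _; rewrite EFinM abseM.
under eq_integral do rewrite E.
rewrite ge0_integralZr//; last exact: measurableT_comp.
by apply: lte_mul_pinfty voo; [|rewrite ge0_fin_numE//]; exact: integral_ge0.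
Qed.

Variable f : T1 * T2 -> R.
Hypothesis imf : (m1 \x m2)%E.-integrable setT (EFin \o f).

Lemma Rfubini_ae : {ae m1, forall x, m2.-integrable setT (EFin \o (fun y => f (x, y)))}.
Proof. by have := ae_integrable1 imf. Qed.

Lemma Rfubini_integrable1 :
  m1.-integrable setT (EFin \o (fun x => \int[m2]_y f (x, y))).
Proof. by have [] := integrable_fine (integrable_fubini_F imf). Qed.

Lemma Rfubini_integrable2 :
  m2.-integrable setT (EFin \o (fun y => \int[m1]_x f (x, y))).
Proof.
have mf := measurable_int _ imf.
have H : (m2 \x m1)%E.-integrable setT (EFin \o (fun yx => f (yx.2, yx.1))).
  apply/integrable12ltyP; last exact: ((integrable21ltyP m1 m2 mf).1 imf).
  apply: (measurableT_comp (f := EFin \o f) (g := fun yx => (yx.2, yx.1))) => //.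
  exact: measurable_fun_pair.
by have [] := integrable_fine (integrable_fubini_F H).
Qed.

Lemma Rfubini1 : \int[m1]_x \int[m2]_y f (x, y) = \int[(m1 \x m2)%E]_z f z.
Proof.
have [_ H] := integrable_fine (integrable_fubini_F imf).
by rewrite [LHS]H integral12_prod_meas1.
Qed.

Lemma Rfubini : \int[m1]_x \int[m2]_y f (x, y) = \int[m2]_y \int[m1]_x f (x, y).
Proof.
have mf := measurable_int _ imf.
have iH : (m2 \x m1)%E.-integrable setT (EFin \o (fun yx => f (yx.2, yx.1))).
  apply/integrable12ltyP; last exact: ((integrable21ltyP m1 m2 mf).1 imf).
  apply: (measurableT_comp (f := EFin \o f) (g := fun yx => (yx.2, yx.1))) => //.
  exact: measurable_fun_pair.
have [_ H] := integrable_fine (integrable_fubini_F imf).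
have [_ H'] := integrable_fine (integrable_fubini_F iH).
by rewrite [LHS]H [RHS]H'; congr fine; exact: Fubini.
Qed.

End Rfubini.

(** * Scalar identities and inequalities in time *)

Section primitives.
Context {R : realType}.
Local Notation leb := (@lebesgue_measure R).
Implicit Types (j c E : measurableTypeR R -> R) (s t : R).

(** Up to a null set, the square ]0,t[ x ]0,t[ consists of two copies of a triangle. *)
Lemma sqr_primitive j t : leb.-integrable `]0, t[ (EFin \o j) ->
  leb.-integrable `]0, t[ (EFin \o (fun s => (\int[leb]_(r in `]0, s[) j r) * j s)) /\
  (\int[leb]_(s in `]0, t[) j s) ^+ 2 =
  2 * \int[leb]_(s in `]0, t[) ((\int[leb]_(r in `]0, s[) j r) * j s).
Proof.
move=> ij; pose g := j \_ `]0, t[.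
have mI : measurable (`]0, t[%classic : set R) by exact: measurable_itv.
have ig : leb.-integrable setT (EFin \o g).
  have := (@integrable_mkcond _ _ R leb `]0, t[%classic (EFin \o j) mI).1 ij; apply: eq_integrable => // x _.
  by rewrite /g /= !patchE; case: ifP.
have mg : measurable_fun setT g by apply/measurable_EFinP; exact: measurable_int ig.
pose T := [set sr : R * R | sr.2 < sr.1].
have mT : measurable (T : set (measurableTypeR R * measurableTypeR R)).
  have mD : measurable_fun setT (fun sr : measurableTypeR R * measurableTypeR R => sr.1 - sr.2).
    by apply: measurable_funB.
  have := mD measurableT `]0, +oo[%classic (measurable_itv _); rewrite setTI.
  by congr (measurable _); apply/seteqP; split=> sr; rewrite /T /= in_itv/= andbT subr_gt0.
pose F (sr : measurableTypeR R * measurableTypeR R) : R := g sr.1 * (g sr.2 * \1_T sr).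
have mF : measurable_fun setT F.
  apply: measurable_funM; first exact: (measurableT_comp mg measurable_fst).
  apply: measurable_funM; first exact: (measurableT_comp mg measurable_snd).
  exact: measurable_indic.
have iF : (leb \x leb)%E.-integrable setT (EFin \o F).
  have itg := integrable_norm (integrable_tensor ig ig).
  apply: (@integrable_le _ _ _ (leb \x leb)%E setT F (fun z => `|g z.1 * g z.2|)) => //.
  move=> sr _; rewrite /F mulrA normrM ler_piMr// indicE.
  by case: (_ \in _); rewrite ?normr1 ?normr0.
have prim s : s \in `]0, t[ -> \int[leb]_(r in `]0, s[) j r = \int[leb]_r (g r * \1_T (s, r)).
  rewrite in_itv/= => /andP[s0 st]; rewrite Rintegral_mkcond; apply: eq_Rintegral => r _.
  rewrite /g !patchE indicE /T; case: ifPn.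
    rewrite inE/= in_itv/= => /andP[r0 rs].
    by rewrite !mem_set ?mulr1//= in_itv/= r0 (lt_trans rs).
  rewrite notin_setE/= in_itv/= => /negP; rewrite negb_and => rs.
  case: ifPn; last by rewrite mul0r.
  rewrite inE/= in_itv/= => /andP[r0 rt]; move: rs; rewrite r0/= -leNgt => sr.
  by rewrite memNset ?mulr0//=; apply/negP; rewrite -leNgt.
have i1 := Rfubini_integrable1 iF; have i2 := Rfubini_integrable2 iF.
have isec s : leb.-integrable setT (EFin \o (fun r => g r * \1_T (s, r))).
  have : leb.-integrable setT (EFin \o (fun r => \1_T (s, r) * g r)).
    apply: (@integrable_bddM _ _ _ leb setT (fun r => \1_T (s, r)) g 1) => //.
      apply: (measurableT_comp (f := (\1_T : measurableTypeR R * measurableTypeR R -> R))) => //.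
    by move=> r _; rewrite indicE; case: (_ \in _); rewrite ?normr1 ?normr0.
  by apply: eq_integrable => // r _; rewrite /= mulrC.
have E1 s : (\int[leb]_r (g r * \1_T (s, r))) * g s = \int[leb]_r F (s, r).
  by rewrite mulrC -RintegralZl.
have resE s : (((fun s => (\int[leb]_(r in `]0, s[) j r) * j s) \_ `]0, t[) : R -> R) s =
    \int[leb]_r F (s, r).
  rewrite patchE; case: ifPn; rewrite -E1 /g patchE.
    by move=> st; rewrite st prim//; rewrite inE in st.
  by move=> /negbTE ->; rewrite mulr0.
split.
  apply: (@integrable_mkcond _ _ R leb `]0, t[%classic _ mI).2.
  apply: eq_integrable i1 => // s _.
  by rewrite /= -resE !patchE; case: ifP.
have P : \int[leb]_(s in `]0, t[) j s = \int[leb]_s g s by rewrite Rintegral_mkcond.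
have -> : \int[leb]_(s in `]0, t[) ((\int[leb]_(r in `]0, s[) j r) * j s) =
    \int[leb]_s \int[leb]_r F (s, r).
  by rewrite Rintegral_mkcond; apply: eq_Rintegral => s _; exact: resE.
rewrite P.
rewrite mulr_natl mulr2n {2}(Rfubini iF) -RintegralD'//.
rewrite expr2 -RintegralZl//; apply: eq_Rintegral => s _.
have ind1 (A : set R) r : `|\1_A r : R| <= 1.
  by rewrite indicE; case: (_ \in _); rewrite ?normr1 ?normr0.
have indE (Q : pred (measurableTypeR R)) r : \1_[set r | Q r] r = (Q r)%:R :> R.
  by rewrite indicE mem_setE.
have mlt : measurable [set r : measurableTypeR R | r < s].
  rewrite (_ : [set r : measurableTypeR R | r < s] = `]-oo, s[%classic); first exact: measurable_itv.
  by apply/seteqP; split=> r /=; rewrite in_itv.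
have mgt : measurable [set r : measurableTypeR R | s < r].
  rewrite (_ : [set r : measurableTypeR R | s < r] = `]s, +oo[%classic); first exact: measurable_itv.
  by apply/seteqP; split=> r /=; rewrite in_itv/= andbT.
have igs : leb.-integrable setT (EFin \o (fun r => g s * g r)) by exact: integrable_scaleR.
have ia (A : set (measurableTypeR R)) : measurable A ->
    leb.-integrable setT (EFin \o (fun r => \1_A r * (g s * g r))).
  move=> mA; apply: (@integrable_bddM _ _ _ leb setT (\1_A) _ 1) => //.
have -> : \int[leb]_r F (s, r) =
    \int[leb]_r (\1_[set r : measurableTypeR R | r < s] r * (g s * g r)).
  apply: eq_Rintegral => r _; rewrite /F /= !indicE /T !mem_setE /=; ring.
have -> : \int[leb]_x F (x, s) =
    \int[leb]_r (\1_[set r : measurableTypeR R | s < r] r * (g s * g r)).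
  apply: eq_Rintegral => r _; rewrite /F /= !indicE /T !mem_setE /=; ring.
rewrite -RintegralD'//; try exact: ia.
rewrite mulrC -RintegralZl//.
congr fine; apply: ae_eq_integral => //.
- exact: measurable_int igs.
- exact: measurable_int (integrable_addR measurableT (ia _ mlt) (ia _ mgt)).
- exists [set s]; split; [exact: measurable_set1|exact: lebesgue_measure_set1|].
  move=> r /= /not_implyP[_]; apply: contra_notP => /eqP rs.
  congr EFin; rewrite (indE (fun r => r < s)) (indE (fun r => s < r)).
  by case: ltgtP rs => //= _ _; rewrite ?(mul0r, mul1r, addr0, add0r).
Qed.

End primitives.

Section time.
Context {R : realType}.
Local Notation leb := (@lebesgue_measure R).
Implicit Types (c j E : measurableTypeR R -> R) (s t : R).

Lemma FTC_oo (F F' : R -> R) (a b : R) : a < b ->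
  (forall x, is_derive x (1 : R) F (F' x)) -> continuous F' ->
  leb.-integrable `]a, b[ (EFin \o F') /\ \int[leb]_(x in `]a, b[) F' x = F b - F a.
Proof.
move=> ab dF cF'.
have iF' : leb.-integrable `[a, b] (EFin \o F').
  apply: continuous_compact_integrable; first exact: segment_compact.
  exact: continuous_subspaceT.
have ioo : leb.-integrable `]a, b[ (EFin \o F').
  by apply: integrableS iF' => //; exact: subset_itv_oo_cc.
split=> //.
have cF : continuous F.
  move=> x; apply: differentiable_continuous; apply/derivable1_diffP.
  by have [] := dF x.
have ibo : leb.-integrable `[a, b[ (EFin \o F').
  by apply: integrableS iF' => //; exact: subset_itv_co_cc.
rewrite Rintegral_itv_obnd_cbnd// Rintegral_itv_bndo_bndc// /Rintegral.
rewrite (@continuous_FTC2 _ _ F)//.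
- exact: continuous_subspaceT.
- split=> [x _||]; first by have [] := dF x.
    exact/cvg_at_right_filter/cF.
  exact/cvg_at_left_filter/cF.
- by move=> x _; rewrite derive1E; have [_] := dF x.
Qed.

(** The supremum m of E(t) exp(-2Kt) satisfies m <= delta + m / 2. *)
Lemma gronwall E (T K delta M : R) : 0 < T -> 0 < K -> 0 <= delta ->
  measurable_fun `]0, T[ E -> (forall t, 0 < t < T -> 0 <= E t <= M) ->
  (forall t, 0 < t < T -> E t <= delta + K * \int[leb]_(s in `]0, t[) E s) ->
  forall t, 0 < t < T -> E t <= 2 * delta * expR (2 * K * T).
Proof.
move=> T0 K0 delta0 mE EM H.
pose w s : R := expR (2 * K * s).
have w0 s : 0 < w s by exact: expR_gt0.
have dw (x : R) : is_derive x (1 : R) (fun s => (2 * K)^-1 * w s) (w x).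
  have K2 : 2 * K != 0 by rewrite mulf_neq0 ?gt_eqF.
  have D : is_derive x (1 : R) (fun s : R => 2 * K * s) (2 * K).
    by have := is_deriveZ (2 * K) (is_derive_id x (1 : R)); rewrite /GRing.scale/= mulr1.
  have D2 := is_derive1_comp (is_derive_expR (2 * K * x)) D.
  have := is_deriveZ (2 * K)^-1 D2.
  rewrite (_ : (2 * K)^-1 *: (_ * _) = w x)//.
  by rewrite /GRing.scale/= mulrCA mulVf ?mulr1.
have cw : continuous w.
  move=> x; apply: continuous_comp; last exact: continuous_expR.
  by apply: cvgM; [exact: cvg_cst|exact: cvg_id].
pose S := [set E t / w t | t in `]0, T[].
have Sb : has_ubound S.
  exists `|M| => _ [t + <-]; rewrite /= in_itv/= => tT.
  have /andP[E0 EM'] := EM t tT.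
  rewrite ler_pdivrMr//; apply: le_trans EM' _; apply: le_trans (ler_norm M) _.
  rewrite ler_peMr// /w -expR0 ler_expR; have /andP[/ltW t0 _] := tT.
  by rewrite mulr_ge0// mulr_ge0 ?ltW.
have T2 : 0 < T / 2 < T by rewrite divr_gt0//= ltr_pdivrMr// ltr_pMr// ltr1n.
have S0 : S !=set0 by exists (E (T / 2) / w (T / 2)), (T / 2) => //=; rewrite in_itv.
set m := sup S.
have mP t : 0 < t < T -> E t <= m * w t.
  by move=> tT; rewrite -ler_pdivrMr//; apply: (ub_le_sup Sb); exists t => //=; rewrite in_itv.
have m0 : 0 <= m.
  have := mP _ T2; have /andP[+ _] := EM _ T2 => /le_trans/[apply].
  by rewrite pmulr_lge0.
have K2 : 0 < (2 * K)^-1 by rewrite invr_gt0 mulr_gt0.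
have mub : ubound S (delta + m / 2).
  move=> _ [t + <-]; rewrite /= in_itv/= => tT; have /andP[t0 tT'] := tT.
  have [iw Iw] := FTC_oo t0 dw cw.
  have mt : measurable_fun `]0, t[ E.
    apply: measurable_funS mE => //; apply: subset_itvl.
    by rewrite bnd_simp ltW.
  have bt s : `]0, t[%classic s -> 0 <= E s <= M.
    by rewrite /= in_itv/= => /andP[s0 st]; apply: EM; rewrite s0 (lt_trans st).
  have it : leb.-integrable `]0, t[ (EFin \o E).
    apply: (@integrable_le _ _ R leb `]0, t[%classic E (fun s => m * w s)) => //.
      move=> s st; have /andP[e0 _] := bt _ st; rewrite ger0_norm//; apply: mP.
      by move: st; rewrite /= in_itv/= => /andP[-> st]; rewrite (lt_trans st).
    exact: (@integrable_scaleR _ _ R leb).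
  have I1 : \int[leb]_(s in `]0, t[) E s <= m * ((2 * K)^-1 * w t).
    apply: (@le_trans _ _ (\int[leb]_(s in `]0, t[) (m * w s))).
      apply: le_Rintegral => //; first exact: (@integrable_scaleR _ _ R leb).
      move=> s; rewrite /= in_itv/= => /andP[s0 st]; apply: mP.
      by rewrite s0 (lt_trans st).
    rewrite RintegralZl// Iw ler_wpM2l// gerBl.
    by rewrite mulr_ge0 ?ltW.
  rewrite ler_pdivrMr//; apply: le_trans (H _ tT) _.
  have w1 : 1 <= w t.
    by rewrite /w -expR0 ler_expR mulr_ge0 ?mulr_ge0 ?ltW.
  rewrite mulrDl lerD//; first by rewrite ler_peMr.
  apply: (@le_trans _ _ (K * (m * ((2 * K)^-1 * w t)))); first by rewrite ler_wpM2l// ltW.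
  by rewrite le_eqVlt; apply/orP; left; apply/eqP; field; rewrite gt_eqF.
have m2 : m <= delta + m / 2 := ge_sup S0 mub.
move=> t tT; have /andP[t0 tT'] := tT.
apply: le_trans (mP _ tT) _; apply: ler_pM => //; first exact: ltW.
  by move: m2; lra.
by rewrite ler_expR ler_wpM2l ?mulr_ge0 ?ltW.
Qed.

Lemma within_continuous_eq0 c (T : R) : 0 < T ->
  {within `[0, T], continuous c} -> (forall t, 0 < t < T -> c t = 0) ->
  forall t, 0 <= t <= T -> c t = 0.
Proof.
move=> T0 cc c0 t /andP[t0 tT].
have [_ cl cr] := (continuous_within_itvP c T0).1 cc.
have [t0'|t0'] := eqVneq t 0.
  rewrite t0'; apply: (cvg_unique _ cl); first exact: norm_hausdorff.
  apply: (@cvg_near_cst _ R 0 c); near=> s; apply: c0; apply/andP; split.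
    by near: s; exact: nbhs_right_gt.
  by near: s; exact: nbhs_right_lt.
have [tT'|tT'] := eqVneq t T.
  rewrite tT'; apply: (cvg_unique _ cr); first exact: norm_hausdorff.
  apply: (@cvg_near_cst _ R 0 c); near=> s; apply: c0; apply/andP; split.
    by near: s; exact: nbhs_left_gt.
  by near: s; exact: nbhs_left_lt.
by apply: c0; rewrite lt_neqAle eq_sym t0' t0 lt_neqAle tT' tT.
Unshelve. all: by end_near. Qed.

(** Smooth approximations of the indicator of ]-oo, t0[, vanishing after t0. *)
Definition ramp (t0 : R) (k : nat) (t : R) : R := cutoff (k.+1%:R * (t0 - t)).

Lemma smooth_ramp t0 k : smooth (ramp t0 k).
Proof.
have cL : continuous (( - k.+1%:R : R) \*: (idfun : {linear R^o -> R^o})).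
  by move=> x; apply: cvgM; [exact: cvg_cst|exact: cvg_id].
have := @smooth_cutoff_comp R R^o _ (k.+1%:R * t0) cL.
rewrite (_ : (fun y => _) = ramp t0 k)//; apply/funext => y; rewrite /ramp/=.
by congr cutoff; rewrite /GRing.scale/= mulrBr mulNr addrC.
Qed.

(** The derivatives of the smooth steps [ramp t0 k] form an approximation of
    minus the Dirac mass at t0, concentrated on the left of t0. *)
Lemma primitive_of_weak (T : R) c j : {within `[0, T], continuous c} ->
  leb.-integrable `]0, T[ (EFin \o j) -> forall t0, 0 < t0 < T ->
  (forall k, \int[leb]_(t in `]0, T[)
     (c t * 'D_(1 : R) (ramp t0 k) t + ramp t0 k t * j t) = 0) ->
  c t0 = \int[leb]_(t in `]0, t0[) j t.
Proof.
move=> cc ij t0 /andP[t00 t0T] H.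
have T0 : 0 < T by exact: lt_trans t0T.
have mI : measurable (`]0, T[%classic : set (measurableTypeR R)) by exact: measurable_itv.
pose p1 : {poly R} := 'X^2 * (1 - 1^`()).
pose psi (k : nat) (t : R) : R := k.+1%:R * flat p1 (k.+1%:R * (t0 - t)).
have dr k (t : R) : is_derive t (1 : R) (fun t => - ramp t0 k t) (psi k t).
  have D : is_derive t (1 : R) (fun t : R => k.+1%:R * (t0 - t)) (- k.+1%:R).
    have D1 := is_deriveB (is_derive_cst t0 t (1 : R)) (is_derive_id t (1 : R)).
    have := is_deriveZ k.+1%:R D1.
    by rewrite /GRing.scale/= sub0r mulrN1.
  have D2 := @is_derive1_comp R (flat 1) (fun t => k.+1%:R * (t0 - t)) t _ _
    (is_derive_flat 1 (k.+1%:R * (t0 - t))) D.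
  have := is_deriveN D2.
  by rewrite (_ : - (_ * _) = psi k t)// mulrN opprK mulrC.
have cpsi k : continuous (psi k).
  move=> t; apply: cvgM; first exact: cvg_cst.
  apply: (@continuous_comp _ _ _ (fun t => k.+1%:R * (t0 - t)) (flat p1)).
    apply: cvgM; first exact: cvg_cst.
    by apply: cvgB; [exact: cvg_cst|exact: cvg_id].
  exact: (smooth_continuous (smooth_flat _)).
have rampE k t : 'D_(1 : R) (ramp t0 k) t = - psi k t.
  have [_ <-] := dr k t; rewrite -[X in - X]/('D_(1 : R) (- ramp t0 k) t).
  by rewrite deriveN ?opprK//; by apply: smooth_derivable; exact: smooth_ramp.
have psi_ge0 k t : 0 <= psi k t.
  rewrite mulr_ge0// /flat; case: ifP => // _.
  by rewrite mulr_ge0 ?expR_ge0// /p1 derivC subr0 mulr1 hornerXn sqr_ge0.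
have psi_eq0 k t : t0 <= t -> psi k t = 0.
  by move=> tt; rewrite /psi /flat ifF ?mulr0// ltNge mulr_ge0_le0 ?subr_le0.
have ipsi k s : 0 < s -> leb.-integrable `]0, s[ (EFin \o psi k).
  by move=> s0; have [] := FTC_oo s0 (dr k) (cpsi k).
have Ipsi k s : 0 < s -> \int[leb]_(t in `]0, s[) psi k t = ramp t0 k 0 - ramp t0 k s.
  by move=> s0; have [_ ->] := FTC_oo s0 (dr k) (cpsi k); rewrite opprK addrC.
(* Linearity of the integral would otherwise be applied to the factor k.+1 of psi. *)
clearbody psi.
have subI : `]0, T[%classic `<=` `[0, T]%classic by exact: subset_itv_oo_cc.
have mc : measurable_fun (`]0, T[%classic : set (measurableTypeR R)) c.
  apply: (@measurable_funS _ _ _ _ (`[0, T]%classic : set (measurableTypeR R))) => //.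
  exact: subspace_continuous_measurable_fun.
have [M M0 cM] : exists2 M, 0 <= M & forall t, `[0, T]%classic t -> `|c t| <= M.
  have : compact (c @` `[0, T]%classic).
    by apply: continuous_compact => //; exact: segment_compact.
  move=> /compact_bounded[M [_ HM]]; exists (`|M| + 1); first by rewrite addr_ge0.
  move=> t tT; apply: HM; last by exists t.
  by rewrite (le_lt_trans (ler_norm M))// ltrDl.
have icp k : leb.-integrable `]0, T[ (EFin \o (fun t => c t * psi k t)).
  apply: (@integrable_bddM _ _ _ leb `]0, T[%classic c (psi k) M) => //.
    by move=> t /subI; exact: cM.
  exact: ipsi.
have irj k : leb.-integrable `]0, T[ (EFin \o (fun t => ramp t0 k t * j t)).
  apply: (@integrable_bddM _ _ _ leb `]0, T[%classic (ramp t0 k) j 1) => //.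
    apply: measurable_funTS; apply: continuous_measurable_fun.
    exact: (smooth_continuous (smooth_ramp t0 k)).
  by move=> t _; rewrite ger0_norm ?cutoff_ge0 ?cutoff_le1.
have HE k : \int[leb]_(t in `]0, T[) (c t * psi k t) =
            \int[leb]_(t in `]0, T[) (ramp t0 k t * j t).
  apply/esym/eqP; rewrite -subr_eq0 -RintegralB//; apply/eqP; apply: etrans (H k).
  by apply: eq_Rintegral => t _; rewrite rampE mulrN addrC.
have r0 s : s < t0 -> ramp t0 k s @[k --> \oo] --> (1 : R).
  by move=> st; have := @cutoff_cvg R (t0 - s); rewrite subr_gt0 st.
have L1 : \int[leb]_(t in `]0, T[) (ramp t0 k t * j t) @[k --> \oo] -->
          \int[leb]_(t in `]0, t0[) j t.
  have -> : \int[leb]_(t in `]0, t0[) j t =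
      \int[leb]_(t in `]0, T[) ((0 < t0 - t)%R%:R * j t).
    rewrite Rintegral_mkcond [RHS]Rintegral_mkcond; apply: eq_Rintegral => t _.
    rewrite !patchE !mem_setE !in_itv/= subr_gt0.
    case: (ltP 0 t) => //= t_gt0; case: (ltP t t0) => [tt|_].
      by rewrite (lt_trans tt)// mul1r.
    by rewrite mul0r if_same.
  apply: (@Rintegral_cvg _ _ _ leb `]0, T[%classic _ _ (fun t => `|j t|)) => //.
  - by move=> k; apply/measurable_EFinP; exact: measurable_int (irj k).
  - apply: measurable_funM; last by apply/measurable_EFinP; exact: measurable_int ij.
    rewrite (_ : (fun t => _) = (\1_(`]-oo, t0[%classic) : R -> R)).
      exact: measurable_indic.
    by apply/funext => t; rewrite indicE mem_setE in_itv/= subr_gt0.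
  - by move=> t _; apply: cvgMl; exact: cutoff_cvg.
  - exact: integrable_norm.
  - move=> k t _; rewrite normrM ler_piMl//.
    by rewrite ger0_norm ?cutoff_ge0 ?cutoff_le1.
have L2 : \int[leb]_(t in `]0, T[) (c t * psi k t) @[k --> \oo] --> c t0.
  have rT k : ramp t0 k T = 0.
    by rewrite /ramp cutoff_eq0// mulr_ge0_le0// subr_le0 ltW.
  have ict k : leb.-integrable `]0, T[ (EFin \o (fun t => (c t - c t0) * psi k t)).
    have := @integrable_subR _ _ R leb `]0, T[%classic _ _ mI (icp k)
      (@integrable_scaleR _ _ R leb _ (c t0) _ mI (ipsi k _ T0)).
    by apply: eq_integrable => // t _ /=; rewrite mulrBl.
  have E k : \int[leb]_(t in `]0, T[) (c t * psi k t) =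
      \int[leb]_(t in `]0, T[) ((c t - c t0) * psi k t) + c t0 * ramp t0 k 0.
    have -> : ramp t0 k 0 = \int[leb]_(t in `]0, T[) psi k t by rewrite Ipsi// rT subr0.
    rewrite -RintegralZl//; last exact: ipsi.
    rewrite -RintegralD'//; last by apply: (@integrable_scaleR _ _ R leb) => //; exact: ipsi.
    by apply: eq_Rintegral => t _; rewrite -mulrDl subrK.
  under eq_fun do rewrite E.
  rewrite -[X in nbhs X]add0r; apply: cvgD; last first.
    have := cvgMr (a := c t0) (r0 _ t00); rewrite mulr1. exact.
  apply/cvgrPdist_le => /= e e0; have e2 : 0 < e / 2 by rewrite divr_gt0.
  have ct0 : c t @[t --> t0] --> c t0.
    have [cin _ _] := (continuous_within_itvP c T0).1 cc.
    by apply: cin; rewrite in_itv/= t00.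
  have /cvgrPdist_le/(_ _ e2)/nbhs_ballP[d /= d0 Hd] := ct0.
  (* On ]s, t0[ the values of c are e/2-close to c t0; the mass of psi_k on ]0, s[
     tends to 0. *)
  pose s := Num.max (t0 / 2) (t0 - d / 2).
  have s0 : 0 < s by rewrite lt_max divr_gt0.
  have st : s < t0 by rewrite gt_max; lra.
  have bd : ramp t0 k 0 - ramp t0 k s @[k --> \oo] --> (0 : R).
    have := cvgB (r0 _ t00) (r0 _ st); rewrite subrr. exact.
  have M2 : 0 < e / (4 * M + 4) by rewrite divr_gt0// ltr_wpDl// mulr_ge0.
  have /cvgrPdist_le/(_ _ M2) := bd; apply: filterS => k; rewrite sub0r normrN => Hk.
  rewrite sub0r normrN; apply: le_trans (le_normr_Rintegral mI (ict k)) _.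
  have i1 : leb.-integrable `]0, T[ (EFin \o (fun t : R => (t < s)%R%:R * psi k t)).
    apply: (@integrable_bddM _ _ _ leb `]0, T[%classic (fun t : R => (t < s)%R%:R) (psi k) 1) => //.
    - rewrite (_ : (fun t => _) = (\1_(`]-oo, s[%classic) : R -> R)).
        exact: measurable_indic.
      by apply/funext => t; rewrite indicE mem_setE in_itv.
    - by move=> t _; case: (t < s); rewrite ?normr1 ?normr0.
    - exact: ipsi.
  apply: (@le_trans _ _ (\int[leb]_(t in `]0, T[)
      (2 * M * ((t < s)%R%:R * psi k t) + e / 2 * psi k t))).
    apply: le_Rintegral => //; first exact: (integrable_norm (ict k)).
      apply: (@integrable_addR _ _ R leb) => //; apply: (@integrable_scaleR _ _ R leb) => //.
      exact: ipsi.
    move=> t tT; rewrite normrM (ger0_norm (psi_ge0 k t)).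
    rewrite (mulrA (2 * M)) -mulrDl; have [tt|tt] := leP t0 t; first by rewrite psi_eq0// !mulr0.
    rewrite ler_wpM2r//; case: (ltP t s) => ts /=.
      rewrite mulr1; apply: le_trans (ler_normB _ _) _.
      have := cM _ (subI _ tT); have : `|c t0| <= M.
        by apply: cM; rewrite /= in_itv/= !ltW.
      by move: e2; lra.
    rewrite mulr0 add0r distrC; apply: Hd; rewrite -ball_normE /= ltr_distl.
    move: ts; rewrite /s ge_max; lra.
  rewrite RintegralD'//; [|exact: (@integrable_scaleR _ _ R leb)|
    by apply: (@integrable_scaleR _ _ R leb) => //; exact: ipsi].
  rewrite !RintegralZl//; last exact: ipsi.
  have -> : \int[leb]_(t in `]0, T[) ((t < s)%R%:R * psi k t) = ramp t0 k 0 - ramp t0 k s.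
    rewrite -(Ipsi _ _ s0) Rintegral_mkcond [RHS]Rintegral_mkcond.
    apply: eq_Rintegral => t _; rewrite !patchE !mem_setE !in_itv/=.
    case: (ltP 0 t) => //= _; case: (ltP t s) => [ts|_].
      by rewrite (lt_trans ts) ?mul1r// (lt_trans st).
    by rewrite mul0r if_same.
  rewrite (Ipsi _ _ T0) rT subr0.
  have r1 : ramp t0 k 0 <= 1 by exact: cutoff_le1.
  have h1 : 2 * M * (ramp t0 k 0 - ramp t0 k s) <= e / 2.
    apply: (@le_trans _ _ (2 * M * (e / (4 * M + 4)))).
      by rewrite ler_wpM2l ?mulr_ge0// (le_trans (ler_norm _)).
    rewrite mulrA ler_pdivrMr ?ltr_wpDl ?mulr_ge0//; nra.
  have h2 : e / 2 * ramp t0 k 0 <= e / 2 by rewrite ler_piMr// ltW.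
  by move: h1 h2; lra.
apply: (cvg_unique _ L2); first exact: norm_hausdorff.
by rewrite /=; under eq_fun do rewrite HE.
Qed.

End time.

(** * The Galerkin spaces and the flux *)

Section flux.
Context {R : realType} {n : nat}.
Variable Omega : set 'rV[R]_n.
Hypothesis oOmega : open Omega.
Hypothesis bOmega : bounded_set Omega.
Local Notation vol := (lebesgue_rV R n).
Local Notation L2 := (L2 vol Omega).
Implicit Types (phi psi v : 'rV[R]_n -> R).
Implicit Types (U : 'I_n.+1 -> 'rV[R]_n -> R) (F : 'I_n -> 'rV[R]_n -> R).
Implicit Types (j : 'I_n.+1) (i : 'I_n).

Let mO : measurable Omega. Proof. exact: mOmega. Qed.
Let Ofin : (vol Omega < +oo)%E. Proof. exact: vol_Omega_lty. Qed.

(** The H^1 scalar product, and the H^1 pairing of a jet with a function. *)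
Definition Hdot phi psi := \sum_j \int[vol]_(x in Omega) (jet phi j x * jet psi j x).
Definition Hpair U phi := \sum_j \int[vol]_(x in Omega) (U j x * jet phi j x).
Definition Hsqr U := \sum_j \int[vol]_(x in Omega) (U j x ^+ 2).
Definition pair0 U phi := \int[vol]_(x in Omega) (U ord0 x * phi x).

(** The pairing of the flux u F - a grad u with grad phi. *)
Definition flux_pair U F (a : R) phi := \sum_i \int[vol]_(x in Omega)
  ((U ord0 x * F i x - a * U (lift ord0 i) x) * jet phi (lift ord0 i) x).

Lemma jet0 phi : jet phi ord0 = phi. Proof. exact: jetof0. Qed.

Lemma integrable_jetM u phi j : L2 u -> smooth phi ->
  vol.-integrable Omega (EFin \o (fun x => u x * jet phi j x)).
Proof. by move=> Lu sphi; apply: L2_mul => //; exact: jet_L2. Qed.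

Lemma HpairD U phi psi : (forall j, L2 (U j)) -> smooth phi -> smooth psi ->
  Hpair U (fun x => phi x + psi x) = Hpair U phi + Hpair U psi.
Proof.
move=> LU s1 s2; rewrite /Hpair -big_split/=; apply: eq_bigr => j _.
rewrite -RintegralD'//; try exact: integrable_jetM.
by apply: eq_Rintegral => x _; rewrite jetD// mulrDr.
Qed.

Lemma HpairZ k U phi : (forall j, L2 (U j)) -> smooth phi ->
  Hpair U (fun x => k * phi x) = k * Hpair U phi.
Proof.
move=> LU s1; rewrite /Hpair mulr_sumr; apply: eq_bigr => j _.
rewrite -RintegralZl//; last exact: integrable_jetM.
by apply: eq_Rintegral => x _; rewrite jetZ// mulrCA.
Qed.

Lemma Hdist U phi : (forall j, L2 (U j)) -> smooth phi ->
  \sum_j \int[vol]_(x in Omega) ((U j x - jet phi j x) ^+ 2) =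
  Hsqr U - 2 * Hpair U phi + Hdot phi phi.
Proof.
move=> LU sphi; rewrite /Hsqr /Hpair /Hdot mulr_sumr -sumrB -big_split/=.
apply: eq_bigr => j _.
have i1 := integrable_jetM j (LU j) sphi.
have i2 := integrable_jetM j (jet_L2 oOmega bOmega j sphi) sphi.
rewrite -RintegralZl// -RintegralB//; [|exact: (LU j).2|exact: integrable_scaleR].
rewrite -RintegralD'//; last first.
  by apply: integrable_subR => //; [exact: (LU j).2|exact: integrable_scaleR].
by apply: eq_Rintegral => x _; ring.
Qed.

Lemma Hdot_ge0 phi : 0 <= Hdot phi phi.
Proof.
apply: sumr_ge0 => j _; apply: Rintegral_ge0 => x _; exact: sqr_ge0.
Qed.

Lemma HdotC phi psi : Hdot phi psi = Hdot psi phi.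
Proof.
by apply: eq_bigr => j _; apply: eq_Rintegral => x _; rewrite mulrC.
Qed.

Lemma Hdot_null phi : smooth phi -> Hdot phi phi = 0 ->
  {ae vol, forall x, Omega x -> phi x = 0}.
Proof.
move=> sphi H0.
have i2 j := integrable_jetM j (jet_L2 oOmega bOmega j sphi) sphi.
have n0 j : 0 <= \int[vol]_(x in Omega) (jet phi j x * jet phi j x).
  by apply: Rintegral_ge0 => x _; exact: sqr_ge0.
have := i2 ord0; rewrite jet0 => i0.
have I0 : \int[vol]_(x in Omega) (phi x * phi x) = 0.
  apply/eqP; rewrite eq_le.
  have h : 0 <= \int[vol]_(x in Omega) (phi x * phi x).
    by apply: Rintegral_ge0 => x _; exact: sqr_ge0.
  rewrite h andbT -H0 /Hdot big_ord_recl jet0 lerDl.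
  by apply: sumr_ge0 => j _; exact: n0.
have := Rintegral_restrict_ge0_eq0 mO i0 (fun x _ => sqr_ge0 (phi x)) I0.
by apply: filterS => x h /h /eqP; rewrite mulf_eq0 orbb => /eqP.
Qed.

Section flux_pair.
Variables (U : 'I_n.+1 -> 'rV[R]_n -> R) (F : 'I_n -> 'rV[R]_n -> R) (a M : R).
Hypothesis LU : forall j, L2 (U j).
Hypothesis mF : forall i, measurable_fun Omega (F i).
Hypothesis bF : forall i x, Omega x -> `|F i x| <= M.

Lemma L2_drift i : L2 (fun x => U ord0 x * F i x).
Proof. by under eq_fun do rewrite mulrC; apply: (L2_bddM (C := M)) => //; exact: bF. Qed.

Lemma L2_flux i : L2 (fun x => U ord0 x * F i x - a * U (lift ord0 i) x).
Proof. by apply: L2_sub => //; [exact: L2_drift|exact: L2_scale]. Qed.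

Lemma flux_pairD phi psi : smooth phi -> smooth psi ->
  flux_pair U F a (fun x => phi x + psi x) = flux_pair U F a phi + flux_pair U F a psi.
Proof.
move=> s1 s2; rewrite /flux_pair -big_split/=; apply: eq_bigr => i _.
rewrite -RintegralD'//; try (by apply: integrable_jetM => //; exact: L2_flux).
by apply: eq_Rintegral => x _; rewrite jetD// mulrDr.
Qed.

Lemma flux_pairZ k phi : smooth phi ->
  flux_pair U F a (fun x => k * phi x) = k * flux_pair U F a phi.
Proof.
move=> s1; rewrite /flux_pair mulr_sumr; apply: eq_bigr => i _.
rewrite -RintegralZl//; last by apply: integrable_jetM => //; exact: L2_flux.
by apply: eq_Rintegral => x _; rewrite jetZ// mulrCA.
Qed.

Lemma flux_pairE phi : smooth phi -> flux_pair U F a phi =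
  \sum_i \int[vol]_(x in Omega) (U ord0 x * F i x * jet phi (lift ord0 i) x) -
  a * (Hpair U phi - pair0 U phi).
Proof.
move=> s1; rewrite /Hpair big_ord_recl jet0 -/(pair0 U phi).
rewrite addrAC subrr add0r mulr_sumr -sumrB; apply: eq_bigr => i _.
rewrite -RintegralZl//; last by have := integrable_jetM (lift ord0 i) (LU (lift ord0 i)) s1.
rewrite -RintegralB//; [|by apply: integrable_jetM => //; exact: L2_drift|
  by apply: integrable_scaleR => //; exact: integrable_jetM].
by apply: eq_Rintegral => x _; ring.
Qed.

Variables (a0 a1 : R).
Hypotheses (a00 : 0 < a0) (aa : a0 <= a <= a1).

(** Young's inequality lets the diffusion absorb the drift.  The function v is
    meant to be the Riesz representative, in a Galerkin space, of the L^2 pairing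
    with u = U_0, and P the H^1 projection of U: then the diffusion term is the L^2
    pairing of u with P, at least half the square norm of u up to the distance
    from U to P. *)
Lemma flux_pair_le v P : smooth v -> smooth P ->
  pair0 U v = Hdot v v -> Hpair U v = pair0 U P ->
  flux_pair U F a v <= (M ^+ 2 * n.+1%:R / (2 * a0) + a1) * Hdot v v +
    a1 / 2 * \sum_j \int[vol]_(x in Omega) ((U j x - jet P j x) ^+ 2).
Proof.
move=> sv sP cv LP; rewrite flux_pairE// LP cv.
set A := \int[vol]_(x in Omega) (U ord0 x ^+ 2).
(* lam is so small that the n Young inequalities cost at most half of the
   ellipticity constant a0. *)
set rho := (X in _ <= _ + a1 / 2 * X); pose lam := a0 / (2 * n.+1%:R).
have n0 : 0 < n.+1%:R :> R by rewrite ltr0n.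
have lam0 : 0 < lam by rewrite divr_gt0// mulr_gt0.
have [aa0 aa1] := andP aa.
have iUU := (LU ord0).2.
have iP : vol.-integrable Omega (EFin \o (fun x => U ord0 x * P x)).
  by have := integrable_jetM ord0 (LU ord0) sP; rewrite jet0.
have LUP : L2 (fun x => U ord0 x - P x) by apply: L2_sub => //; exact: smooth_L2.
have hP : A / 2 - rho / 2 <= pair0 U P.
  have h0 : \int[vol]_(x in Omega) ((U ord0 x - P x) ^+ 2) <= rho.
    rewrite /rho big_ord_recl jet0 lerDl; apply: sumr_ge0 => i _.
    exact: Rintegral_sqr_ge0.
  apply: (@le_trans _ _ (A / 2 - \int[vol]_(x in Omega) ((U ord0 x - P x) ^+ 2) / 2)).
    by rewrite lerD2l lerN2 ler_wpM2r.
  rewrite ![_ / 2]mulrC -!RintegralZl//; last exact: LUP.2.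
  rewrite -RintegralB//; [|exact: integrable_scaleR|apply: integrable_scaleR => //; exact: LUP.2].
  apply: le_Rintegral => //.
    apply: integrable_subR => //; first exact: integrable_scaleR.
    by apply: integrable_scaleR => //; exact: LUP.2.
  by move=> x _; have := sqr_ge0 (P x); nra.
have hD : \sum_i \int[vol]_(x in Omega) (U ord0 x * F i x * jet v (lift ord0 i) x) <=
    n%:R * (lam * A) + M ^+ 2 / (4 * lam) * Hdot v v.
  have -> : n%:R * (lam * A) = \sum_(i < n) (lam * A).
    by rewrite sumr_const card_ord mulr_natl.
  apply: (@le_trans _ _ (\sum_(i < n) (lam * A + M ^+ 2 / (4 * lam) *
      \int[vol]_(x in Omega) (jet v (lift ord0 i) x * jet v (lift ord0 i) x)))).
    apply: ler_sum => i _.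
    have iv := integrable_jetM (lift ord0 i) (jet_L2 oOmega bOmega (lift ord0 i) sv) sv.
    rewrite -!RintegralZl// -RintegralD'//; try exact: integrable_scaleR.
    apply: le_Rintegral => //.
    - by apply: integrable_jetM => //; exact: L2_drift.
    - by apply: integrable_addR => //; exact: integrable_scaleR.
    move=> x Ox; set u := U _ _; set f := F _ _; set d := jet _ _ _.
    have fM : f ^+ 2 <= M ^+ 2.
      by rewrite -[f ^+ 2]real_normK ?num_real// lerXn2r ?nnegrE ?bF// (le_trans _ (bF i Ox)).
    have -> : lam * u ^+ 2 + M ^+ 2 / (4 * lam) * (d * d) =
      u * f * d + ((2 * lam * u - f * d) ^+ 2 + (M ^+ 2 - f ^+ 2) * d ^+ 2) / (4 * lam).
      by field; rewrite gt_eqF.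
    rewrite lerDl; apply: divr_ge0; last by rewrite mulr_ge0// ltW.
    by rewrite addr_ge0 ?sqr_ge0// mulr_ge0 ?sqr_ge0// subr_ge0.
  rewrite big_split/= lerD2l -mulr_sumr ler_wpM2l//.
    by rewrite divr_ge0 ?sqr_ge0// mulr_ge0// ltW.
  rewrite /Hdot big_ord_recl lerDr; apply: Rintegral_ge0 => x _; exact: sqr_ge0.
have A0 : 0 <= A by exact: Rintegral_sqr_ge0.
have rho0 : 0 <= rho by apply: sumr_ge0 => j _; exact: Rintegral_sqr_ge0.
have lamE : n%:R * (lam * A) <= a0 / 2 * A.
  rewrite mulrA ler_wpM2r// /lam -[leLHS](_ : a0 / 2 * (n%:R / n.+1%:R) = _); last first.
    by field; rewrite gt_eqF.
  rewrite ler_piMr ?divr_ge0 ?(ltW a00)// ler_pdivrMr// mul1r ler_nat//.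
have cE : M ^+ 2 / (4 * lam) = M ^+ 2 * n.+1%:R / (2 * a0).
  by rewrite /lam; field; rewrite !gt_eqF.
have v0 := Hdot_ge0 v.
rewrite cE in hD; set Q := _ / _ in hD *.
set p := pair0 U P in hP *; set D := \sum_i _ in hD *.
have h1 : a * (A / 2 - rho / 2) <= a * p by rewrite ler_wpM2l// (le_trans (ltW a00)).
have h2 : a0 * A <= a * A by rewrite ler_wpM2r.
have h3 : a * rho <= a1 * rho by rewrite ler_wpM2r.
have h4 : a * Hdot v v <= a1 * Hdot v v by rewrite ler_wpM2r.
by move: h1 h2 h3 h4 hD lamE; lra.
Qed.

End flux_pair.

Section galerkin.
Variable N : nat.
Implicit Types b : 'rV[R]_N.

(** [insub] extends the coordinates to all natural numbers, the indices of [comb]. *)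
Definition galerkin b : 'rV[R]_n -> R :=
  comb N (fun l => if insub l is Some i then b 0 i else 0).

Lemma galerkinE b x : galerkin b x = \sum_(l < N) b 0 l * fam l x.
Proof. by apply: eq_bigr => l _; rewrite valK. Qed.

Lemma comb_galerkin (c : nat -> R) : comb N c = galerkin (\row_l c l).
Proof. by apply/funext => x; rewrite galerkinE; apply: eq_bigr => l _; rewrite mxE. Qed.

Lemma galerkinD b1 b2 : galerkin (b1 + b2) = fun x => galerkin b1 x + galerkin b2 x.
Proof.
apply/funext => x; rewrite !galerkinE -big_split/=.
by apply: eq_bigr => l _; rewrite mxE mulrDl.
Qed.

Lemma galerkinZ k b : galerkin (k *: b) = fun x => k * galerkin b x.
Proof.
apply/funext => x; rewrite !galerkinE mulr_sumr.
by apply: eq_bigr => l _; rewrite mxE mulrA.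
Qed.

Lemma smooth_galerkin b : smooth (galerkin b).
Proof. exact: smooth_comb. Qed.

Definition gdot b1 b2 := Hdot (galerkin b1) (galerkin b2).

Let jL j b : L2 (jet (galerkin b) j).
Proof. by apply: jet_L2 => //; exact: smooth_galerkin. Qed.

Lemma gdotD b1 b2 b3 : gdot (b1 + b2) b3 = gdot b1 b3 + gdot b2 b3.
Proof.
rewrite /gdot !(HdotC _ (galerkin b3)) galerkinD.
exact: (HpairD (fun j => jL j b3) (smooth_galerkin b1) (smooth_galerkin b2)).
Qed.

Lemma gdotZ k b1 b2 : gdot (k *: b1) b2 = k * gdot b1 b2.
Proof.
rewrite /gdot !(HdotC _ (galerkin b2)) galerkinZ.
exact: (HpairZ _ (fun j => jL j b2) (smooth_galerkin b1)).
Qed.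

Lemma gdotC b1 b2 : gdot b1 b2 = gdot b2 b1.
Proof. exact: HdotC. Qed.

Lemma gdot_ge0 b : 0 <= gdot b b.
Proof. exact: Hdot_ge0. Qed.

(** An H^1-orthonormal family of the Galerkin space, spanning it up to functions
    that vanish on Omega. *)
Lemma galerkin_basis : exists m (e : nat -> 'rV[R]_N), orthonormal gdot m e /\
  forall b, gdot (b - proj gdot m e b) (b - proj gdot m e b) = 0.
Proof.
pose phi (l : nat) : 'rV[R]_N := if insub l is Some i then delta_mx 0 i else 0.
have [m [e [oe He]]] := gram_schmidt gdotD gdotZ gdotC gdot_ge0 phi N.
exists m, e; split=> // b.
suff : projects gdot m e b by [].
rewrite (row_sum_delta b).
apply: (big_ind (projects gdot m e)) => [||l _].
- exact: (projects0 gdotZ).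
- exact: (projectsD gdotD gdotZ gdotC gdot_ge0).
- apply: (projectsZ gdotZ gdotC); have := He l (ltn_ord l).
  by rewrite /phi valK.
Qed.

End galerkin.

End flux.

(** * The energy estimate *)

Lemma lebesgue_ae_filter {R : realType} : Filter (almost_everywhere (@lebesgue_measure R)).
Proof. exact: (ae_filter_ringOfSetsType (@lebesgue_measure R)). Qed.

(* The filter of co-null sets of the line, for the carrier R of the line instead of
   its measurable alias. *)
#[global] Hint Extern 0 (Filter (nbhs (almost_everywhere _))) =>
  (apply lebesgue_ae_filter) : typeclass_instances.
#[global] Hint Extern 0 (Filter (almost_everywhere _)) =>
  (apply lebesgue_ae_filter) : typeclass_instances.

Section ae_integrals.
Context d (X : measurableType d) {R : realType}.
Variables (mu : {measure set X -> \bar R}) (D : set X).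
Hypothesis mD : measurable D.
Implicit Types u v : X -> R.

Lemma Rintegral_ae_eq u v : measurable_fun D u -> measurable_fun D v ->
  {ae mu, forall x, D x -> u x = v x} ->
  \int[mu]_(x in D) u x = \int[mu]_(x in D) v x.
Proof.
move=> mu_ mv uv; congr fine; apply: ae_eq_integral => //; try exact/measurable_EFinP.
by apply: filterS uv => x h Dx; rewrite h.
Qed.

Lemma Rintegral_ae_le u v : mu.-integrable D (EFin \o u) ->
  mu.-integrable D (EFin \o v) -> {ae mu, forall x, D x -> u x <= v x} ->
  \int[mu]_(x in D) u x <= \int[mu]_(x in D) v x.
Proof.
move=> iu iv uv; rewrite -subr_ge0 -RintegralB//.
have i := integrable_subR mD iv iu.
rewrite (_ : \int[mu]_(x in D) _ = \int[mu]_(x in D) `|v x - u x|).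
  by apply: Rintegral_ge0 => x _; exact: normr_ge0.
apply: Rintegral_ae_eq.
- by apply/measurable_EFinP; exact: measurable_int i.
- by apply/measurable_EFinP; exact: measurable_int (integrable_norm i).
by apply: filterS uv => x h Dx; rewrite ger0_norm// subr_ge0 h.
Qed.

Lemma Rintegral_ae_cvg0 (F : nat -> X -> R) g :
  (forall k, measurable_fun D (F k)) ->
  {ae mu, forall x, D x -> F ^~ x @ \oo --> (0 : R)} ->
  mu.-integrable D (EFin \o g) -> (forall k x, D x -> `|F k x| <= g x) ->
  \int[mu]_(x in D) F k x @[k --> \oo] --> (0 : R).
Proof.
move=> mF F0 ig Fg.
have [||||_ _ H] := @dominated_convergence _ _ _ mu D mD
  (fun k x => (F k x)%:E) (cst 0%E) (EFin \o g) _ _ _ ig _.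
- by move=> k; exact/measurable_EFinP.
- exact: measurable_cst.
- apply: filterS F0 => x h /h Fx; exact: cvg_EFin (nearW _ _) Fx.
- by apply: aeW => x k Dx; rewrite lee_fin Fg.
by move: H; rewrite integral0_eq// => /fine_cvg.
Qed.

End ae_integrals.

Section energy.
Context {R : realType} {n : nat}.
Variable Omega : set 'rV[R]_n.
Hypothesis oOmega : open Omega.
Hypothesis bOmega : bounded_set Omega.
Local Notation vol := (lebesgue_rV R n).
Local Notation leb := (@lebesgue_measure R).
Implicit Types (phi : 'rV[R]_n -> R) (j : 'I_n.+1) (i : 'I_n).

(** U t stands for the jet of the difference of two solutions at time t, F t for the
    drift and a t for the diffusion coefficient. *)
Variables (T a0 a1 M : R).
Variables (U : R -> 'I_n.+1 -> 'rV[R]_n -> R) (F : R -> 'I_n -> 'rV[R]_n -> R).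
Variable a : R -> R.
Local Notation c phi := (fun t => pair0 Omega (U t) phi).
Local Notation J phi := (fun t => flux_pair Omega (U t) (F t) (a t) phi).

Hypothesis T0 : 0 < T.
Hypothesis a00 : 0 < a0.
Hypothesis a01 : a0 <= a1.
Hypothesis integrable_u : forall t, 0 < t < T -> vol.-integrable Omega (EFin \o U t ord0).
Hypothesis good : {ae leb, forall t : R, 0 < t < T -> [/\ approximable Omega (U t),
  forall i, measurable_fun Omega (F t i),
  forall i x, Omega x -> `|F t i x| <= M & a0 <= a t <= a1]}.
Hypothesis integrable_Hsqr : leb.-integrable `]0, T[ (EFin \o (fun t => Hsqr Omega (U t))).
Hypothesis measurable_Hpair : forall phi, smooth phi ->
  measurable_fun `]0, T[ (fun t => Hpair Omega (U t) phi).
Hypothesis integrable_J : forall phi, smooth phi ->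
  leb.-integrable `]0, T[ (EFin \o (J phi)).
Hypothesis primitive_J : forall phi, smooth phi -> forall t, 0 < t < T ->
  pair0 Omega (U t) phi = \int[leb]_(s in `]0, t[) flux_pair Omega (U s) (F s) (a s) phi.
Hypothesis bounded_c : forall phi, smooth phi ->
  exists C, forall t, 0 < t < T -> `|pair0 Omega (U t) phi| <= C.
Hypothesis measurable_c : forall phi, smooth phi -> measurable_fun `]0, T[ (c phi).

Let mO : measurable Omega. Proof. exact: mOmega. Qed.
Let mI t : measurable (`]0, t[%classic : set (measurableTypeR R)).
Proof. exact: measurable_itv. Qed.

Lemma integrable_uM t phi : 0 < t < T -> smooth phi ->
  vol.-integrable Omega (EFin \o (fun x => U t ord0 x * phi x)).
Proof.
move=> tT sphi; have [C _ HC] := continuous_bounded_Omega bOmega (smooth_continuous sphi).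
under [X in _ \o X]eq_fun do rewrite mulrC.
apply: (integrable_bddM (C := C)) (integrable_u tT) => //.
  by apply: measurable_funTS; exact: continuous_measurable_rV (smooth_continuous sphi).
by move=> x Ox; apply: HC; exact: subset_closure.
Qed.

Section galerkin_energy.
Variables (N m : nat) (e : nat -> 'rV[R]_N).
Local Notation Phi := (@galerkin R n N).
Local Notation B := (gdot Omega (N := N)).
Hypothesis oe : orthonormal B m e.

(** The square of the H^1 distance from U s to the Galerkin space when U s is
    square-integrable; the maximum keeps it nonnegative for the other s. *)
Definition defect (s : R) : R :=
  Num.max 0 (Hsqr Omega (U s) - \sum_(k < m) Hpair Omega (U s) (Phi (e k)) ^+ 2).

Lemma defect_ge0 s : 0 <= defect s.
Proof. by rewrite le_max lexx. Qed.

Lemma defect_le s : defect s <= Hsqr Omega (U s).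
Proof.
rewrite ge_max; apply/andP; split.
  by apply: sumr_ge0 => j _; exact: Rintegral_sqr_ge0.
by rewrite gerBl; apply: sumr_ge0 => k _; exact: sqr_ge0.
Qed.

Lemma measurable_defect : measurable_fun (`]0, T[%classic : set (measurableTypeR R)) defect.
Proof.
apply: measurable_maxr; first exact: measurable_cst.
apply: measurable_funB.
  by apply/measurable_EFinP; exact: measurable_int integrable_Hsqr.
apply: measurable_sum => k; apply: measurable_funX.
by apply: measurable_Hpair; exact: smooth_galerkin.
Qed.

Lemma integrable_defect : leb.-integrable `]0, T[ (EFin \o defect).
Proof.
apply: (@integrable_le _ _ R leb `]0, T[%classic defect (fun t => Hsqr Omega (U t))) => //.
  exact: measurable_defect.
by move=> s _; rewrite ger0_norm ?defect_ge0// defect_le.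
Qed.

Lemma Hpair_galerkinD s : (forall j, L2 vol Omega (U s j)) -> forall b1 b2,
  Hpair Omega (U s) (Phi (b1 + b2)) = Hpair Omega (U s) (Phi b1) + Hpair Omega (U s) (Phi b2).
Proof.
by move=> LU b1 b2; rewrite galerkinD HpairD//; exact: smooth_galerkin.
Qed.

Lemma Hpair_galerkinZ s : (forall j, L2 vol Omega (U s j)) -> forall k b,
  Hpair Omega (U s) (Phi (k *: b)) = k * Hpair Omega (U s) (Phi b).
Proof.
by move=> LU k b; rewrite galerkinZ HpairZ//; exact: smooth_galerkin.
Qed.

Lemma pair0_galerkinD s : 0 < s < T -> forall b1 b2,
  pair0 Omega (U s) (Phi (b1 + b2)) = pair0 Omega (U s) (Phi b1) + pair0 Omega (U s) (Phi b2).
Proof.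
move=> sT b1 b2; rewrite galerkinD /pair0 -RintegralD'//;
  try (by apply: integrable_uM => //; exact: smooth_galerkin).
by apply: eq_Rintegral => x _; rewrite mulrDr.
Qed.

Lemma pair0_galerkinZ s : 0 < s < T -> forall k b,
  pair0 Omega (U s) (Phi (k *: b)) = k * pair0 Omega (U s) (Phi b).
Proof.
move=> sT k b; rewrite galerkinZ /pair0 -RintegralZl//;
  last by apply: integrable_uM => //; exact: smooth_galerkin.
by apply: eq_Rintegral => x _; rewrite mulrCA.
Qed.

(** The square of the norm of the difference u in the dual of the Galerkin space. *)
Definition energy (s : R) : R := \sum_(k < m) pair0 Omega (U s) (Phi (e k)) ^+ 2.

Definition growth := M ^+ 2 * n.+1%:R / (2 * a0) + a1.

Lemma growth_gt0 : 0 < growth.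
Proof.
have a20 : 0 <= 2 * a0 by rewrite mulr_ge0// ltW.
by rewrite /growth ltr_wpDl ?(lt_le_trans a00)// divr_ge0// mulr_ge0 ?sqr_ge0.
Qed.

(** The left-hand side, half the derivative of the energy, is the flux paired with
    the Riesz representative of u, so that [flux_pair_le] applies. *)
Lemma energy_derivative : {ae leb, forall s : R, 0 < s < T ->
  \sum_(k < m) pair0 Omega (U s) (Phi (e k)) *
    flux_pair Omega (U s) (F s) (a s) (Phi (e k)) <=
  growth * energy s + a1 / 2 * defect s}.
Proof.
apply: filterS good => s H sT; have [[LU _] mF bF aa] := H sT.
pose w k := pair0 Omega (U s) (Phi (e k)).
pose L b := Hpair Omega (U s) (Phi b).
pose v := \sum_(k < m) w k *: e k; pose P := \sum_(k < m) L (e k) *: e k.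
have LD := Hpair_galerkinD LU; have LZ := Hpair_galerkinZ LU.
have cD := pair0_galerkinD sT; have cZ := pair0_galerkinZ sT.
have JE : flux_pair Omega (U s) (F s) (a s) (Phi v) =
    \sum_(k < m) w k * flux_pair Omega (U s) (F s) (a s) (Phi (e k)).
  apply: (@L_comb _ _ m e (fun b => flux_pair Omega (U s) (F s) (a s) (Phi b))).
    move=> b1 b2; rewrite galerkinD.
    exact: (flux_pairD oOmega bOmega _ LU mF bF (smooth_galerkin _) (smooth_galerkin _)).
  move=> k b; rewrite galerkinZ.
  exact: (flux_pairZ oOmega bOmega _ LU mF bF _ (smooth_galerkin _)).
have vE : energy s = Hdot Omega (Phi v) (Phi v).
  rewrite -/(gdot Omega v v) (B_comb2 (@gdotD _ _ _ oOmega bOmega N) (@gdotZ _ _ _ oOmega bOmega N) (@gdotC _ _ _ N) w w oe).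
  by apply: eq_bigr => k _; rewrite expr2.
have cv : pair0 Omega (U s) (Phi v) = energy s.
  rewrite (L_comb m e cD cZ w); apply: eq_bigr => k _; by rewrite expr2.
have Lv : Hpair Omega (U s) (Phi v) = pair0 Omega (U s) (Phi P).
  rewrite (L_comb m e cD cZ (fun k => L (e k))) (L_comb m e LD LZ w).
  by apply: eq_bigr => k _; rewrite mulrC.
rewrite -[leLHS]JE vE.
have := flux_pair_le oOmega bOmega LU mF bF a00 aa (smooth_galerkin v) (smooth_galerkin P)
  (etrans cv vE) Lv.
have a12 : 0 <= a1 / 2 by rewrite divr_ge0// (le_trans (ltW a00)).
move=> /le_trans; apply; rewrite lerD2l; apply: ler_wpM2l => //.
rewrite Hdist//; last exact: smooth_galerkin.
rewrite -/(gdot Omega P P).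
rewrite (dist_proj_eq (@gdotD _ _ _ oOmega bOmega N) (@gdotZ _ _ _ oOmega bOmega N) (@gdotC _ _ _ N) oe _ LD LZ).
by rewrite le_max lexx orbT.
Qed.

(** The energy is a sum of squares of primitives, hence the primitive of its
    derivative by [sqr_primitive]. *)
Lemma energy_le t : 0 < t < T -> energy t <=
  2 * (a1 * \int[leb]_(s in `]0, T[) defect s) * expR (2 * (2 * growth) * T).
Proof.
have alg (g x y z : R) : a1 * y <= a1 * z ->
    2 * (g * x + a1 / 2 * y) <= a1 * z + 2 * g * x by lra.
move: t; have g0 := growth_gt0; have a10 : 0 <= a1 by rewrite (le_trans (ltW a00)).
have se k : smooth (Phi (e k)) by exact: smooth_galerkin.
have sub r : 0 < r < T -> `]0, r[%classic `<=` `]0, T[%classic.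
  by move=> /andP[_ rT] x; rewrite /= !in_itv/= => /andP[-> /lt_trans->].
have mE : measurable_fun (`]0, T[%classic : set (measurableTypeR R)) energy.
  by apply: measurable_sum => k; apply: measurable_funX; exact: measurable_c.
have [C HC] := choice (fun k : nat => bounded_c (se k)).
have EM t : 0 < t < T -> 0 <= energy t <= \sum_(k < m) C k ^+ 2.
  move=> tT; rewrite sumr_ge0/=; last by move=> k _; exact: sqr_ge0.
  apply: ler_sum => k _; rewrite -[leLHS]real_normK ?num_real//.
  by rewrite lerXn2r ?nnegrE ?HC// (le_trans _ (HC k t tT)).
have iE t : 0 < t < T -> leb.-integrable `]0, t[ (EFin \o energy).
  move=> tT; have mEt := measurable_funS (mI T) (sub t tT) mE.
  apply: (@integrable_le _ _ R leb `]0, t[%classic energy (cst (\sum_(k < m) C k ^+ 2))) => //.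
    move=> s st; have sT : 0 < s < T.
      by have := sub t tT _ st; rewrite /= in_itv.
    by have /andP[E0 ?] := EM _ sT; rewrite ger0_norm.
  have icc : leb.-integrable `[0, t] (EFin \o (cst (\sum_(k < m) C k ^+ 2) : R -> R)).
    apply: continuous_compact_integrable; first exact: segment_compact.
    exact: cst_continuous.
  by apply: integrableS icc => //; exact: subset_itv_oo_cc.
have iD t : 0 < t < T -> leb.-integrable `]0, t[ (EFin \o defect).
  by move=> tT; apply: integrableS integrable_defect => //; exact: sub.
apply: (@gronwall R energy T (2 * growth) _ (\sum_(k < m) C k ^+ 2)) => //.
- by rewrite mulr_gt0.
- by rewrite mulr_ge0//; apply: Rintegral_ge0 => s _; exact: defect_ge0.
move=> t tT; have st s : `]0, t[%classic s -> 0 < s < T.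
  by move=> /(sub t tT); rewrite /= in_itv.
have iJ k : leb.-integrable `]0, t[ (EFin \o (J (Phi (e k)))).
  by apply: integrableS (integrable_J (se k)) => //; exact: sub.
have iS k := (sqr_primitive (iJ k)).1.
have E1 : energy t = 2 * \int[leb]_(s in `]0, t[) (\sum_(k < m)
    (\int[leb]_(r in `]0, s[) J (Phi (e k)) r * J (Phi (e k)) s)).
  rewrite (@Rintegral_sum _ _ R leb) // mulr_sumr; apply: eq_bigr => k _.
  by rewrite -(sqr_primitive (iJ k)).2 primitive_J.
rewrite E1.
have iG : leb.-integrable `]0, t[ (EFin \o (fun s => growth * energy s)).
  by apply: (@integrable_scaleR _ _ R leb) => //; exact: iE.
have iD2 : leb.-integrable `]0, t[ (EFin \o (fun s => a1 / 2 * defect s)).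
  by apply: (@integrable_scaleR _ _ R leb) => //; exact: iD.
apply: (@le_trans _ _ (2 * \int[leb]_(s in `]0, t[)
    (growth * energy s + a1 / 2 * defect s))).
  rewrite ler_wpM2l//; apply: (@Rintegral_ae_le _ _ R leb) => //.
  - exact: (@integrable_sumR _ _ R leb).
  - exact: (@integrable_addR _ _ R leb).
  apply: filterS energy_derivative => s H st'; apply: le_trans (H (st s st')).
  by rewrite le_eqVlt; apply/orP; left; apply/eqP; apply: eq_bigr => k _;
    rewrite primitive_J//; exact: st.
rewrite RintegralD'// !RintegralZl//; [|exact: iD|exact: iE].
have hD : \int[leb]_(s in `]0, t[) defect s <= \int[leb]_(s in `]0, T[) defect s.
  rewrite /Rintegral fine_le//; try (by apply: integrable_fin_num => //; exact: iD);
    first exact: (@integrable_fin_num _ _ R leb _ _ _ integrable_defect).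
  apply: (@ge0_subset_integral _ _ R leb _ _ (mI t) (mI T)).
  - by apply/measurable_EFinP; exact: measurable_defect.
  - by move=> s _; rewrite lee_fin defect_ge0.
  - exact: (sub t tT).
have : a1 * \int[leb]_(s in `]0, t[) defect s <= a1 * \int[leb]_(s in `]0, T[) defect s.
  by rewrite ler_wpM2l.
exact: alg.
Qed.

End galerkin_energy.
Lemma defect_dist N m (e : nat -> 'rV[R]_N) s (b : 'rV[R]_N) :
  (forall b, gdot Omega (b - proj (gdot Omega (N := N)) m e b)
                        (b - proj (gdot Omega (N := N)) m e b) = 0) ->
  (forall j, L2 vol Omega (U s j)) ->
  defect m e s <=
  \sum_j \int[vol]_(x in Omega) ((U s j x - jet (galerkin b) j x) ^+ 2).
Proof.
move=> span_e LU.
have D0 b' : 0 <= \sum_j \int[vol]_(x in Omega) ((U s j x - jet (galerkin b') j x) ^+ 2).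
  by apply: sumr_ge0 => j _; exact: Rintegral_sqr_ge0.
rewrite ge_max D0/= Hdist//; last exact: smooth_galerkin.
apply: (dist_proj (@gdotD _ _ _ oOmega bOmega N) (@gdotZ _ _ _ oOmega bOmega N)
  (@gdotC _ _ _ N) (@gdot_ge0 _ _ _ N) span_e (Hpair_galerkinD LU) (Hpair_galerkinZ LU)).
by move=> b'; rewrite -Hdist//; exact: smooth_galerkin.
Qed.

Lemma comb_galerkin_widen K N (d : nat -> R) : (K <= N)%N ->
  exists b : 'rV[R]_N, comb K d = galerkin b :> ('rV[R]_n -> R).
Proof. by move=> KN; rewrite (comb_widen d KN) comb_galerkin; eexists. Qed.

(** The Galerkin function is expanded in the orthonormal family, and each term is
    bounded by Young's inequality; the null remainder vanishes on Omega. *)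
Lemma pair0_le_energy N m (e : nat -> 'rV[R]_N) t (b : 'rV[R]_N) r : orthonormal (gdot Omega (N := N)) m e ->
  (forall b, gdot Omega (b - proj (gdot Omega (N := N)) m e b)
                        (b - proj (gdot Omega (N := N)) m e b) = 0) ->
  0 < t < T -> 0 < r ->
  2 * pair0 Omega (U t) (galerkin b) <=
  r * Hdot Omega (galerkin b) (galerkin b) + r^-1 * energy m e t.
Proof.
move=> oe span_e tT r0.
have BD := @gdotD _ _ _ oOmega bOmega N; have BZ := @gdotZ _ _ _ oOmega bOmega N.
have cD := @pair0_galerkinD N _ tT; have cZ := @pair0_galerkinZ N _ tT.
have c0 : pair0 Omega (U t) (galerkin (b - proj (gdot Omega (N := N)) m e b)) = 0.
  have := Hdot_null oOmega bOmega (smooth_galerkin (b - proj (gdot Omega (N := N)) m e b)) (span_e b).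
  move=> H; rewrite /pair0 (@Rintegral_ae_eq _ _ _ _ _ mO _ (cst 0)).
  - by rewrite Rintegral_cst ?mul0r.
  - apply/measurable_EFinP; apply: measurable_int.
    by apply: (integrable_uM tT); exact: smooth_galerkin.
  - exact: measurable_cst.
  by apply: filterS H => x H Ox; rewrite H// mulr0.
have cE : pair0 Omega (U t) (galerkin b) =
    \sum_(k < m) gdot Omega b (e k) * pair0 Omega (U t) (galerkin (e k)).
  rewrite -[in LHS](subrK (proj (gdot Omega (N := N)) m e b) b) cD c0 add0r.
  by rewrite -(L_comb m e cD cZ (fun k => gdot Omega b (e k))).
have BE : \sum_(k < m) gdot Omega b (e k) ^+ 2 <= gdot Omega b b.
  rewrite -subr_ge0; under eq_bigr do rewrite gdotC.
  apply: (dist_proj_ge0 BD BZ (@gdotC _ _ _ N) oe (L := fun a => gdot Omega a b)) => [u v|k u|u].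
  - exact: BD.
  - exact: BZ.
  - have <- : gdot Omega (b - u) (b - u) = gdot Omega b b - 2 * gdot Omega u b + gdot Omega u u.
      by rewrite (BB BD BZ) [gdot Omega b _]gdotC [gdot Omega u (b - u)]gdotC !(BB BD BZ) (gdotC _ b u); ring.
    exact: gdot_ge0.
apply: (@le_trans _ _ (r * \sum_(k < m) gdot Omega b (e k) ^+ 2 + r^-1 * energy m e t)); last first.
  by rewrite lerD2r ler_wpM2l// ltW.
rewrite cE /energy !mulr_sumr -big_split/=; apply: ler_sum => k _.
set x := gdot Omega b _; set y := pair0 _ _ _.
have -> : r * x ^+ 2 + r^-1 * y ^+ 2 = 2 * (x * y) + r^-1 * (r * x - y) ^+ 2.
  by field; rewrite gt_eqF.
by rewrite lerDl mulr_ge0 ?sqr_ge0// invr_ge0 ltW.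
Qed.

(** The defects tend to 0 almost everywhere, since U t is approximable, and they are
    dominated by the H^1 norm of U t: their integrals tend to 0, and so do the
    energies. *)
Lemma pair0_span_le0 phi t : in_span phi -> 0 < t < T -> pair0 Omega (U t) phi <= 0.
Proof.
move=> [K [d ->]] tT.
have HB N : exists me : nat * (nat -> 'rV[R]_N),
    orthonormal (gdot Omega (N := N)) me.1 me.2 /\
    forall b, gdot Omega (b - proj (gdot Omega (N := N)) me.1 me.2 b)
                         (b - proj (gdot Omega (N := N)) me.1 me.2 b) = 0.
  by have [m [e H]] := galerkin_basis oOmega bOmega N; exists (m, e).
pose me N := projT1 (cid (HB N)).
have oe N : orthonormal (gdot Omega (N := N)) (me N).1 (me N).2.
  by have [] := projT2 (cid (HB N)).
have span_e N b : gdot Omega (b - proj (gdot Omega (N := N)) (me N).1 (me N).2 b)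
                             (b - proj (gdot Omega (N := N)) (me N).1 (me N).2 b) = 0.
  by have [_ H] := projT2 (cid (HB N)); exact: H.
pose rho N := defect (me N).1 (me N).2.
have rho0 : \int[leb]_(s in `]0, T[) rho N s @[N --> \oo] --> (0 : R).
  apply: (@Rintegral_ae_cvg0 _ _ R leb `]0, T[%classic (mI T) rho
    (fun s => Hsqr Omega (U s))) => //.
  - by move=> N; exact: measurable_defect.
  - apply: filterS good => s H sT; have [|[LU HU] _ _ _] := H _.
      by move: sT; rewrite /= in_itv.
    apply/cvgrPdist_le => /= eps eps0.
    have [_ [K' [d' ->]] HK] := HU _ eps0.
    near=> N; have K'N : (K' <= N)%N by near: N; exact: nbhs_infty_ge.
    rewrite sub0r normrN ger0_norm ?defect_ge0//.
    have [b bE] := comb_galerkin_widen d' K'N; rewrite bE in HK.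
    by apply: le_trans HK; exact: (defect_dist b (span_e N) LU).
  - by move=> N s _; rewrite ger0_norm ?defect_ge0// defect_le.
apply/ler_addgt0Pr => eps eps0; rewrite add0r.
set D := Hdot Omega (comb K d) (comb K d).
have D0 : 0 <= D by exact: Hdot_ge0.
(* This r makes the first term of the duality estimate small whatever N. *)
pose r := eps / (D + 1); have r0 : 0 < r by rewrite divr_gt0// ltr_wpDl.
pose G := 2 * (2 * growth) * T.
have lim : r^-1 * (2 * (a1 * \int[leb]_(s in `]0, T[) rho N s) * expR G) @[N --> \oo] --> (0 : R).
  rewrite [X in _ --> X](_ : 0 = r^-1 * (2 * (a1 * 0) * expR G)); last by ring.
  by apply: cvgMr; apply: cvgMl; apply: cvgMr; apply: cvgMr.
have /cvgrPdist_le/(_ _ eps0) := lim => Hlim.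
near \oo => N.
have KN : (K <= N)%N by near: N; exact: nbhs_infty_ge.
have [b bE] := comb_galerkin_widen d KN.
have := pair0_le_energy b (oe N) (span_e N) tT r0.
rewrite -bE -/D.
have h1 : r * D <= eps by rewrite /r mulrAC ler_pdivrMr ?ltr_wpDl// ler_pM2l// lerDl.
have h2 : r^-1 * energy (me N).1 (me N).2 t <= eps.
  apply: (@le_trans _ _ (r^-1 * (2 * (a1 * \int[leb]_(s in `]0, T[) rho N s) * expR G))).
    by rewrite ler_wpM2l ?invr_ge0 ?(ltW r0)//; exact: energy_le.
  apply: le_trans (ler_norm _) _.
  by rewrite -normrN -sub0r; near: N.
move: h1 h2; set x := r * D; set y := r^-1 * _; set p := pair0 _ _ _ => h1 h2 h3.
have h4 := le_trans h3 (lerD h1 h2).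
by rewrite -(ler_pM2l (ltr0Sn _ 1)) (le_trans h4)// mulr_natl mulr2n.
Unshelve. all: by end_near. Qed.

Theorem pair0_span_eq0 phi t : in_span phi -> 0 < t < T -> pair0 Omega (U t) phi = 0.
Proof.
move=> sphi tT; apply/eqP; rewrite eq_le pair0_span_le0//=.
have := pair0_span_le0 (in_spanZ (-1) sphi) tT.
rewrite /pair0 (_ : \int[vol]_(x in Omega) _ =
    -1 * \int[vol]_(x in Omega) (U t ord0 x * phi x)).
  by rewrite mulN1r oppr_le0.
rewrite -RintegralZl//; last exact: (integrable_uM tT (in_span_smooth sphi)).
by apply: eq_Rintegral => x _; rewrite mulrCA.
Qed.

End energy.

(** * Functions of time and space *)

Section sections.
Context d1 d2 (T1 : measurableType d1) (T2 : measurableType d2) {R : realType}.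
Variable m1 : {sigma_finite_measure set T1 -> \bar R}.
Variable m2 : {sigma_finite_measure set T2 -> \bar R}.
Variables (D1 : set T1) (D2 : set T2).
Hypotheses (mD1 : measurable D1) (mD2 : measurable D2).
Implicit Types h : T1 -> T2 -> R.
Local Notation Q := (D1 `*` D2).
Local Notation unc h := (fun z : T1 * T2 => h z.1 z.2).

Let mQ : measurable Q. Proof. exact: measurableX. Qed.

Lemma patch_section h t x :
  (unc h \_ Q) (t, x) = if t \in D1 then (h t \_ D2) x else 0.
Proof.
rewrite !patchE; have [tD|tD] := boolP (t \in D1); have [xD|xD] := boolP (x \in D2).
- by rewrite mem_set//=; rewrite !inE in tD xD.
- by rewrite memNset//= => -[_ /=]; move: xD; rewrite notin_setE.
- by rewrite memNset//= => -[/=]; move: tD; rewrite notin_setE.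
- by rewrite memNset//= => -[/=]; move: tD; rewrite notin_setE.
Qed.

Lemma measurable_section h t : measurable_fun Q (unc h) -> D1 t ->
  measurable_fun D2 (h t).
Proof.
move=> /(measurable_restrictT _ mQ) mh tD; apply/(measurable_restrictT _ mD2).
have := measurableT_comp mh (pair1_measurable t).
rewrite (_ : _ \o _ = h t \_ D2)//; apply/funext => x /=.
by rewrite patch_section mem_set.
Qed.

Lemma integrable_patch d (T : measurableType d) (mu : {measure set T -> \bar R})
    (D : set T) (u : T -> R) : measurable D ->
  mu.-integrable D (EFin \o u) <-> mu.-integrable setT (EFin \o (u \_ D)).
Proof.
move=> mD; have E : (EFin \o u) \_ D = EFin \o (u \_ D).
  by apply/funext => x; rewrite /= !patchE; case: ifP.
by split=> [/(integrable_mkcond _ mD)|H]; [|apply/(integrable_mkcond _ mD)]; rewrite E.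
Qed.

Lemma sections_integrable h : (m1 \x m2)%E.-integrable Q (EFin \o unc h) ->
  [/\ {ae m1, forall t, D1 t -> m2.-integrable D2 (EFin \o h t)},
      m1.-integrable D1 (EFin \o (fun t => \int[m2]_(x in D2) h t x)) &
      \int[(m1 \x m2)%E]_(z in Q) h z.1 z.2 =
      \int[m1]_(t in D1) \int[m2]_(x in D2) h t x].
Proof.
move=> /(integrable_patch _ _ mQ) ih; split.
- have := Rfubini_ae ih; apply: filterS => t + tD.
  move=> H; apply/(integrable_patch _ _ mD2); apply: eq_integrable H => // x _ /=.
  by rewrite patch_section mem_set.
- apply/(integrable_patch _ _ mD1); apply: eq_integrable (Rfubini_integrable1 ih) => // t _ /=.
  congr EFin; rewrite patchE; under eq_Rintegral do rewrite patch_section.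
  case: ifP => tD; first by rewrite -Rintegral_mkcond.
  by rewrite Rintegral_cst// mul0r.
- rewrite Rintegral_mkcond -(Rfubini1 ih) [RHS]Rintegral_mkcond.
  apply: eq_Rintegral => t _; rewrite patchE.
  under eq_Rintegral do rewrite patch_section.
  case: ifP => tD; first by rewrite -Rintegral_mkcond.
  by rewrite Rintegral_cst// mul0r.
Qed.

Lemma L2_section h : L2 (m1 \x m2)%E Q (unc h) ->
  {ae m1, forall t, D1 t -> L2 m2 D2 (h t)}.
Proof.
move=> [mh ih]; have [H _ _] := @sections_integrable (fun t x => h t x ^+ 2) ih.
by apply: filterS H => t Ht tD; split; [exact: measurable_section|exact: Ht].
Qed.

Lemma Rintegral_ae_sections h h' : (m1 \x m2)%E.-integrable Q (EFin \o unc h) ->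
  (m1 \x m2)%E.-integrable Q (EFin \o unc h') ->
  {ae m1, forall t, D1 t -> {ae m2, forall x, D2 x -> h t x = h' t x}} ->
  \int[(m1 \x m2)%E]_(z in Q) h z.1 z.2 = \int[(m1 \x m2)%E]_(z in Q) h' z.1 z.2.
Proof.
move=> ih ih' hh'.
have mh : measurable_fun Q (unc h) by apply/measurable_EFinP; exact: measurable_int ih.
have mh' : measurable_fun Q (unc h') by apply/measurable_EFinP; exact: measurable_int ih'.
have [_ i1 ->] := sections_integrable ih; have [_ i2 ->] := sections_integrable ih'.
apply: Rintegral_ae_eq => //.
- by apply/measurable_EFinP; exact: measurable_int i1.
- by apply/measurable_EFinP; exact: measurable_int i2.
apply: filterS hh' => t Ht tD; apply: Rintegral_ae_eq; [exact: mD2|..].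
- exact: measurable_section mh tD.
- exact: measurable_section mh' tD.
- exact: Ht.
Qed.

Lemma integrable_sections h : measurable_fun Q (unc h) -> (forall t x, 0 <= h t x) ->
  (\int[m1]_(t in D1) \int[m2]_(x in D2) (h t x)%:E < +oo)%E ->
  (m1 \x m2)%E.-integrable Q (EFin \o unc h).
Proof.
move=> mh h0 hoo; apply/(integrable_patch _ _ mQ).
apply/integrable12ltyP; first by apply/measurable_EFinP/(measurable_restrictT _ mQ).
rewrite (_ : (\int[m1]_x _)%E = (\int[m1]_(t in D1) \int[m2]_(x in D2) (h t x)%:E)%E)//.
rewrite [RHS]integral_mkcond; apply: eq_integral => t _; rewrite patchE.
under eq_integral do rewrite /= patch_section.
case: ifP => tD; last by rewrite integral0_eq// => x _; rewrite normr0.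
rewrite [RHS]integral_mkcond; apply: eq_integral => x _.
by rewrite !patchE; case: ifP => _; rewrite ?normr0// ger0_norm.
Qed.

Lemma ae_bounded_L2 h M : (m1 D1 < +oo)%E -> (m2 D2 < +oo)%E ->
  measurable_fun Q (unc h) ->
  {ae m1, forall t, D1 t -> {ae m2, forall x, D2 x -> `|h t x| <= M}} ->
  L2 (m1 \x m2)%E Q (unc h).
Proof.
move=> fin1 fin2 mh hM; split=> //.
have mh2 : measurable_fun Q (unc (fun t x => h t x ^+ 2)) by exact: measurable_funX.
apply: (@integrable_sections (fun t x => h t x ^+ 2)) => //.
  by move=> t x; exact: sqr_ge0.
have fin : ((M ^+ 2)%:E * m2 D2 < +oo)%E.
  by apply: lte_mul_pinfty; rewrite ?lee_fin ?sqr_ge0.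
apply: (@le_lt_trans _ _ (\int[m1]_(t in D1) ((M ^+ 2)%:E * m2 D2))%E); last first.
  rewrite integral_cst//; apply: lte_mul_pinfty => //.
    by rewrite mule_ge0 ?lee_fin ?sqr_ge0.
  by rewrite ge0_fin_numE// mule_ge0 ?lee_fin ?sqr_ge0.
apply: ae_ge0_le_integral.
- exact: mD1.
- by move=> t _; apply: integral_ge0 => x _; rewrite lee_fin sqr_ge0.
- have mF : measurable_fun setT (fubini_F m2 (EFin \o (unc (fun t x => h t x ^+ 2) \_ Q))).
    apply: measurable_fun_fubini_tonelli_F.
      exact/measurable_EFinP/(measurable_restrictT _ mQ).
    by move=> z; rewrite lee_fin /= patchE; case: ifP => // _; exact: sqr_ge0.
  apply: eq_measurable_fun (measurable_funTS mF) => t tD.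
  rewrite /fubini_F [RHS]integral_mkcond; apply: eq_integral => x _.
  rewrite /= -[(_ \_ Q) (t, x)]/((unc (fun t x => h t x ^+ 2) \_ Q) (t, x)).
  by rewrite (patch_section (fun t x => h t x ^+ 2)) tD !patchE; case: ifP.
- by move=> t _; rewrite mule_ge0 ?lee_fin ?sqr_ge0.
- exact: measurable_cst.
apply: filterS hM => t + tD => /(_ tD) Ht.
rewrite -integral_cst//; apply: ae_ge0_le_integral.
- exact: mD2.
- by move=> x _; rewrite lee_fin sqr_ge0.
- exact/measurable_EFinP/(@measurable_section (fun t x => h t x ^+ 2) t mh2 tD).
- by move=> x _; rewrite lee_fin sqr_ge0.
- exact: measurable_cst.
apply: filterS Ht => x /[apply] hx; rewrite lee_fin -[leLHS]real_normK ?num_real//.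
by rewrite lerXn2r ?nnegrE// (le_trans _ hx).
Qed.

Lemma ae_section (P : T1 -> T2 -> Prop) : {ae (m1 \x m2)%E, forall z, P z.1 z.2} ->
  {ae m1, forall t, {ae m2, forall x, P t x}}.
Proof.
move=> [N [mN N0 PN]].
have mf : measurable_fun setT (fun t => m2 (xsection N t)).
  exact: measurable_fun_xsection.
have : (\int[m1]_t `|m2 (xsection N t)| = 0)%E.
  by under eq_integral do rewrite gee0_abs//; exact: N0.
move=> /(ae_eq_integral_abs m1 measurableT mf); apply: filterS => t /(_ Logic.I) Nt.
exists (xsection N t); split => //; first exact: measurable_xsection.
move=> x /= nP; rewrite /xsection/= inE; exact: (PN (t, x)).
Qed.

End sections.

Section norms.
Context d (X : measurableType d) {R : realType}.
Variable mu : {measure set X -> \bar R}.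

Lemma Lnorm_pinfty_ae (u : X -> \bar R) (M : \bar R) : ('N[mu]_+oo[u] <= M)%E ->
  {ae mu, forall x, (`|u x| <= M)%E}.
Proof.
rewrite unlock; case: ifPn => [_ /ess_sup_inf.ess_supP//|].
rewrite -leNgt measure_le0 => /eqP mu0 _.
exists setT; split => //; exact: measurableT.
Qed.

Lemma in_Linfty_ae (D : set X) (u : X -> R) : in_Lebesgue mu +oo%E D u ->
  exists2 M, 0 < M & {ae mu, forall x, D x -> `|u x| <= M}.
Proof.
move=> [_ uoo]; have Nfin : 'N[mu]_+oo[EFin \o (u \_ D)]%E \is a fin_num.
  by rewrite ge0_fin_numE//; exact: Lnorm_ge0.
exists (fine 'N[mu]_+oo[EFin \o (u \_ D)]%E + 1).
  by rewrite ltr_wpDl// fine_ge0//; exact: Lnorm_ge0.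
have := Lnorm_pinfty_ae (lexx 'N[mu]_+oo[EFin \o (u \_ D)]%E).
apply: filterS => x + Dx; rewrite /= patchE mem_set// -[in X in (_ <= X)%E](fineK Nfin).
by rewrite lee_fin => /le_trans; apply; rewrite lerDl.
Qed.

Lemma in_L1_integrable (D : set X) (u : X -> R) : measurable D ->
  in_Lebesgue mu 1%E D u -> mu.-integrable D (EFin \o u).
Proof.
move=> mD [mu_ uoo]; apply/(integrable_patch _ _ mD)/integrableP; split.
  exact/measurable_EFinP/(measurable_restrictT _ mD).
by rewrite -Lnorm1.
Qed.

End norms.

Section mixed_norms.
Context {R : realType} {n : nat}.
Variables (Omega : set 'rV[R]_n) (I : set R).
Hypothesis mO : measurable Omega.
Hypothesis mI : measurable (I : set (measurableTypeR R)).
Local Notation vol := (lebesgue_rV R n).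
Local Notation leb := (@lebesgue_measure R).

Lemma mixed_Linfty_ae (u : R -> 'rV[R]_n -> R) : in_mixed_Lebesgue Omega I +oo%E +oo%E u ->
  exists2 M, 0 < M & {ae leb, forall t, I t ->
    {ae vol, forall x, Omega x -> `|u t x| <= M}}.
Proof.
move=> [_]; set N := Lnorm _ _ _ => Noo.
have Nfin : N \is a fin_num by rewrite ge0_fin_numE//; exact: Lnorm_ge0.
exists (fine N + 1); first by rewrite ltr_wpDl// fine_ge0//; exact: Lnorm_ge0.
have := Lnorm_pinfty_ae (lexx N); apply: filterS => t + tI.
rewrite /= patchE mem_set// gee0_abs ?Lnorm_ge0// => /Lnorm_pinfty_ae.
apply: filterS => x + Ox; rewrite /= patchE mem_set// -[in X in (_ <= X)%E](fineK Nfin).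
by rewrite lee_fin => /le_trans; apply; rewrite lerDl.
Qed.

Lemma mixed_L2_integrable (u : R -> 'rV[R]_n -> R) :
  in_mixed_Lebesgue Omega I 2%:E 2%:E u ->
  L2 (leb \x vol)%E (I `*` Omega) (fun z : measurableTypeR R * 'rV[R]_n => u z.1 z.2).
Proof.
move=> [mu uoo]; split=> //.
apply: (@integrable_sections _ _ _ _ _ leb vol I Omega mI mO (fun t x => u t x ^+ 2)).
- exact: measurable_funX.
- by move=> t x; exact: sqr_ge0.
have two : (2 : R) != 0 by [].
have := poweR_lty 2 uoo; rewrite (poweR_Lnorm _ _ two).
congr (_ < _)%E; rewrite [RHS]integral_mkcond; apply: eq_integral => t _.
rewrite !patchE; case: ifPn => tI; last by rewrite abse0 (poweR0r two).
rewrite gee0_abs ?Lnorm_ge0// (poweR_Lnorm _ _ two).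
rewrite [RHS]integral_mkcond; apply: eq_integral => x _.
rewrite -[(EFin \o _) x]/((u t \_ Omega) x)%:E !patchE.
case: ifPn => xO; last by rewrite abse0 (poweR0r two).
by rewrite -[`|(u t x)%:E|%E]/(`|u t x|%:E) poweR_EFin powR_mulrn ?normr_ge0// real_normK ?num_real.
Qed.

End mixed_norms.

(** * Uniqueness of weak gradients *)

Section weak_gradients.
Context {R : realType} {n : nat}.
Variable Omega : set 'rV[R]_n.
Hypothesis oOmega : open Omega.
Local Notation vol := (lebesgue_rV R n).
Implicit Types (u : 'rV[R]_n -> R) (g : 'rV[R]_n -> 'rV[R]_n).

Let mO : measurable Omega. Proof. exact: open_measurable_rV. Qed.

(** Tested with bumps, two weak gradients have the same integral over every small
    rational box. *)
Lemma weak_gradient_unique u g g' : weak_gradient Omega u g -> weak_gradient Omega u g' ->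
  {ae vol, forall x, Omega x -> g x = g' x}.
Proof.
move=> [ig wg] [ig' wg'].
suff H i : {ae vol, forall x, Omega x -> g x 0 i = g' x 0 i}.
  have : {ae vol, forall x, forall i, Omega x -> g x 0 i = g' x 0 i}.
    have : {ae vol, forall x, forall k : nat, forall i : 'I_n, i = k :> nat ->
        Omega x -> g x 0 i = g' x 0 i}.
      apply/ae_foralln => k; have [kn|nk] := ltnP k n.
        apply: filterS (H (Ordinal kn)) => x Hx i ik.
        by have -> : i = Ordinal kn by exact: val_inj.
      by apply: aeW => x i ik; move: (ltn_ord i); rewrite ik ltnNge nk.
    by apply: filterS => x Hx i; exact: Hx.
  by apply: filterS => x Hx Ox; apply/rowP => i; exact: Hx.
have box_eq a b : cbox (map_mx ratr a) (map_mx ratr b) `<=` Omega ->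
    {ae vol, forall x, qbox a b x -> g x 0 i = g' x 0 i}.
  set C := cbox _ _ => CO.
  have mC : measurable C by exact: measurable_cbox.
  have cC : compact C by exact: cbox_compact.
  have iC : vol.-integrable C (EFin \o (fun x => g x 0 i - g' x 0 i)).
    by apply: integrable_subR => //; [exact: (ig C cC CO).2|exact: (ig' C cC CO).2].
  have bC : qbox a b `<=` C by exact: box_cbox.
  have mb : measurable (qbox a b : set 'rV[R]_n) by exact: measurable_box.
  have : {ae vol, forall x, qbox a b x -> g x 0 i - g' x 0 i = 0}.
    apply: ae_eq0_qbox => //; first by apply: integrableS iC.
    move=> c d.
    have [a' [b' E]] : qboxes (qbox a b `&` qbox c d : set 'rV[R]_n).
      by apply: setI_closed_qboxes; eexists; eexists.
    rewrite E; set f := fun x => g x 0 i - g' x 0 i.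
    pose psi k : 'rV[R]_n -> R := bump k (map_mx ratr a') (map_mx ratr b').
    have off k x : ~ C x -> psi k x = 0.
      move=> nC; apply: bump_eq0 => abx; apply: nC; apply: bC.
      have [+ _] : (qbox a b `&` qbox c d) x by rewrite E.
      exact.
    have test k : Cc_infty Omega (psi k).
      split; first exact: smooth_bump.
      by exists C; split=> // x; exact: off.
    have restr (h : 'rV[R]_n -> R) k :
        \int[vol]_(x in Omega) (h x * psi k x) = \int[vol]_(x in C) (h x * psi k x).
      rewrite Rintegral_mkcond [RHS]Rintegral_mkcond; apply: eq_Rintegral => x _.
      rewrite !patchE; case: (boolP (x \in C)) => [|]; rewrite ?inE ?notin_setE => Cx.
        by rewrite mem_set//; exact: CO.
      by rewrite off// mulr0 if_same.
    have bpsi (h : 'rV[R]_n -> R) k : vol.-integrable C (EFin \o h) ->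
        vol.-integrable C (EFin \o (fun x => h x * psi k x)).
      move=> ih; under [X in _ \o X]eq_fun do rewrite mulrC.
      apply: (integrable_bddM (C := 1)) => //.
        apply: measurable_funTS; apply: continuous_measurable_rV.
        exact: (smooth_continuous (smooth_bump _ _ _)).
      by move=> x _; rewrite ger0_norm ?bump_ge0 ?bump_le1.
    have zero k : \int[vol]_(x in C) (f x * psi k x) = 0.
      have := wg _ (test k) i; rewrite (wg' _ (test k) i) => /oppr_inj.
      rewrite !restr => E'; under eq_Rintegral do rewrite mulrBl.
      rewrite RintegralB//; [by rewrite -E' subrr| |].
        exact: (bpsi (fun x => g x 0 i) k ((ig C cC CO).2 i)).
      exact: (bpsi (fun x => g' x 0 i) k ((ig' C cC CO).2 i)).
    have L : \int[vol]_(x in C) (f x * psi k x) @[k --> \oo] -->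
        \int[vol]_(x in C) (f x * \1_(qbox a' b') x).
      apply: (Rintegral_cvg (g := fun x => `|f x|)) => //.
      - by move=> k; apply/measurable_EFinP; exact: measurable_int (bpsi f k iC).
      - apply: measurable_funM; last by apply: measurable_indic; exact: measurable_box.
        by apply/measurable_EFinP; exact: measurable_int iC.
      - by move=> x _; apply: cvgMr; exact: bump_cvg.
      - exact: integrable_norm.
      - move=> k x _; rewrite normrM ler_piMr//.
        by rewrite ger0_norm ?bump_ge0 ?bump_le1.
    have -> : \int[vol]_(x in qbox a' b') f x = \int[vol]_(x in C) (f x * \1_(qbox a' b') x).
      rewrite Rintegral_mkcond [RHS]Rintegral_mkcond; apply: eq_Rintegral => x _.
      rewrite !patchE indicE; case: (boolP (x \in qbox a' b')) => [|_].
        rewrite inE => abx; rewrite mem_set ?mulr1//; apply: bC.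
        have [+ _] : (qbox a b `&` qbox c d) x by rewrite E.
        exact.
      by rewrite mulr0 if_same.
    apply: (cvg_unique _ L); first exact: norm_hausdorff.
    by rewrite /=; under eq_fun do rewrite zero; exact: cvg_cst.
  by apply: filterS => x /[apply] /eqP; rewrite subr_eq0 => /eqP.
have : {ae vol, forall x, forall k : nat, forall ab : 'rV[rat]_n * 'rV[rat]_n,
    unpickle k = Some ab -> cbox (map_mx ratr ab.1) (map_mx ratr ab.2) `<=` Omega ->
    qbox ab.1 ab.2 x -> g x 0 i = g' x 0 i}.
  apply/ae_foralln => k; case: (unpickle k) => [ab|]; last by apply: aeW => x ab.
  have [abO|nO] := pselect (cbox (map_mx ratr ab.1) (map_mx ratr ab.2) `<=` Omega).
    by apply: filterS (box_eq _ _ abO) => x Hx ab' [<-] _.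
  by apply: aeW => x ab' [<-].
apply: filterS => x Hx; rewrite {1}(open_qbox_cover oOmega) => -[ab /= abO abx].
exact: (Hx (pickle ab) ab (pickleK ab) abO abx).
Qed.

End weak_gradients.

(** * From the weak formulation to the energy estimate *)

Section product_tests.
Context {R : realType} {n : nat}.

Let fst_linear_continuous :
  exists2 L : {linear (R * 'rV[R]_n)%type -> R}, continuous L & forall z, L z = z.1.
Proof.
have lf : linear (fun z : (R * 'rV[R]_n)%type => z.1) by [].
pose L : {linear (R * 'rV[R]_n)%type -> R} :=
  HB.pack (fun z : (R * 'rV[R]_n)%type => z.1) (GRing.isLinear.Build _ _ _ _ _ lf).
by exists L => // z; exact: cvg_fst.
Qed.

Let snd_linear_continuous :
  exists2 L : {linear (R * 'rV[R]_n)%type -> 'rV[R]_n}, continuous L & forall z, L z = z.2.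
Proof.
have lf : linear (fun z : (R * 'rV[R]_n)%type => z.2) by [].
pose L : {linear (R * 'rV[R]_n)%type -> 'rV[R]_n} :=
  HB.pack (fun z : (R * 'rV[R]_n)%type => z.2) (GRing.isLinear.Build _ _ _ _ _ lf).
by exists L => // z; exact: cvg_snd.
Qed.

Lemma tensor_test (chi : R -> R) (phi : 'rV[R]_n -> R) : smooth chi -> smooth phi ->
  let Phi := fun z : R * 'rV[R]_n => chi z.1 * phi z.2 in
  [/\ smooth Phi,
      forall z, 'D_(1, 0) Phi z = 'D_(1 : R) chi z.1 * phi z.2 &
      forall z v, 'D_(0, v) Phi z = chi z.1 * 'D_v phi z.2].
Proof.
move=> schi sphi Phi.
have [L cL LE] := fst_linear_continuous; have [L' cL' LE'] := snd_linear_continuous.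
pose chi1 (z : R * 'rV[R]_n) := chi (L z + 0); pose phi1 (z : R * 'rV[R]_n) := phi (L' z + 0).
have s1 : smooth chi1 by exact: smooth_comp_affine.
have s2 : smooth phi1 by exact: smooth_comp_affine.
have E1 z : chi1 z = chi z.1 by rewrite /chi1 LE addr0.
have E2 z : phi1 z = phi z.2 by rewrite /phi1 LE' addr0.
have PE : Phi = chi1 * phi1 by apply/funext => z; rewrite /Phi mulrfctE E1 E2.
have D1 v z : 'D_v chi1 z = 'D_(v.1 : R) chi z.1.
  have [_ ->] := @derive_comp_affine _ _ _ L 0 chi v z cL (smooth_differentiable _ schi).
  by rewrite !LE addr0.
have D2 v z : 'D_v phi1 z = 'D_(v.2) phi z.2.
  have [_ ->] := @derive_comp_affine _ _ _ L' 0 phi v z cL' (smooth_differentiable _ sphi).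
  by rewrite !LE' addr0.
have DE v z : 'D_v Phi z = chi z.1 * 'D_(v.2) phi z.2 + 'D_(v.1 : R) chi z.1 * phi z.2.
  rewrite PE deriveM; [|exact: smooth_derivable|exact: smooth_derivable].
  by rewrite D1 D2 E1 E2 /GRing.scale/= [phi _ * _]mulrC.
have zero (V : normedModType R) (g : V -> R) x : smooth g -> 'D_0 g x = 0.
  by move=> sg; rewrite deriveE ?linear0//; exact: smooth_differentiable.
split=> [|z|z v]; first by rewrite PE; exact: smoothM.
  by rewrite DE/= zero// mulr0 add0r.
by rewrite DE/= zero// mul0r addr0.
Qed.

End product_tests.

Section uniqueness.
Context {R : realType} {d : nat}.
Local Notation n := d.+1.
Variables (Omega : set 'rV[R]_n) (T eps : R) (sigma : R -> R).
Variable f : R -> 'rV[R]_n -> 'rV[R]_n.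
Local Notation vol := (lebesgue_rV R n).
Local Notation leb := (@lebesgue_measure R).
Local Notation I := (`]0, T[%classic : set (measurableTypeR R)).
Local Notation Q := (I `*` Omega).
Local Notation unc h := (fun z : measurableTypeR R * 'rV[R]_n => h z.1 z.2).
Implicit Types (p : R -> 'rV[R]_n -> R) (g : R -> 'rV[R]_n -> 'rV[R]_n).
Implicit Types (phi : 'rV[R]_n -> R) (chi : R -> R) (i : 'I_n) (j : 'I_n.+1).

Hypothesis HOmega : bounded_Lipschitz_domain Omega.
Hypothesis HT : 0 < T.
Hypothesis Hsigma_meas : measurable_fun `]0, T[ sigma.
Hypothesis Heps : 0 < eps.
Hypothesis Hsigma : forall t, t \in `]0, T[ -> eps <= sigma t <= eps^-1.
Hypothesis Hf : forall i, in_Lebesgue (vol_tx R n) +oo%E (`]0, T[ `*` Omega)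
  (fun z => f z.1 z.2 ord0 i).

Let oO : open Omega. Proof. by case: HOmega. Qed.
Let bO : bounded_set Omega. Proof. by case: HOmega. Qed.
Let mO : measurable Omega. Proof. exact: mOmega. Qed.
Let Ofin : (vol Omega < +oo)%E. Proof. exact: vol_Omega_lty. Qed.
Let mI : measurable I. Proof. exact: measurable_itv. Qed.
Let Ifin : (leb I < +oo)%E.
Proof. by rewrite lebesgue_measure_itv/=; case: ifP => _; rewrite ?ltry. Qed.
Let mQ : measurable Q. Proof. exact: measurableX. Qed.
Let Qfin : ((leb \x vol)%E Q < +oo)%E.
Proof.
by rewrite product_measure1E// lte_mul_pinfty// ge0_fin_numE.
Qed.

Let diffusion (t : R) : R := 2^-1 * sigma t ^+ 2.

Let diffusion_bounds t : I t -> 2^-1 * eps ^+ 2 <= diffusion t <= 2^-1 * eps^-1 ^+ 2.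
Proof.
move=> tI; have /andP[s1 s2] : eps <= sigma t <= eps^-1 by exact: Hsigma.
have s0 : 0 < sigma t by exact: lt_le_trans s1.
rewrite !ler_pM2l ?invr_gt0//; apply/andP; split.
  by rewrite lerXn2r ?nnegrE ?(ltW Heps) ?(ltW s0).
by rewrite lerXn2r ?nnegrE ?invr_ge0 ?(ltW Heps) ?(ltW s0).
Qed.

Let measurable_diffusion : measurable_fun Q (fun z : measurableTypeR R * 'rV[R]_n => diffusion z.1).
Proof.
apply: (@measurable_comp _ _ _ _ _ _ I (fun t : measurableTypeR R => diffusion t)) => //.
- by move=> _ [[t x] [/= tI _] <-].
- by apply: measurable_funM => //; apply: measurable_funX.
- exact: measurable_funTS measurable_fst.
Qed.

Let truncate (M r : R) : R := Num.max (- M) (Num.min M r).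

Let truncate_bound M r : 0 <= M -> `|truncate M r| <= M.
Proof.
move=> M0; rewrite ler_norml /truncate le_max lexx/= ge_max ge_min lexx/= andbT.
by rewrite (le_trans _ M0)// oppr_le0.
Qed.

Let truncate_id M r : `|r| <= M -> truncate M r = r.
Proof.
by rewrite ler_norml => /andP[Mr rM]; rewrite /truncate (min_idPr rM) (max_idPr Mr).
Qed.

(** A drift that is bounded everywhere spares the null sets of space-time in all
    later estimates. *)
Lemma bounded_drift : exists (M : R) (F : R -> 'I_n -> 'rV[R]_n -> R),
  [/\ forall i, measurable_fun Q (unc (fun t => F t i)),
      forall t i x, `|F t i x| <= M &
      {ae leb, forall t, I t -> {ae vol, forall x i, Omega x -> F t i x = f t x 0 i}}].
Proof.
have HM i := in_Linfty_ae (Hf i).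
pose M i := s2val (cid2 (HM i)); have M0 i : 0 < M i := s2valP (cid2 (HM i)).
have aeM i := s2valP' (cid2 (HM i)).
have MS i : M i <= \sum_k M k.
  by rewrite (bigD1 i)//= lerDl; apply: sumr_ge0 => k _; exact: ltW.
exists (\sum_k M k), (fun t i x => truncate (\sum_k M k) (f t x 0 i)); split.
- move=> i; apply: measurable_maxr; first exact: measurable_cst.
  by apply: measurable_minr; [exact: measurable_cst|exact: (Hf i).1].
- by move=> t i x; apply: truncate_bound; apply: sumr_ge0 => k _; exact: ltW.
have H i : {ae leb, forall t, {ae vol, forall x, Q (t, x) -> `|f t x 0 i| <= M i}}.
  apply: (@ae_section _ _ _ _ R leb vol (fun t x => Q (t, x) -> `|f t x 0 i| <= M i)).
  by apply: filterS (aeM i) => -[t x].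
have {}H : {ae leb, forall t, forall i, {ae vol, forall x, Q (t, x) -> `|f t x 0 i| <= M i}}.
  exact: filter_forall.
apply: filterS H => t Ht tI.
have : {ae vol, forall x, forall i, Q (t, x) -> `|f t x 0 i| <= M i} by exact: filter_forall.
apply: filterS => x Hx i Ox; rewrite truncate_id//.
by apply: le_trans (MS i); exact: Hx.
Qed.

Variables (M : R) (F : R -> 'I_n -> 'rV[R]_n -> R).
Hypothesis mF : forall i, measurable_fun Q (unc (fun t => F t i)).
Hypothesis bF : forall t i x, `|F t i x| <= M.
Hypothesis Ff : {ae leb, forall t, I t -> {ae vol, forall x i, Omega x -> F t i x = f t x 0 i}}.

Definition density_flux p g t i x : R := p t x * F t i x - diffusion t * g t x 0 i.

Lemma class_X_L2 p : class_X Omega T p -> L2 (leb \x vol)%E Q (unc p).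
Proof.
move=> [[_ pLoo] _]; have [K _ HK] := mixed_Linfty_ae pLoo.
apply: (@ae_bounded_L2 _ _ _ _ R leb vol I Omega mI mO p K Ifin Ofin).
  apply: measurable_funS pLoo.1.
    by apply: measurableX => //; exact: measurable_itv.
  by move=> [t x] [tI Ox]; split=> //=; exact: subset_itv_oo_cc.
apply: filterS HK => t Ht tI; apply: Ht; exact: subset_itv_oo_cc.
Qed.

Lemma density_integrable p t : in_Linfty_L1Linfty Omega T p ->
  {ae vol, forall x, Omega x -> 0 <= p t x} ->
  (\int[vol]_(x in Omega) (p t x)%:E = 1)%E -> t \in `[0, T] ->
  vol.-integrable Omega (EFin \o p t).
Proof.
move=> [[mp _] _] p0 p1 tT.
have mpt : measurable_fun Omega (p t).
  apply: (@measurable_section _ _ _ _ R (`[0, T]%classic : set (measurableTypeR R)) Omega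
    (measurable_itv _) mO p t mp) => //.
apply/integrableP; split; first exact/measurable_EFinP.
have -> : (\int[vol]_(x in Omega) `|(EFin \o p t) x| = \int[vol]_(x in Omega) (p t x)%:E)%E;
  last by rewrite p1 ltry.
apply: ae_eq_integral => //; [by apply: measurableT_comp => //; exact/measurable_EFinP|
  exact/measurable_EFinP|].
by apply: filterS p0 => x Hx Ox /=; rewrite ger0_norm ?Hx.
Qed.

Lemma bounded_smooth_Q phi : smooth phi -> exists2 C, 0 < C &
  measurable_fun Q (fun z : measurableTypeR R * 'rV[R]_n => phi z.2) /\
  forall z, Q z -> `|phi z.2| <= C.
Proof.
move=> sphi; have [C C0 HC] := continuous_bounded_Omega bO (smooth_continuous sphi).
exists C => //; split.
  apply: measurable_funTS; apply: (measurableT_comp (f := phi)) => //.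
  exact: continuous_measurable_rV (smooth_continuous sphi).
by move=> [t x] [_ Ox]; apply: HC; exact: subset_closure.
Qed.

Lemma bounded_smooth_time chi : smooth chi -> exists2 C, 0 < C &
  measurable_fun Q (fun z : measurableTypeR R * 'rV[R]_n => chi z.1) /\
  forall z, Q z -> `|chi z.1| <= C.
Proof.
move=> schi; have cchi := smooth_continuous schi.
have : compact (chi @` `[0, T]%classic).
  by apply: continuous_compact; [exact: continuous_subspaceT|exact: segment_compact].
move=> /compact_bounded[K [_ HK]]; exists (`|K| + 1); first by rewrite ltr_wpDl.
split.
  apply: measurable_funTS; apply: (measurableT_comp (f := chi : measurableTypeR R -> R)) => //.
  exact: continuous_measurable_fun.
move=> [t x] [/= tI _]; apply: HK; first by rewrite (le_lt_trans (ler_norm K))// ltrDl.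
by exists t => //; exact: subset_itv_oo_cc.
Qed.

Lemma integrable_tested (u : measurableTypeR R * 'rV[R]_n -> R) chi phi :
  smooth chi -> smooth phi ->
  (leb \x vol)%E.-integrable Q (EFin \o u) ->
  (leb \x vol)%E.-integrable Q (EFin \o (fun z => u z * (chi z.1 * phi z.2))).
Proof.
move=> schi sphi iu; have [C C0 [mc HC]] := bounded_smooth_time schi.
have [K K0 [mk HK]] := bounded_smooth_Q sphi.
under [X in _ \o X]eq_fun do rewrite mulrC.
apply: (@integrable_bddM _ _ R (leb \x vol)%E Q _ u (C * K)) => //.
  exact: measurable_funM.
by move=> z Qz; rewrite normrM ler_pM// ?HC ?HK.
Qed.

Lemma density_flux_L2 p g i : L2 (leb \x vol)%E Q (unc p) ->
  (forall i, L2 (leb \x vol)%E Q (fun z => g z.1 z.2 0 i)) ->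
  L2 (leb \x vol)%E Q (unc (fun t => density_flux p g t i)).
Proof.
move=> Lp Lg.
have -> : unc (fun t => density_flux p g t i) =
    fun z => F z.1 i z.2 * p z.1 z.2 - diffusion z.1 * g z.1 z.2 0 i.
  by apply/funext => z; rewrite /density_flux mulrC.
apply: L2_sub => //.
  by apply: (L2_bddM (C := M)) => // z _; exact: bF.
apply: (L2_bddM (C := 2^-1 * eps^-1 ^+ 2)) => // z [zI _].
have /andP[d1 d2] := diffusion_bounds zI; rewrite ger0_norm//.
by apply: le_trans d1; rewrite mulr_ge0 ?sqr_ge0.
Qed.

(** The gradient of the weak formulation and the square-integrable one agree almost
    everywhere by uniqueness of weak gradients, and the drift may be truncated. *)
Lemma weak_formulation_tensor (p0 : 'rV[R]_n -> R) p : class_X Omega T p ->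
  no_flux_weak_solution Omega T sigma f p0 p ->
  exists g, [/\ forall i, L2 (leb \x vol)%E Q (fun z => g z.1 z.2 0 i),
    {ae leb, forall t, I t -> weak_gradient Omega (p t) (g t)} &
    forall chi phi, smooth chi -> smooth phi ->
      (exists2 delta, 0 < delta & forall t, T - delta < t < T -> chi t = 0) ->
      \int[(leb \x vol)%E]_(z in Q) (p z.1 z.2 * ('D_(1 : R) chi z.1 * phi z.2) +
        \sum_i density_flux p g z.1 i z.2 * (chi z.1 * jet phi (lift ord0 i) z.2)) =
      - \int[vol]_(x in Omega) (p0 x * (chi 0 * phi x))].
Proof.
move=> pX [pLoo prob _ [g' [grad' L1flux weak]]].
have Lp := class_X_L2 pX; have [_ [g [grad gL2]]] := pX.
have Lg i : L2 (leb \x vol)%E Q (fun z => g z.1 z.2 0 i).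
  exact: (@mixed_L2_integrable R n Omega _ mO mI (fun t x => g t x 0 i) (gL2 i)).
exists g; split=> //.
move=> chi phi schi sphi [delta delta0 chi0].
have [sPhi D1 D2] := tensor_test schi sphi.
set Phi := (fun z => _) in sPhi D1 D2.
have tPhi : test_function Omega T Phi.
  by split=> //; exists delta => // t x tT _; rewrite /Phi/= chi0 ?mul0r.
have /eqP := weak _ tPhi; rewrite addr_eq0 => /eqP <-.
have ip : (leb \x vol)%E.-integrable Q (EFin \o (fun z => p z.1 z.2 * ('D_(1 : R) chi z.1 * phi z.2))).
  apply: (@integrable_tested (unc p) ('D_(1 : R) chi) phi) => //; first exact: smooth_derive.
  exact: integrable_L2.
have sj i : smooth (jet phi (lift ord0 i)) by exact: smooth_jet.
have i1 : (leb \x vol)%E.-integrable Q (EFin \o (fun z => p z.1 z.2 * ('D_(1 : R) chi z.1 * phi z.2) +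
    \sum_i density_flux p g z.1 i z.2 * (chi z.1 * jet phi (lift ord0 i) z.2))).
  apply: integrable_addR => //; apply: integrable_sumR => // i.
  apply: (@integrable_tested (unc (fun t => density_flux p g t i))) => //.
  by apply: integrable_L2 => //; exact: density_flux_L2.
have i2 : (leb \x vol)%E.-integrable Q (EFin \o (fun z => p z.1 z.2 * ('D_(1 : R) chi z.1 * phi z.2) +
    \sum_i flux sigma f p g' z.1 z.2 ord0 i * (chi z.1 * jet phi (lift ord0 i) z.2))).
  apply: integrable_addR => //; apply: integrable_sumR => // i.
  apply: (@integrable_tested (fun z => flux sigma f p g' z.1 z.2 ord0 i)) => //.
  exact: in_L1_integrable (L1flux i).
transitivity (\int[(leb \x vol)%E]_(z in Q) (p z.1 z.2 * ('D_(1 : R) chi z.1 * phi z.2) +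
    \sum_i flux sigma f p g' z.1 z.2 ord0 i * (chi z.1 * jet phi (lift ord0 i) z.2))); last first.
  apply: eq_Rintegral => z _; rewrite D1; congr (_ + _); apply: eq_bigr => i _.
  by rewrite D2 /jet jetofS.
apply: (@Rintegral_ae_sections _ _ _ _ R leb vol I Omega mI mO
  (fun t x => p t x * ('D_(1 : R) chi t * phi x) +
    \sum_i density_flux p g t i x * (chi t * jet phi (lift ord0 i) x))
  (fun t x => p t x * ('D_(1 : R) chi t * phi x) +
    \sum_i flux sigma f p g' t x ord0 i * (chi t * jet phi (lift ord0 i) x))) => //.
have gg' : {ae leb, forall t, I t -> {ae vol, forall x, Omega x -> g t x = g' t x}}.
  apply: filterS2 grad grad' => t H H' tI.
  exact: (weak_gradient_unique oO (H tI) (H' tI)).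
apply: filterS2 gg' Ff => t H H' tI; apply: filterS2 (H tI) (H' tI) => x Hx Hx' Ox.
congr (_ + _); apply: eq_bigr => i _; congr (_ * _).
by rewrite /density_flux /flux !mxE Hx// Hx'.
Qed.

Lemma narrowly_continuous_pair p phi : narrowly_continuous Omega T p -> smooth phi ->
  {within `[0, T], continuous (fun t => \int[vol]_(x in Omega) (p t x * phi x))}.
Proof.
move=> np sphi; have cphi := smooth_continuous sphi.
have [C _ HC] := continuous_bounded_Omega bO cphi.
have : {within `[0, T], continuous (fun t => \int[vol]_(x in Omega) (phi x * p t x))}.
  apply: np; first exact: continuous_subspaceT.
  exists C; split; first exact: num_real.
  move=> K CK x Ox; apply: le_trans (ltW CK); apply: HC; exact: subset_closure.
have -> : (fun t => \int[vol]_(x in Omega) (phi x * p t x)) =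
    (fun t => \int[vol]_(x in Omega) (p t x * phi x)).
  by apply/funext => t; apply: eq_Rintegral => x _; rewrite mulrC.
exact.
Qed.

Lemma integrable_pairing (u : R -> 'rV[R]_n -> R) phi :
  L2 (leb \x vol)%E Q (unc u) -> smooth phi ->
  leb.-integrable I (EFin \o (fun t => \int[vol]_(x in Omega) (u t x * phi x))).
Proof.
move=> Lu sphi; have [C C0 [mphi HC]] := bounded_smooth_Q sphi.
have i1 : (leb \x vol)%E.-integrable Q (EFin \o (unc (fun t x => u t x * phi x))).
  under [X in _ \o X]eq_fun do rewrite mulrC.
  apply: (@integrable_bddM _ _ R (leb \x vol)%E Q (fun z => phi z.2) (unc u) C) => //.
  exact: integrable_L2.
by have [] := @sections_integrable _ _ _ _ R leb vol I Omega mI mO (fun t x => u t x * phi x) i1.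
Qed.

Section difference.
Variables (p0 : 'rV[R]_n -> R) (p q : R -> 'rV[R]_n -> R).
Hypotheses (pX : class_X Omega T p) (qX : class_X Omega T q).
Hypothesis pS : no_flux_weak_solution Omega T sigma f p0 p.
Hypothesis qS : no_flux_weak_solution Omega T sigma f p0 q.

(** In the difference of the two weak formulations the initial data cancel.  Tested
    with [ramp] in time, it makes the pairing of p - q with phi the primitive of the
    pairing of the fluxes, and the energy estimate makes it vanish when phi is a
    rational bump; bumps increase to indicators of boxes. *)
Lemma solutions_agree : forall t, t \in `[0, T] ->
  {ae vol, forall x, Omega x -> p t x = q t x}.
Proof.
have [gp [Lgp gradp weakp]] := weak_formulation_tensor pX pS.
have [gq [Lgq gradq weakq]] := weak_formulation_tensor qX qS.
have Lp := class_X_L2 pX; have Lq := class_X_L2 qX.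
pose U t : 'I_n.+1 -> 'rV[R]_n -> R :=
  jetof (fun x => p t x - q t x) (fun i x => gp t x 0 i - gq t x 0 i).
have U0 t x : U t ord0 x = p t x - q t x by rewrite /U jetof0.
have US t i x : U t (lift ord0 i) x = gp t x 0 i - gq t x 0 i by rewrite /U jetofS.
have LU j : L2 (leb \x vol)%E Q (unc (fun t => U t j)).
  rewrite /U /jetof; case: (unliftP ord0 j) => [i|] _.
      by apply: L2_sub.
  exact: L2_sub.
have [_ probp narp _] := pS; have [_ probq narq _] := qS.
have ipt t : t \in `[0, T] -> vol.-integrable Omega (EFin \o p t).
  by move=> tT; have [p1 p2] := probp _ tT; apply: density_integrable p1 p2 tT; case: pX.
have iqt t : t \in `[0, T] -> vol.-integrable Omega (EFin \o q t).
  by move=> tT; have [q1 q2] := probq _ tT; apply: density_integrable q1 q2 tT; case: qX.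
have iU t : t \in `[0, T] -> vol.-integrable Omega (EFin \o U t ord0).
  move=> tT; have := integrable_subR mO (ipt t tT) (iqt t tT).
  by rewrite (_ : (fun x => p t x - q t x) = U t ord0)//; apply/funext => x; rewrite U0.
have imul (u : 'rV[R]_n -> R) phi : vol.-integrable Omega (EFin \o u) -> smooth phi ->
    vol.-integrable Omega (EFin \o (fun x => u x * phi x)).
  move=> iu sphi; have [C _ HC] := continuous_bounded_Omega bO (smooth_continuous sphi).
  under [X in _ \o X]eq_fun do rewrite mulrC.
  apply: (integrable_bddM (C := C)) iu => //.
    by apply: measurable_funTS; exact: continuous_measurable_rV (smooth_continuous sphi).
  by move=> x Ox; apply: HC; exact: subset_closure.
have cU phi : smooth phi -> {within `[0, T], continuous (fun t => pair0 Omega (U t) phi)}.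
  move=> sphi; pose c1 t := \int[vol]_(x in Omega) (p t x * phi x).
  pose c2 t := \int[vol]_(x in Omega) (q t x * phi x).
  apply: (@subspace_eq_continuous _ _ _ (fun t => c1 t - c2 t)).
    move=> t tT; rewrite inE in tT; rewrite /c1 /c2 /pair0 -RintegralB//.
    - by apply: eq_Rintegral => x _; rewrite U0 mulrBl.
    - by apply: imul => //; exact: ipt.
    - by apply: imul => //; exact: iqt.
  move=> t; apply: cvgB; first exact: (narrowly_continuous_pair narp sphi).
  exact: (narrowly_continuous_pair narq sphi).
pose J phi t := flux_pair Omega (U t) (F t) (diffusion t) phi.
have Lflux i : L2 (leb \x vol)%E Q
    (unc (fun t x => U t ord0 x * F t i x - diffusion t * U t (lift ord0 i) x)).
  have -> : unc (fun t x => U t ord0 x * F t i x - diffusion t * U t (lift ord0 i) x) =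
      (fun z => density_flux p gp z.1 i z.2 - density_flux q gq z.1 i z.2).
    by apply/funext => z; rewrite /density_flux U0 US; ring.
  by apply: L2_sub => //; exact: density_flux_L2.
have iJ phi : smooth phi -> leb.-integrable I (EFin \o J phi).
  move=> sphi; apply: (@integrable_sumR _ _ R leb) => // i.
  by apply: (integrable_pairing (Lflux i)); exact: smooth_jet.
have goodU : {ae leb, forall t, I t -> (forall j, L2 vol Omega (U t j)) /\
    (forall i, measurable_fun Omega (F t i))}.
  have : {ae leb, forall t, forall j, I t -> L2 vol Omega (U t j)}.
    by apply: filter_forall => j; exact: (@L2_section _ _ _ _ R leb vol I Omega mI mO (fun t => U t j) (LU j)).
  apply: filterS => t Ht tI; split=> [j|i]; first exact: Ht.
  exact: (@measurable_section _ _ _ _ R I Omega mI mO (fun t => F t i) t (mF i) tI).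
have goodg p' g : {ae leb, forall t, I t -> weak_gradient Omega (p' t) (g t)} ->
    (forall i, L2 (leb \x vol)%E Q (fun z => g z.1 z.2 0 i)) ->
    {ae leb, forall t, I t -> weak_gradient Omega (p' t) (g t) /\
      forall i, L2 vol Omega (fun x => g t x 0 i)}.
  move=> gradg Lg.
  have : {ae leb, forall t, forall i, I t -> L2 vol Omega (fun x => g t x 0 i)}.
    apply: filter_forall => i.
    exact: (@L2_section _ _ _ _ R leb vol I Omega mI mO (fun t x => g t x 0 i) (Lg i)).
  by apply: filterS2 gradg => t H1 H2 tI; split=> [|i]; [exact: H1|exact: H2].
have weakU phi t0 : smooth phi -> 0 < t0 < T -> forall k, \int[leb]_(t in `]0, T[)
    (pair0 Omega (U t) phi * 'D_(1 : R) (ramp t0 k) t + ramp t0 k t * J phi t) = 0.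
  move=> sphi /andP[t00 t0T] k; set chi := ramp t0 k.
  have schi : smooth chi by exact: smooth_ramp.
  have chi0 : exists2 delta, 0 < delta & forall t, T - delta < t < T -> chi t = 0.
    exists (T - t0); first by rewrite subr_gt0.
    move=> t /andP[+ _]; rewrite opprB addrC subrK => t0t.
    by rewrite /chi /ramp cutoff_eq0// mulr_ge0_le0// subr_le0 ltW.
  pose h p g t x := p t x * ('D_(1 : R) chi t * phi x) +
    \sum_i density_flux p g t i x * (chi t * jet phi (lift ord0 i) x).
  pose hU t x := U t ord0 x * ('D_(1 : R) chi t * phi x) +
    \sum_i (U t ord0 x * F t i x - diffusion t * U t (lift ord0 i) x) *
      (chi t * jet phi (lift ord0 i) x).
  have ih p' g : L2 (leb \x vol)%E Q (unc p') ->
      (forall i, L2 (leb \x vol)%E Q (fun z => g z.1 z.2 0 i)) ->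
      (leb \x vol)%E.-integrable Q (EFin \o unc (h p' g)).
    move=> L1 L2; apply: integrable_addR => //.
      apply: (@integrable_tested (unc p') ('D_(1 : R) chi) phi) => //; first exact: smooth_derive.
      exact: integrable_L2.
    apply: integrable_sumR => // i.
    apply: (@integrable_tested (unc (fun t => density_flux p' g t i))) => //.
      exact: smooth_jet.
    by apply: integrable_L2 => //; exact: density_flux_L2.
  have hE : unc hU = fun z => unc (h p gp) z - unc (h q gq) z.
    apply/funext => z; rewrite /hU /h U0 opprD addrACA -sumrB -mulrBl; congr (_ + _).
    by apply: eq_bigr => i _; rewrite US /density_flux; ring.
  have ihU : (leb \x vol)%E.-integrable Q (EFin \o unc hU).
    by rewrite hE; apply: integrable_subR => //; exact: ih.
  have int0 : \int[(leb \x vol)%E]_(z in Q) hU z.1 z.2 = 0.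
    transitivity (\int[(leb \x vol)%E]_(z in Q) (unc (h p gp) z - unc (h q gq) z)).
      by apply: eq_Rintegral => z _; rewrite -[LHS]/(unc hU z) hE.
    rewrite RintegralB//; [|exact: ih|exact: ih].
    by rewrite (weakp chi phi schi sphi chi0) (weakq chi phi schi sphi chi0) subrr.
  have [_ ihU' E] := @sections_integrable _ _ _ _ R leb vol I Omega mI mO hU ihU.
  apply: etrans int0; rewrite E; apply: (@Rintegral_ae_eq _ _ R leb I mI).
  - apply: measurable_funD; apply: measurable_funM.
    + apply: (@measurable_funS _ _ _ _ (`[0, T]%classic : set (measurableTypeR R))) => //.
        exact: subset_itv_oo_cc.
      by apply: subspace_continuous_measurable_fun => //; exact: cU.
    + apply: measurable_funTS; apply: continuous_measurable_fun.
      exact: (smooth_continuous (smooth_derive _ schi)).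
    + apply: measurable_funTS; apply: continuous_measurable_fun.
      exact: smooth_continuous.
    + by apply/measurable_EFinP; exact: measurable_int (iJ phi sphi).
  - by apply/measurable_EFinP; exact: measurable_int ihU'.
  apply: filterS goodU => t H tI; have [LUt mFt] := H tI.
  have LF i : L2 vol Omega (fun x => U t ord0 x * F t i x - diffusion t * U t (lift ord0 i) x).
    exact: (@L2_flux R n Omega oO (U t) (F t) (diffusion t) M LUt mFt (fun i x _ => bF t i x) i).
  have ii i : vol.-integrable Omega (EFin \o (fun x =>
      (U t ord0 x * F t i x - diffusion t * U t (lift ord0 i) x) * jet phi (lift ord0 i) x)).
    exact: integrable_jetM.
  have i0 : vol.-integrable Omega (EFin \o (fun x => U t ord0 x * phi x)).
    by apply: imul => //; apply: integrable_L2.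
  rewrite /hU /pair0 /J /flux_pair mulrC -RintegralZl// -Rintegral_sum// -RintegralZl//;
    last exact: integrable_sumR.
  rewrite -RintegralD'//; [|exact: integrable_scaleR|by apply: integrable_scaleR => //; exact: integrable_sumR].
  apply: eq_Rintegral => x _; rewrite mulr_sumr mulrCA; congr (_ + _).
  by apply: eq_bigr => i _; rewrite mulrCA.
have zero phi t : in_span phi -> 0 < t < T -> pair0 Omega (U t) phi = 0.
  have a00 : 0 < 2^-1 * eps ^+ 2 by rewrite mulr_gt0// exprn_gt0.
  have T2 : I (T / 2) by rewrite /= in_itv/= divr_gt0//= ltr_pdivrMr// ltr_pMr// ltr1n.
  have /andP[b1 b2] := diffusion_bounds T2.
  apply: (@pair0_span_eq0 R n Omega oO bO T _ _ M U F diffusion HT a00 (le_trans b1 b2)).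
  - move=> {}t /andP[t0 tT]; apply: iU; by rewrite in_itv/= !ltW.
  - apply: filterS3 goodU (goodg _ _ gradp Lgp) (goodg _ _ gradq Lgq) => s H Hp Hq sT.
    have sI : I s by rewrite /= in_itv.
    have [LUs mFs] := H sI; split=> //; last exact: diffusion_bounds.
    apply: (weak_jet_approximable oO bO) => //; first by case: HOmega.
      exact: (Lipschitz_inward HOmega).
    split=> // psi Cpsi i; have [spsi _] := Cpsi.
    have [[_ wp] Lgps] := Hp sI; have [[_ wq] Lgqs] := Hq sI.
    have sT' : s \in `[0, T] by exact: subset_itv_oo_cc.
    have sD : smooth ('D_(delta_mx ord0 i) psi) by exact: smooth_derive.
    have i1 := imul _ _ (ipt s sT') sD; have i2 := imul _ _ (iqt s sT') sD.
    have i3 := imul _ _ (integrable_L2 mO Ofin (Lgps i)) spsi.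
    have i4 := imul _ _ (integrable_L2 mO Ofin (Lgqs i)) spsi.
    under eq_Rintegral do rewrite U0 mulrBl.
    under [in RHS]eq_Rintegral do rewrite US mulrBl.
    by rewrite !RintegralB// (wp psi Cpsi i) (wq psi Cpsi i) opprB addrC opprK.
  - apply: (@integrable_sumR _ _ R leb) => // j.
    by have [] := @sections_integrable _ _ _ _ R leb vol I Omega mI mO (fun t x => U t j x ^+ 2) (LU j).2.
  - move=> psi spsi; apply: measurable_sum => j; apply/measurable_EFinP.
    exact: measurable_int (integrable_pairing (LU j) (smooth_jet j spsi)).
  - exact: iJ.
  - move=> psi spsi s sT.
    exact: (primitive_of_weak (cU psi spsi) (iJ psi spsi) sT (weakU psi s spsi sT)).
  - move=> psi spsi.
    have : compact ((fun t => pair0 Omega (U t) psi) @` `[0, T]%classic).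
      by apply: continuous_compact; [exact: cU|exact: segment_compact].
    move=> /compact_bounded[C [_ HC]]; exists (`|C| + 1) => s sT; apply: HC.
      by rewrite (le_lt_trans (ler_norm C))// ltrDl.
    by exists s => //; apply: subset_itv_oo_cc; rewrite /= in_itv.
  - move=> psi spsi.
    apply: (@measurable_funS _ _ _ _ (`[0, T]%classic : set (measurableTypeR R))) => //.
      exact: subset_itv_oo_cc.
    by apply: subspace_continuous_measurable_fun => //; exact: cU.
move=> t tT.
have zeroT phi : in_span phi -> pair0 Omega (U t) phi = 0.
  move=> sphi; apply: (within_continuous_eq0 HT (cU phi (in_span_smooth sphi))).
    by move=> s; exact: zero.
  by move: tT; rewrite in_itv.
have mUt : measurable_fun Omega (U t ord0).
  by apply/measurable_EFinP; exact: measurable_int (iU t tT).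
have : {ae vol, forall x, Omega x -> U t ord0 x = 0}.
  apply: ae_eq0_qbox => //; first exact: iU.
  move=> a b; pose psi k : 'rV[R]_n -> R := bump k (map_mx ratr a) (map_mx ratr b).
  have L : \int[vol]_(x in Omega) (U t ord0 x * psi k x) @[k --> \oo] -->
      \int[vol]_(x in Omega) (U t ord0 x * \1_(qbox a b) x).
    apply: (Rintegral_cvg (g := fun x => `|U t ord0 x|)) => //.
    - move=> k; apply: measurable_funM => //; apply: measurable_funTS.
      apply: continuous_measurable_rV; exact: (smooth_continuous (smooth_bump _ _ _)).
    - by apply: measurable_funM => //; apply: measurable_indic; exact: measurable_box.
    - by move=> x _; apply: cvgMr; exact: bump_cvg.
    - by apply: integrable_norm; exact: iU.
    - move=> k x _; rewrite normrM ler_piMr//.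
      by rewrite ger0_norm ?bump_ge0 ?bump_le1.
  have -> : \int[vol]_(x in Omega `&` qbox a b) U t ord0 x =
      \int[vol]_(x in Omega) (U t ord0 x * \1_(qbox a b) x).
    rewrite Rintegral_mkcond [RHS]Rintegral_mkcond; apply: eq_Rintegral => x _.
    rewrite !patchE in_setI indicE; case: (x \in Omega) => //=.
    by case: (x \in qbox a b); rewrite ?mulr1 ?mulr0.
  apply: (cvg_unique _ L); first exact: norm_hausdorff.
  have psi0 k : \int[vol]_(x in Omega) (U t ord0 x * psi k x) = 0.
    exact: (zeroT _ (in_span_bump a b k)).
  rewrite /=; under eq_fun do rewrite psi0.
  exact: cvg_cst.
by apply: filterS => x H Ox; apply/eqP; rewrite -subr_eq0 -U0 H.
Qed.

End difference.

End uniqueness.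

Theorem proposition2p6 (R : realType) (d : nat) (Omega : set 'rV[R]_d.+1)
    (T eps : R) (sigma : R -> R) (f : R -> 'rV[R]_d.+1 -> 'rV[R]_d.+1)
    (p0 : 'rV[R]_d.+1 -> R)
    (HOmega : bounded_Lipschitz_domain Omega)
    (HT : 0 < T)
    (Hsigma_meas : measurable_fun `]0, T[ sigma)
    (Heps : 0 < eps)
    (Hsigma : forall t, t \in `]0, T[ -> eps <= sigma t <= eps^-1)
    (Hf : forall i, in_Lebesgue (vol_tx R d.+1) +oo%E (`]0, T[ `*` Omega)
            (fun z => f z.1 z.2 ord0 i))
    (Hp0_L1 : in_Lebesgue (lebesgue_rV R d.+1) 1%E Omega p0)
    (Hp0_Loo : in_Lebesgue (lebesgue_rV R d.+1) +oo%E Omega p0)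
    (p q : R -> 'rV[R]_d.+1 -> R)
    (Hp_class : class_X Omega T p)
    (Hq_class : class_X Omega T q)
    (Hp : no_flux_weak_solution Omega T sigma f p0 p)
    (Hq : no_flux_weak_solution Omega T sigma f p0 q) :
  forall t, t \in `[0, T] ->
    {ae lebesgue_rV R d.+1, forall x, Omega x -> p t x = q t x}.
Proof.
have [M [F [mF bF Ff]]] := bounded_drift Hf.
exact: (solutions_agree HOmega HT Hsigma_meas Heps Hsigma mF bF Ff Hp_class Hq_class Hp Hq).
Qed.
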